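(* There exist constants $c_1,c_2>0$ depending only on $(\tau,\upsilon_1,\kappa_1,\kappa_2,\kappa_u,l_0,\bar f,\underline f)$ and a constant $C>0$ depending only on $(\upsilon_1,\kappa_2,\kappa_u,l_0,\bar f,\underline f)$ such that the following holds. Let $t>0$ and suppose the sample size $n$ and bandwidth $h$ satisfy $$ c_1\,\underline f^{-1}m_3^{1/2}\upsilon_1\sqrt{\frac{p+t}{n}}\ \le\ h\ \le\ c_2\,\underline f\,m_3^{-1/2}. $$ Then, with probability at least $1-3e^{-t}$, $$ \left\|\boldsymbol\Sigma^{-1/2}\mathbf J_h(\hat{\boldsymbol\beta}_h-\boldsymbol\beta^* )-\frac1n\sum_{i=1}^n\{\tau-\mathcal K_h(-\varepsilon_i)\}\boldsymbol\Sigma^{-1/2}\boldsymbol x_i\right\|_2\ \le\ C\left(\frac{p+t}{nh^{1/2}}+h^{3/2}\sqrt{\frac{p+t}{n}}+h^4\right), $$ where $\mathbf J_h=\mathbb E\{K_h(\varepsilon)\boldsymbol x\boldsymbol x^{\top}\}$. When $\mathbf J_h$ on the left-hand side is replaced by $\mathbf J=\mathbb E\{f_{\varepsilon|\boldsymbol x}(0)\boldsymbol x\boldsymbol x^{\top}\}$, the upper bound is of order $\frac{p+t}{nh^{1/2}}+h\sqrt{\frac{p+t}{n}}+h^3$, i.e. it holds with the right-hand side replaced by $C'\big(\frac{p+t}{nh^{1/2}}+h\sqrt{\frac{p+t}{n}}+h^3\big)$ for a constant $C'$ not depending on $n,p,t,h$.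
   Context: Model: fix $\tau\in(0,1)$ and $p\ge 2$. Let $\boldsymbol x=(x_1,\dots,x_p)^{\top}$ be a random vector with $x_1\equiv1$ and $\mathbb E(x_j)=0$ for $j=2,\dots,p$, and $\boldsymbol\Sigma=\mathbb E(\boldsymbol x\boldsymbol x^{\top})$ positive definite. Let $y=\langle\boldsymbol x,\boldsymbol\beta^*\rangle+\varepsilon$ with $\boldsymbol\beta^*\in\mathbb R^p$ and $\mathbb P(\varepsilon\le0\mid\boldsymbol x)=\tau$; $f_{\varepsilon|\boldsymbol x}$ is the conditional density of $\varepsilon$ given $\boldsymbol x$. $(y_i,\boldsymbol x_i)$, $i=1,\dots,n$, are i.i.d. copies of $(y,\boldsymbol x)$, and $\varepsilon_i=y_i-\langle\boldsymbol x_i,\boldsymbol\beta^*\rangle$. Estimator: $\rho_\tau(u)=u\{\tau-\mathbf 1(u<0)\}$, $K_h(u)=h^{-1}K(u/h)$, $\mathcal K_h(u)=\int_{-\infty}^{u/h}K(v)\,dv$, $\ell_h(u)=\int_{-\infty}^\infty\rho_\tau(v)K_h(v-u)\,dv$, $\hat Q_h(\boldsymbol\beta)=\frac1n\sum_{i=1}^n\ell_h(y_i-\langle\boldsymbol x_i,\boldsymbol\beta\rangle)$, and $\hat{\boldsymbol\beta}_h\in\arg\min_{\boldsymbol\beta\in\mathbb R^p}\hat Q_h(\boldsymbol\beta)$. Notation: $\boldsymbol w=\boldsymbol\Sigma^{-1/2}\boldsymbol x$; $m_3=\sup_{\|\boldsymbol u\|_2=1}\mathbb E|\langle\boldsymbol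 u,\boldsymbol w\rangle|^3$; $\kappa_k=\int_{-\infty}^\infty|u|^kK(u)\,du$ (assumed finite for the $k$ that appear). Assumptions: (Kernel) $K$ is symmetric, non-negative, $\int K=1$, and $\kappa_u=\sup_uK(u)<\infty$. (Density) There are constants $\underline f,l_0,\bar f>0$ such that, almost surely, $f_{\varepsilon|\boldsymbol x}(0)\ge\underline f$, $|f_{\varepsilon|\boldsymbol x}(u)-f_{\varepsilon|\boldsymbol x}(v)|\le l_0|u-v|$ for all $u,v\in\mathbb R$, and $\sup_{u\in\mathbb R}f_{\varepsilon|\boldsymbol x}(u)\le\bar f$. (Sub-Gaussian design) There is $\upsilon_1>0$ such that $\mathbb P(|\langle\boldsymbol u,\boldsymbol w\rangle|\ge\upsilon_1t)\le2e^{-t^2/2}$ for all unit vectors $\boldsymbol u\in\mathbb R^p$ and $t\ge0$. *)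

(* Defs.v *)
From HB Require Import structures.
From mathcomp Require Import all_boot all_order all_algebra.
From mathcomp Require Import all_classical all_reals all_analysis.
From mathcomp Require Import measurable_realfun.
Set Implicit Arguments.
Unset Strict Implicit.
Unset Printing Implicit Defensive.
Import Order.TTheory GRing.Theory Num.Theory.
Import numFieldNormedType.Exports.
Local Open Scope classical_set_scope.
Local Open Scope ring_scope.

Definition dot (R : realType) (p : nat) (u v : 'cV[R]_p) : R :=
  \sum_(j < p) u j 0 * v j 0.

(* The library norm on matrices is the sup norm, hence this Euclidean one. *)
Definition norm2 (R : realType) (p : nat) (u : 'cV[R]_p) : R :=
  Num.sqrt (dot u u).

Definition posdefmx (R : realType) (p : nat) (A : 'M[R]_p) : Prop :=
  A^T = A /\ forall v : 'cV[R]_p, v != 0 -> 0 < dot v (A *m v).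

(* A^(-1/2), for A positive definite, is the unique S satisfying this. *)
Definition is_inv_sqrtmx (R : realType) (p : nat) (A S : 'M[R]_p) : Prop :=
  posdefmx S /\ S *m S = invmx A.

(** Random vectors take their values in [p.-tuple R], which carries the product
    sigma-algebra; [vec] gives the corresponding column vector. *)

Definition vec (R : realType) (p : nat) (x : p.-tuple R) : 'cV[R]_p :=
  \col_(j < p) tnth x j.

Definition same_law (d d' : measure_display) (T : measurableType d)
    (S : measurableType d') (R : realType) (P : probability T R)
    (Z Z' : T -> S) : Prop :=
  forall A : set S, measurable A -> P (Z @^-1` A) = P (Z' @^-1` A).

Definition mutually_independent (d d' : measure_display) (T : measurableType d)
    (S : measurableType d') (R : realType) (P : probability T R)
    (n : nat) (Z : 'I_n -> T -> S) : Prop :=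
  forall (I : {set 'I_n}) (A : 'I_n -> set S),
    (forall i, measurable (A i)) ->
    P [set w | forall i, i \in I -> A i (Z i w)] =
    (\prod_(i in I) P (Z i @^-1` A i))%E.

(* [g] is a version of s |-> P(E | X = s) *)
Definition cond_prob (d d' : measure_display) (T : measurableType d)
    (S : measurableType d') (R : realType) (P : probability T R)
    (X : T -> S) (E : set T) (g : S -> \bar R) : Prop :=
  measurable_fun setT g /\
  forall A : set S, measurable A ->
    P (E `&` X @^-1` A) = (\int[P]_(w in X @^-1` A) g (X w))%E.

(* [f s] is the density of [e] given X = s *)
Definition cond_density (d d' : measure_display) (T : measurableType d)
    (S : measurableType d') (R : realType) (P : probability T R)
    (X : T -> S) (e : T -> R) (f : S -> R -> R) : Prop :=
  [/\ measurable_fun setT (fun z : S * R => f z.1 z.2),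
      forall s u, 0 <= f s u &
      forall B : set R, measurable B ->
        cond_prob P X (e @^-1` B)
          (fun s => (\int[lebesgue_measure]_(u in B) (f s u)%:E)%E)].

Section Population.
Context (d : measure_display) (T : measurableType d) (R : realType).
Context (P : probability T R) (p : nat) (X : T -> p.-tuple R).

Definition noise (Y : T -> R) (b : 'cV[R]_p) : T -> R :=
  fun w => Y w - dot (vec (X w)) b.

(* E (Z x x^T), entrywise *)
Definition weighted_gram (Z : T -> R) : 'M[R]_p :=
  \matrix_(j < p, k < p)
    fine ('E_P[fun w => (Z w * (tnth (X w) j * tnth (X w) k))%R])%E.

Definition Sigma_mx : 'M[R]_p := weighted_gram (fun=> 1).

(* m_3, where S stands for Sigma^(-1/2) *)
Definition m3 (S : 'M[R]_p) : R :=
  fine (ereal_sup [set ('E_P[fun w => (`|dot u (S *m vec (X w))| ^+ 3)%R])%E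
                  | u in [set u : 'cV[R]_p | norm2 u = 1]]).

(* The index of the first coordinate, x_1 in the usual numbering, is 0. *)
Record design_assumption : Prop := DesignAssumption {
  design_intercept : forall (j : 'I_p) w, j = 0%N :> nat -> tnth (X w) j = 1;
  design_square_integrable : forall j : 'I_p,
    P.-integrable setT (fun w => (tnth (X w) j ^+ 2)%:E);
  design_centered : forall j : 'I_p, (0 < j)%N ->
    ('E_P[fun w => tnth (X w) j] = 0)%E;
  design_posdef : posdefmx Sigma_mx }.

Definition subgaussian_design (S : 'M[R]_p) (ups1 : R) : Prop :=
  forall (u : 'cV[R]_p) (t : R), norm2 u = 1 -> 0 <= t ->
    (P [set w | (ups1 * t <= `|dot u (S *m vec (X w))|)%R]
      <= (2 * expR (- (t ^+ 2 / 2)))%:E)%E.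

Definition density_assumption (f : p.-tuple R -> R -> R) (flow l0 fbar : R)
    : Prop :=
  {ae P, forall w,
    [/\ flow <= f (X w) 0,
        forall u v, `|f (X w) u - f (X w) v| <= l0 * `|u - v| &
        forall u, f (X w) u <= fbar]}.

End Population.

Section Smoothing.
Context (R : realType).

Definition abs_moment (K : R -> R) (k : nat) : \bar R :=
  (\int[lebesgue_measure]_u (`|u| ^+ k * K u)%:E)%E.

Record kernel_assumption (K : R -> R) (kap1 kap2 kapu : R) : Prop :=
  KernelAssumption {
  kernel_measurable : measurable_fun setT K;
  kernel_sym : forall u, K (- u) = K u;
  kernel_ge0 : forall u, 0 <= K u;
  kernel_int1 : (\int[lebesgue_measure]_u (K u)%:E)%E = 1%E;
  kernel_moment1 : abs_moment K 1 = kap1%:E;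
  kernel_moment2 : abs_moment K 2 = kap2%:E;
  kernel_sup : ereal_sup [set (K u)%:E | u in setT] = kapu%:E }.

Definition rho (tau u : R) : R := u * (tau - (u < 0)%R%:R).

Definition scaled_kernel (K : R -> R) (h u : R) : R := h^-1 * K (u / h).

Definition smooth_cdf (K : R -> R) (h u : R) : R :=
  \int[lebesgue_measure]_(v in `]-oo, u / h]) K v.

Definition smooth_loss (tau : R) (K : R -> R) (h u : R) : R :=
  \int[lebesgue_measure]_v (rho tau v * scaled_kernel K h (v - u)).

Definition smooth_risk (tau : R) (K : R -> R) (h : R) (n p : nat)
    (y : 'I_n -> R) (x : 'I_n -> 'cV[R]_p) (b : 'cV[R]_p) : R :=
  n%:R^-1 * \sum_(i < n) smooth_loss tau K h (y i - dot (x i) b).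

Definition is_minimizer (p : nat) (Q : 'cV[R]_p -> R) (b : 'cV[R]_p) : Prop :=
  forall b', Q b <= Q b'.

End Smoothing.

Section Bahadur.
Context (d : measure_display) (T : measurableType d) (R : realType).

Definition Jh_mx (P : probability T R) (p : nat) (X : T -> p.-tuple R)
    (e : T -> R) (K : R -> R) (h : R) : 'M[R]_p :=
  weighted_gram P X (fun w => scaled_kernel K h (e w)).

Definition J_mx (P : probability T R) (p : nat) (X : T -> p.-tuple R)
    (f : p.-tuple R -> R -> R) : 'M[R]_p :=
  weighted_gram P X (fun w => f (X w) 0).

Definition bahadur_remainder (tau : R) (K : R -> R) (h : R) (n p : nat)
    (Xs : 'I_n -> T -> p.-tuple R) (Ys : 'I_n -> T -> R)
    (S J : 'M[R]_p) (betastar : 'cV[R]_p) (betahat : T -> 'cV[R]_p) (w : T) : R :=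
  norm2 (S *m J *m (betahat w - betastar)
    - n%:R^-1 *: \sum_(i < n)
        (tau - smooth_cdf K h (- noise (Xs i) (Ys i) betastar w))
          *: (S *m vec (Xs i w))).

End Bahadur.

(* Main.v *)
Require Import Defs.
From HB Require Import structures.
From mathcomp Require Import all_boot all_order all_algebra.
From mathcomp Require Import all_classical all_reals all_analysis.
From mathcomp Require Import measurable_realfun.
From mathcomp Require Import ring lra.
Set Implicit Arguments.
Unset Strict Implicit.
Unset Printing Implicit Defensive.
Import Order.TTheory GRing.Theory Num.Theory.
Import numFieldNormedType.Exports.
Local Open Scope classical_set_scope.
Local Open Scope ring_scope.

(** Notation of this comment: [L a x = <a, S x>] is a linear form of the
    standardized design, [G = smooth_cdf K h] the smoothed indicator, [W a] the
    increment [G (L a x - e) - G (- e)] at an observation with design [x] and noise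
    [e], [r = (p + t) / n], and [delta = S^-1 (betahat - betastar)].

    The smoothed loss is convex with slope [tau - G (- u)], so that at a minimizer
    the empirical mean of [(tau - G (L delta x - e)) S x] vanishes
    ([minimizer_first_order]). Hence the empirical mean of [W delta S x] equals that
    of the score [(tau - G (- e)) S x], which is the stochastic term of the
    expansion, and the remainder is the norm of [S J S delta] minus the empirical
    mean of [W delta S x] ([bahadur_remainderE]). It has a population part and a
    fluctuation.

    Population part. Given the design, the mean of [W a] is [L a x] times the mean
    of the scaled kernel, up to [l0 (L a x) ^ 2], because the conditional
    distribution function has an [l0]-Lipschitz derivative
    ([conditional_mean_linear]). As the design is sub-Gaussian, this integrates to
    [O (|a| ^ 2)] ([kernel_gram_pop_mean]). Replacing the mean of the scaled kernel by
    [f x 0], that is [J_h] by [J], costs [O (h |a|)] ([density_gram_kernel_gram]).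

    Fluctuation. An increment of [W] over a distance [eta] is at most of order
    [eta / h], but only of order [eta] on average over the noise, so its second moment is
    of order [eta ^ 2 / h] ([cdf_incr_second_moment]). Exponential moments of this
    size and a chaining argument over lattice nets ([chaining]) give a bound of order
    [rho sqrt (r / h)], uniformly over the ball of radius [rho]
    ([increment_process_bound]). The score deviates from its mean by
    [O (sqrt r)] ([score_process_bound]), and this mean is [O (h ^ 2)] because the
    kernel is symmetric ([conditional_mean_bias]).

    Localization. Let [rho = C0 (sqrt r + h ^ 2)], which is the size of the score.
    On the sphere of radius [rho] the scalar product of [a] with the empirical mean
    of [W a S x] is at least [(flow / 2) rho ^ 2] when [h] is small, and it grows
    along rays, [G] being monotone. As the score is too small to balance it outside
    the ball, [|delta| <= rho] ([emp_mean_localization]). Since [m3 >= 1]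
    ([m3_ge1]), the lower bound on [h] forces [sqrt r <= h], so that [rho] is of order
    [h] and the relative fluctuation [sqrt (r / h)] at most [sqrt h]; all the
    smallness conditions then are upper bounds on [h] ([bandwidth_cap_small]).

    With [|delta| <= rho] the remainder is at most of order
    [rho ^ 2 + rho sqrt (r / h)], plus [h rho] for [J], and this is the announced
    rate ([remainder_rate_Jh], [remainder_rate_J]). *)

(** * Integrals against densities, weighted laws, independence, disintegration *)

Section DensityMeasure.
Local Open Scope ereal_scope.
Context d (T : measurableType d) (R : realType) (mu : {measure set T -> \bar R}).
Variable g : T -> R.
Hypotheses (mg : measurable_fun setT g) (g0 : forall x, (0 <= g x)%R).

(** The two proofs are arguments so that the measure structure can be attached to
    this term. *)
Definition density_measure of measurable_fun setT g & (forall x, (0 <= g x)%R) :=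
  fun A : set T => \int[mu]_(x in A) (g x)%:E.

Local Notation nu := (density_measure mg g0).

Let nu0 : nu set0 = 0. Proof. exact: integral_set0. Qed.
Let nu_ge0 A : 0 <= nu A. Proof. by apply: integral_ge0 => x _; rewrite lee_fin. Qed.
Let nu_add : semi_sigma_additive nu.
Proof.
apply: semi_sigma_additive_nng_induced => //; exact/measurable_EFinP.
Qed.

HB.instance Definition _ := isMeasure.Build _ _ _ nu nu0 nu_ge0 nu_add.

Import HBNNSimple.

(** By monotone convergence from simple functions. *)
Lemma ge0_integral_density (f : T -> \bar R) :
  measurable_fun setT f -> (forall x, 0 <= f x) ->
  \int[nu]_x f x = \int[mu]_x (f x * (g x)%:E).
Proof.
move=> mf f0.
pose f_ := nnsfun_approx measurableT mf.
have cvgf x : (f_ n x)%:E @[n --> \oo] --> f x by exact: cvg_nnsfun_approx.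
have ndf x : {homo (fun n => (f_ n x)%:E) : m n / (m <= n)%N >-> m <= n}.
  by move=> m n mn; rewrite lee_fin; exact/lefP/nd_nnsfun_approx.
transitivity (limn (fun n => \int[nu]_x (f_ n x)%:E)).
  rewrite -monotone_convergence//.
  - by apply: eq_integral => y _; apply/esym/cvg_lim.
  - by move=> n; exact/measurable_EFinP/measurable_funP.
  - by move=> n y _; rewrite lee_fin.
have mfn n : measurable_fun setT (fun x => (f_ n x)%:E).
  exact/measurable_EFinP/measurable_funP.
transitivity (limn (fun n => \int[mu]_x ((f_ n x)%:E * (g x)%:E))); last first.
  rewrite -monotone_convergence//.
  - apply: eq_integral => y _; apply/cvg_lim => //.
    exact: cvgeZr.
  - by move=> n; apply: emeasurable_funM => //; exact/measurable_EFinP.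
  - by move=> n x _; rewrite mule_ge0// lee_fin.
  - by move=> x _ m n mn; rewrite lee_wpmul2r ?lee_fin//; exact/lefP/nd_nnsfun_approx.
congr (limn _); apply/funext => n.
have mk r : measurable (f_ n @^-1` [set r]).
  by rewrite -(setTI (_ @^-1` _)); exact: (measurable_funP (f_ n)).
rewrite integral_nnsfun// patch_setT.
rewrite sintegralE.
transitivity (\sum_(k \in range (f_ n))
    \int[mu]_x ((k * \1_(f_ n @^-1` [set k]) x)%:E * (g x)%:E)).
  apply: eq_fsbigr => r /[!inE] -[z _ <-].
  under [RHS]eq_integral do rewrite EFinM -muleA.
  rewrite ge0_integralZl//; last 3 first.
  - by apply: emeasurable_funM => //; exact/measurable_EFinP.
  - by move=> x _; rewrite mule_ge0// lee_fin.
  - by rewrite lee_fin.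
  rewrite [X in _ * X = _](_ : _ =
      \int[mu]_(x in f_ n @^-1` [set f_ n z]) (g x)%:E)//.
  congr (_ * _); rewrite [LHS]integral_mkcond.
  apply: eq_integral => x _; rewrite patchE indicE.
  by case: ifP; rewrite ?mul1e ?mul0e.
rewrite -ge0_integral_fsum//.
- apply: eq_integral => x _; rewrite -ge0_mule_fsuml.
    by rewrite fsumEFin// -fimfunE.
  by move=> r; rewrite nnfun_muleindic_ge0.
- move=> r; apply: emeasurable_funM => //; apply/measurable_EFinP => //.
  by apply: measurable_funM => //; exact: measurable_indic.
- by move=> r x _; rewrite mule_ge0 ?EFinM ?nnfun_muleindic_ge0// lee_fin.
Qed.

End DensityMeasure.

Section WeightedLaw.
Local Open Scope ereal_scope.
Context d1 d2 d (T1 : measurableType d1) (T2 : measurableType d2)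
  (S : measurableType d) (R : realType).
Variables (mu1 : {measure set T1 -> \bar R}) (mu2 : {measure set T2 -> \bar R}).
Variables (Z1 : T1 -> S) (Z2 : T2 -> S) (g1 : T1 -> R) (g2 : T2 -> R).
Hypotheses (mZ1 : measurable_fun setT Z1) (mZ2 : measurable_fun setT Z2).
Hypotheses (mg1 : measurable_fun setT g1) (mg2 : measurable_fun setT g2).
Hypotheses (g1_ge0 : forall x, (0 <= g1 x)%R) (g2_ge0 : forall x, (0 <= g2 x)%R).

(** Finite measures that agree on a generating pi-system are equal; applied to the
    images under [Z1] and [Z2] of the measures with densities [g1] and [g2]. Product
    formulas, equality in law and disintegration are all instances. *)
Lemma ge0_weighted_law_eq (G : set (set S)) :
  measurable = <<s G >> -> setI_closed G -> G setT ->
  \int[mu1]_x (g1 x)%:E < +oo ->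
  (forall A, G A -> \int[mu1]_(x in Z1 @^-1` A) (g1 x)%:E =
                    \int[mu2]_(x in Z2 @^-1` A) (g2 x)%:E) ->
  forall phi : S -> \bar R, measurable_fun setT phi -> (forall s, 0 <= phi s) ->
  \int[mu1]_x (phi (Z1 x) * (g1 x)%:E) = \int[mu2]_x (phi (Z2 x) * (g2 x)%:E).
Proof.
move=> GE GI GT fin1 eqG phi mphi phi0.
rewrite -(ge0_integral_density mu1 mg1 g1_ge0 (f := phi \o Z1))//; last 2 first.
- exact: measurableT_comp.
- by move=> x; exact: phi0.
rewrite -(ge0_integral_density mu2 mg2 g2_ge0 (f := phi \o Z2))//; last 2 first.
- exact: measurableT_comp.
- by move=> x; exact: phi0.
have := @ge0_integral_pushforward _ _ _ _ _ _ mZ1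
  (density_measure mu1 mg1 g1_ge0) setT phi measurableT mphi (fun s _ => phi0 s).
rewrite preimage_setT => <-.
have := @ge0_integral_pushforward _ _ _ _ _ _ mZ2
  (density_measure mu2 mg2 g2_ge0) setT phi measurableT mphi (fun s _ => phi0 s).
rewrite preimage_setT => <-.
apply: eq_measure_integral => A mA _.
apply: (measure_unique G (fun=> setT)) => //.
- by rewrite bigcup_const//; exists O.
Qed.

End WeightedLaw.

Section Independence.
Local Open Scope ereal_scope.
Context d d' (T : measurableType d) (S : measurableType d') (R : realType).
Variables (P : probability T R) (n : nat) (Z : 'I_n -> T -> S).
Hypothesis mZ : forall i, measurable_fun setT (Z i).
Hypothesis indepZ : mutually_independent P Z.

(** Mutual independence is the case of indicator functions. The general case
    replaces one indicator after the other: with all factors but one frozen into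
    the weight, both sides are integrals against weighted laws, which agree as soon
    as they agree on indicators. *)
Lemma independent_integral_prod (phi : 'I_n -> S -> R) (m : 'I_n -> R) :
  (forall i, measurable_fun setT (phi i)) ->
  (forall i s, (0 <= phi i s)%R) ->
  (forall i, \int[P]_w (phi i (Z i w))%:E = (m i)%:E) ->
  \int[P]_w (\prod_(i < n) phi i (Z i w))%:E = (\prod_(i < n) m i)%:E.
Proof.
suff H k : (k <= n)%N -> forall (phi : 'I_n -> S -> R) (m : 'I_n -> R),
    (forall i, measurable_fun setT (phi i)) ->
    (forall i s, (0 <= phi i s)%R) ->
    (forall i, \int[P]_w (phi i (Z i w))%:E = (m i)%:E) ->
    (forall i : 'I_n, (k <= i)%N ->
      exists2 A, measurable A & phi i = \1_A) ->
    \int[P]_w (\prod_(i < n) phi i (Z i w))%:E = (\prod_(i < n) m i)%:E.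
  move=> mphi phi0 eqm; apply: (H n) => // i ni.
  by have := ltn_ord i; rewrite ltnNge ni.
(* Induction on the number of leading factors that are not indicators. *)
elim: k => [_|k IH kn] {}phi {}m mphi phi0 eqm Aphi.
  have /choice[A AP] : forall i, exists A, measurable A /\ phi i = \1_A.
    by move=> i; have [//|A mA ->] := Aphi i; exists A.
  have mZA i : measurable (Z i @^-1` A i).
    by rewrite -[X in measurable X]setTI; apply: mZ => //; have [] := AP i.
  have eqP i : P (Z i @^-1` A i) = (m i)%:E.
    rewrite -eqm -(setIT (_ @^-1` _)) -integral_indic//.
    by apply: eq_integral => w _; rewrite (AP i).2 /= !indicE.
  pose E := \bigcap_(i in [set: 'I_n]) (Z i @^-1` A i).
  have mE : measurable E.
    by apply: fin_bigcap_measurable => // i _; exact: mZA.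
  transitivity (\int[P]_w (\1_E w)%:E).
    apply: eq_integral => w _; congr EFin.
    rewrite indicE; case: (boolP (w \in E)) => [/set_mem wE|wE].
      rewrite big1// => i _; rewrite (AP i).2 indicE mem_set//; exact: wE.
    have /existsNP[i wi] : ~ (forall i, A i (Z i w)).
      by move=> h; move: wE; rewrite mem_set// => i _; exact: h.
    by rewrite (bigD1 i)//= (AP i).2 indicE memNset// mul0r.
  rewrite integral_indic// setIT.
  have := @indepZ [set: 'I_n]%SET A (fun i => (AP i).1).
  rewrite (_ : [set w | _] = E).
    move=> PE; apply: etrans PE _.
    rewrite -prodEFin (eq_bigl xpredT); last by move=> i; rewrite inE.
    by apply: eq_bigr => i _; exact: eqP.
  apply/seteqP; split => [w h i _|w h i _]; first by apply: h; rewrite inE.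
  exact: h.
pose j := Ordinal kn.
pose C := (\prod_(i < n | i != j) m i)%R.
have m0 i : (0 <= m i)%R.
  by rewrite -lee_fin -eqm; apply: integral_ge0 => w _; rewrite lee_fin.
have C0 : (0 <= C)%R by apply: prodr_ge0.
pose g1 w := (\prod_(i < n | i != j) phi i (Z i w))%R.
have mg1 : measurable_fun setT g1.
  rewrite /g1; under eq_fun do rewrite -big_filter.
  by apply: measurable_prod => i _; exact: measurableT_comp.
have g10 w : (0 <= g1 w)%R by apply: prodr_ge0.
have step A : measurable A ->
    \int[P]_(x in Z j @^-1` A) (g1 x)%:E = C%:E * P (Z j @^-1` A).
  move=> mA; have mZA : measurable (Z j @^-1` A).
    by rewrite -[X in measurable X]setTI; exact: mZ.
  pose phi' i := if i == j then (\1_A : S -> R) else phi i.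
  pose m' i := if i == j then fine (P (Z j @^-1` A)) else m i.
  have m'E : (\prod_(i < n) m' i = C * fine (P (Z j @^-1` A)))%R.
    rewrite (bigD1 j)//= mulrC; congr (_ * _)%R; last by rewrite /m' eqxx.
    by apply: eq_bigr => i /negbTE ij; rewrite /m' ij.
  have phi'E w : (\prod_(i < n) phi' i (Z i w) = \1_A (Z j w) * g1 w)%R.
    rewrite (bigD1 j)//=; congr (_ * _)%R; first by rewrite /phi' eqxx.
    by apply: eq_bigr => i /negbTE ij; rewrite /phi' ij.
  have := IH (ltnW kn) phi' m' _ _ _ _.
  rewrite m'E EFinM fineK ?fin_num_measure// => <-.
  - rewrite integral_mkcond; apply: eq_integral => w _.
    rewrite phi'E patchE indicE.
    rewrite (_ : (w \in _) = (Z j w \in A)); last by apply/idP/idP; rewrite !inE.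
    by case: ifP; rewrite ?mul1r ?mul0r.
  - by move=> i; rewrite /phi'; case: ifP.
  - by move=> i s; rewrite /phi'; case: ifP => // _; rewrite indicE.
  - move=> i; rewrite /phi' /m'; case: ifPn => [/eqP ->|//].
    rewrite fineK ?fin_num_measure// -[X in P X]setIT -integral_indic//.
  - move=> i ki; rewrite /phi'; case: ifPn => [_|ij]; first by exists A.
    apply: Aphi; rewrite ltn_neqAle ki andbT.
    by apply: contra ij => /eqP ki'; apply/eqP/val_inj.
have := @ge0_weighted_law_eq _ _ _ _ _ _ _ P P (Z j) (Z j) g1 (fun=> C) (mZ j) (mZ j) mg1 _ g10 _
   measurable _ _ _ _ _ (EFin \o phi j) _ _.
rewrite (bigD1 j)//= -/C mulrC EFinM -eqm.
under [in X in _ -> X]eq_integral do rewrite (bigD1 j)//= -/(g1 _) EFinM.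
move=> -> //.
- by under eq_integral do rewrite muleC; rewrite ge0_integralZl//;
    [apply/measurable_EFinP; exact: measurableT_comp | move=> *; rewrite lee_fin].
- by rewrite sigma_algebra_id//; exact: sigma_algebra_measurable.
- by move=> A B; exact: measurableI.
- by have := step setT measurableT; rewrite preimage_setT probability_setT => ->; rewrite mule1 ltry.
- move=> A mA; rewrite step// integral_cst//.
  by rewrite -[X in measurable X]setTI; exact: mZ.
- exact/measurable_EFinP.
- by move=> s; rewrite lee_fin.
Qed.

End Independence.

Section Disintegration.
Local Open Scope ereal_scope.
Context d d' (T : measurableType d) (S : measurableType d') (R : realType).
Variables (P : probability T R) (X : T -> S) (e : T -> R) (f : S -> R -> R).
Hypotheses (mX : measurable_fun setT X) (me : measurable_fun setT e).
Hypothesis ef : cond_density P X e f.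

Lemma measurable_cond_density : measurable_fun setT (fun z : T * R => f (X z.1) z.2).
Proof.
have [mf _ _] := ef.
apply: (measurableT_comp mf (g := fun z : T * R => (X z.1, z.2))).
apply/measurable_fun_pairP; split => /=; last exact: measurable_snd.
exact: (measurableT_comp mX measurable_fst).
Qed.

(** The specification of a conditional density says that two weighted laws agree
    on measurable rectangles. *)
Lemma ge0_disintegration (phi : S * R -> \bar R) :
  measurable_fun setT phi -> (forall z, 0 <= phi z) ->
  \int[P]_w phi (X w, e w) =
  \int[P]_w \int[lebesgue_measure]_u (phi (X w, u) * (f (X w) u)%:E).
Proof.
move=> mphi phi0; have [mf f0 fP] := ef.
have mXe : measurable_fun setT (fun w => (X w, e w)) by apply/measurable_fun_pairP.
have mXu : measurable_fun setT (fun z : T * R => (X z.1, z.2)).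
  apply/measurable_fun_pairP; split => /=; last exact: measurable_snd.
  exact: (measurableT_comp mX measurable_fst).
pose G := [set A `*` B | A in @measurable _ S & B in @measurable _ R].
have := @ge0_weighted_law_eq _ _ _ _ _ _ R P (P \x lebesgue_measure)
   (fun w => (X w, e w)) (fun z : T * R => (X z.1, z.2)) (fun=> 1%R)
   (fun z : T * R => f (X z.1) z.2) mXe mXu _ measurable_cond_density _ _ G.
under [in X in _ -> X]eq_integral do rewrite -[phi _]mule1.
move=> -> //.
- rewrite fubini_tonelli1//.
  + apply: emeasurable_funM; first exact: measurableT_comp.
    by apply/measurable_EFinP; exact: measurable_cond_density.
  + by move=> z; rewrite mule_ge0// lee_fin.
- by rewrite measurable_prod_measurableType.
- move=> _ _ [A mA [B mB <-]] [A' mA' [B' mB' <-]].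
  by rewrite -setXI; exists (A `&` A'); [exact: measurableI|exists (B `&` B') => //; exact: measurableI].
- by exists setT => //; exists setT => //; rewrite setXTT.
- rewrite (_ : \int[P]_x _ = 1) ?ltry//.
  by rewrite (integral_cst P measurableT 1) mul1e; exact: probability_setT.
- move=> _ [A mA [B mB <-]].
  have mXA : measurable (X @^-1` A) by rewrite -[X in measurable X]setTI; exact: mX.
  have meB : measurable (e @^-1` B) by rewrite -[X in measurable X]setTI; exact: me.
  have [mg /(_ A mA)] := fP B mB.
  rewrite (_ : (fun w => (X w, e w)) @^-1` (A `*` B) =
      e @^-1` B `&` X @^-1` A); last first.
    by apply/seteqP; split => w /= -[].
  move=> PE; transitivity (P (e @^-1` B `&` X @^-1` A)).
    by rewrite integral_cst ?mul1e; last exact: measurableI.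
  rewrite {}PE [in RHS]integral_mkcond.
  rewrite [RHS]fubini_tonelli1.
  + rewrite integral_mkcond; apply: eq_integral => w _.
    rewrite /fubini_F patchE; case: ifPn => wA.
      rewrite [LHS]integral_mkcond; apply: eq_integral => u _.
      rewrite !patchE.
      rewrite (_ : (w, u) \in _ = (u \in B))//.
      by move: wA; rewrite inE /= => XA; apply/idP/idP; rewrite !inE //= => -[].
    rewrite [RHS]integral0_eq// => u _; rewrite patchE memNset// => -[/= XA _].
    by move: wA; rewrite mem_set.
  + have mAB : measurable ((fun z : T * R => (X z.1, z.2)) @^-1` (A `*` B)).
      by have := mXu measurableT _ (measurableX mA mB); rewrite setTI.
    have mf2 : measurable_fun setT (fun z : T * R => (f (X z.1) z.2)%:E).
      by apply/measurable_EFinP; exact: measurable_cond_density.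
    exact: (measurable_restrictT _ mAB).1 (measurable_funTS mf2).
  + by move=> z; apply: erestrict_ge0 => ? _; rewrite lee_fin.
Qed.

End Disintegration.

(** * Distribution functions, the kernel and the smoothed loss *)

Section AffineSubstitution.
Local Open Scope ereal_scope.
Context (R : realType).
Local Notation leb := (@lebesgue_measure R).
Variables (h b : R).
Hypothesis h_gt0 : (0 < h)%R.

Let aff : measurableTypeR R -> measurableTypeR R := fun z => (h * z + b)%R.
Let maff : measurable_fun setT aff.
Proof.
by apply: measurable_funD => //; exact: measurable_funM.
Qed.
Let aff_mixin := isMeasurableFun.Build _ _ _ _ _ maff.
Let aff_pack : {mfun _ >-> _} := HB.pack aff aff_mixin.

Lemma lebesgue_measure_affine (A : set R) : measurable A ->
  leb A = h%:E * leb [set z | A (h * z + b)%R].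
Proof.
pose hn := NngNum (ltW h_gt0).
move=> mA; apply: (@lebesgue_measure_unique R (mscale hn (pushforward leb aff_pack))) => //.
move=> _ [[x y] _ <-]; rewrite /mscale /pushforward /=.
change (leb `]x, y] = h%:E * leb (aff @^-1` `]x, y])).
rewrite (_ : aff @^-1` `]x, y] = `]((x - b) / h)%R, ((y - b) / h)%R]%classic); last first.
  apply/seteqP; split => z /=; rewrite !in_itv /= ltr_pdivrMr// ler_pdivlMr//.
    by rewrite ltrBlDr lerBrDr mulrC.
  by rewrite ltrBlDr lerBrDr mulrC.
rewrite !lebesgue_measure_itv/= !lte_fin ltr_pM2r ?invr_gt0// ltrD2r.
case: ifP => _; last by rewrite mule0.
by rewrite -!EFinD -EFinM; congr EFin; field; rewrite gt_eqF.
Qed.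

Lemma ge0_integral_affine (f : R -> \bar R) :
  measurable_fun setT f -> (forall x, 0 <= f x) ->
  \int[leb]_x f x = h%:E * \int[leb]_z f (h * z + b)%R.
Proof.
move=> mf f0; pose hn := NngNum (ltW h_gt0).
(* The measure structure of a push-forward awaits the measurability proof. *)
pose nu := (mscale hn (pushforward leb aff_pack) :
  {measure set (measurableTypeR R) -> \bar R}).
transitivity (\int[nu maff]_x f x).
  by apply: eq_measure_integral => A mA _; exact: lebesgue_measure_affine.
rewrite ge0_integral_mscale//=; congr (_ * _).
have := @ge0_integral_pushforward _ _ _ _ _ _ maff leb setT f measurableT mf (fun x _ => f0 x).
by rewrite preimage_setT.
Qed.

End AffineSubstitution.

Section OppSubstitution.
Local Open Scope ereal_scope.
Context (R : realType).
Local Notation leb := (@lebesgue_measure R).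

Lemma ge0_integral_opp (f : R -> \bar R) :
  measurable_fun setT f -> (forall x, 0 <= f x) ->
  \int[leb]_x f x = \int[leb]_z f (- z)%R.
Proof.
move=> mf f0.
transitivity (\int[pushforward leb (-%R : _ -> measurableTypeR R)]_x f x).
  by apply: eq_measure_integral => A mA _; exact/esym/lebesgue_measureN.
have := @ge0_integral_pushforward _ _ _ _ _ (-%R : measurableTypeR R -> measurableTypeR R)
  (@oppr_measurable R setT) leb setT f measurableT mf (fun x _ => f0 x).
by rewrite preimage_setT.
Qed.

End OppSubstitution.

Lemma eq_ler (R : realType) (x y : R) : x = y -> x <= y.
Proof. by move=> ->. Qed.

Lemma measurable_comparison d (T : measurableType d) (R : realType) (b : T -> bool) :
  measurable_fun setT b -> measurable_fun setT (fun x => (b x)%:R : R).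
Proof.
move=> mb; rewrite (_ : (fun x => _) = (fun x => if b x then 1 else 0)).
  exact: measurable_fun_ifT.
by apply/funext => x; case: (b x).
Qed.

Section Integrability.
Context d (T : measurableType d) (R : realType) (mu : {measure set T -> \bar R}).

Lemma integrable_bounded_mul (g phi : T -> R) (M : R) :
  mu.-integrable setT (EFin \o g) -> measurable_fun setT phi ->
  (forall x, `|phi x| <= M) ->
  mu.-integrable setT (EFin \o (fun x => phi x * g x)).
Proof.
move=> ig mphi phiM; have mg := measurable_int _ ig.
apply: (@le_integrable _ _ _ _ setT measurableT _ (fun x => (M%:E * (g x)%:E)%E)).
- apply/measurable_EFinP/measurable_funM => //; exact/measurable_EFinP.
- move=> x _; rewrite -EFinM /= lee_fin !normrM ler_wpM2r//.
  by rewrite (le_trans (phiM x))// ler_norm.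
- exact: integrableZl.
Qed.

Lemma integrableRD (f g : T -> R) : mu.-integrable setT (EFin \o f) ->
  mu.-integrable setT (EFin \o g) ->
  mu.-integrable setT (EFin \o (fun x => f x + g x)).
Proof. by move=> hf hg; exact: (integrableD measurableT hf hg). Qed.

Lemma integrableRB (f g : T -> R) : mu.-integrable setT (EFin \o f) ->
  mu.-integrable setT (EFin \o g) ->
  mu.-integrable setT (EFin \o (fun x => f x - g x)).
Proof. by move=> hf hg; exact: (integrableB measurableT hf hg). Qed.

Lemma integrableRZ (c : R) (f : T -> R) : mu.-integrable setT (EFin \o f) ->
  mu.-integrable setT (EFin \o (fun x => c * f x)).
Proof. by move=> hf; exact: (integrableZl measurableT c hf). Qed.

Lemma le_normr_RintegralT (f g : T -> R) :
  mu.-integrable setT (EFin \o f) -> mu.-integrable setT (EFin \o g) ->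
  (forall x, `|f x| <= g x) ->
  `|\int[mu]_x f x| <= \int[mu]_x g x.
Proof.
move=> hf hg fg; apply: (le_trans (le_normr_Rintegral measurableT hf)).
apply: le_Rintegral => //; exact: (integrable_norm hf).
Qed.

Lemma integrable_ge0_lty (g : T -> R) :
  measurable_fun setT g -> (forall x, 0 <= g x) ->
  (\int[mu]_x (g x)%:E < +oo)%E -> mu.-integrable setT (EFin \o g).
Proof.
move=> mg g0 goo; apply/integrableP; split; first exact/measurable_EFinP.
by under eq_integral => x _ do rewrite /= ger0_norm//.
Qed.

End Integrability.

Definition distr_fun (R : realType) (g : R -> R) (x : R) : R :=
  \int[lebesgue_measure]_(v in `]-oo, x]) g v.

Section Cdf.
Context (R : realType) (g : R -> R) (M : R).
Local Notation leb := (@lebesgue_measure R).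
Hypotheses (mg : measurable_fun setT g) (g0 : forall u, 0 <= g u).
Hypothesis (g1 : (\int[leb]_u (g u)%:E = 1)%E).

Lemma density_integrable (D : set R) : measurable D ->
  leb.-integrable D (EFin \o g).
Proof.
move=> mD; apply: (@integrableS _ _ _ leb setT) => //.
by apply: integrable_ge0_lty => //; rewrite g1 ltry.
Qed.

Lemma density_Rintegral1 : \int[leb]_u g u = 1.
Proof. by rewrite /Rintegral g1. Qed.

Lemma cdfB a b : a <= b -> distr_fun g b - distr_fun g a = \int[leb]_(v in `]a, b]) g v.
Proof. by move=> ab; rewrite Rintegral_itvB//; exact: density_integrable. Qed.

Lemma cdf_ndecr a b : a <= b -> distr_fun g a <= distr_fun g b.
Proof. by move=> ab; rewrite -subr_ge0 cdfB// Rintegral_ge0. Qed.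

Lemma cdf_ge0 a : 0 <= distr_fun g a. Proof. exact: Rintegral_ge0. Qed.

Lemma cdf_le1 a : distr_fun g a <= 1.
Proof.
rewrite -density_Rintegral1 /distr_fun Rintegral_mkcond.
apply: le_Rintegral => //.
- rewrite -restrict_EFin; apply/(integrable_mkcond _ _).1 => //.
  exact: density_integrable.
- exact: density_integrable.
- by move=> x _; rewrite patchE; case: ifP.
Qed.

Lemma measurable_cdf : measurable_fun setT (distr_fun g).
Proof. by apply: nondecreasing_measurable => // a b ab; exact: cdf_ndecr. Qed.

Lemma Rintegral_itv_cst (a b c : R) : a <= b ->
  \int[leb]_(v in `]a, b]) c = c * (b - a).
Proof.
move=> ab; rewrite Rintegral_cst//= lebesgue_measure_itv/= lte_fin.
case: ltgtP ab => //= -> _; by rewrite subrr.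
Qed.

Lemma integrable_itv_cst (a b c : R) : leb.-integrable `]a, b] (EFin \o (fun=> c)).
Proof.
apply/integrableP; split; first exact: measurable_cst.
rewrite integral_cst//= lebesgue_measure_itv/=.
by case: ifP => _; rewrite ?mule0 ?ltry// -EFinD -EFinM ltry.
Qed.

Lemma cdf_lip : (forall u, g u <= M) ->
  forall a b, `|distr_fun g b - distr_fun g a| <= M * `|b - a|.
Proof.
move=> gM a b; wlog ab : a b / a <= b.
  move=> H; case: (leP a b) => [/H//|/ltW/H].
  by rewrite distrC (distrC a).
rewrite [X in _ <= _ * X]ger0_norm ?subr_ge0// cdfB//.
rewrite ger0_norm ?Rintegral_ge0// -Rintegral_itv_cst//.
apply: le_Rintegral => //; first exact: density_integrable.
exact: integrable_itv_cst.
Qed.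

(** On the interval between [x] and [x + s] the density differs from [g x] by at most
    [l * `|s|]. *)
Lemma cdf_taylor (l : R) : 0 <= l -> (forall u v, `|g u - g v| <= l * `|u - v|) ->
  forall x s, `|distr_fun g (x + s) - distr_fun g x - s * g x| <= l * s ^+ 2.
Proof.
move=> l0 glip.
have H a b c : a <= c <= b ->
    `|distr_fun g b - distr_fun g a - (b - a) * g c| <= l * (b - a) ^+ 2.
  move=> /andP[ac cb]; have ab := le_trans ac cb.
  rewrite cdfB// [_ * g c]mulrC -Rintegral_itv_cst// -RintegralB//;
    [|exact: density_integrable|exact: integrable_itv_cst].
  have iB : leb.-integrable `]a, b] (EFin \o (fun x => g x - g c)).
    rewrite (_ : _ \o _ = (EFin \o g) \- (EFin \o (fun=> g c)))%E//.
    apply: integrableB => //; first exact: density_integrable.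
    exact: integrable_itv_cst.
  apply: (le_trans (le_normr_Rintegral _ iB)) => //.
  rewrite expr2 mulrA -Rintegral_itv_cst//; apply: le_Rintegral => //.
  - by apply/integrable_norm.
  - exact: integrable_itv_cst.
  - move=> x /=; rewrite in_itv /= => /andP[ax xb].
    rewrite (le_trans (glip _ _))// ler_wpM2l// ler_norml; apply/andP; split; lra.
move=> x s; case: (leP 0 s) => s0.
  have := H x (x + s) x; rewrite lexx lerDl s0 => /(_ isT).
  by rewrite [x + s - x]addrC addKr.
have := H (x + s) x x; rewrite lexx gerDl (ltW s0) => /(_ isT).
rewrite (_ : x - (x + s) = - s); last by ring.
by rewrite mulNr opprK sqrrN -[X in `|X| <= _ -> _]opprK normrN !opprD !opprK [distr_fun g (x + s) - _]addrC.
Qed.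

End Cdf.

Section Kernel.
Context (R : realType) (K : R -> R) (kap1 kap2 kapu : R).
Hypothesis HK : kernel_assumption K kap1 kap2 kapu.
Local Notation leb := (@lebesgue_measure R).

Let mK : measurable_fun setT K := kernel_measurable HK.
Let K0 : forall u, 0 <= K u := kernel_ge0 HK.

Lemma kernel_le u : K u <= kapu.
Proof.
by rewrite -lee_fin -(kernel_sup HK); apply: ereal_sup_ubound; exists u.
Qed.

Lemma kernel_bound_ge0 : 0 <= kapu.
Proof. exact: le_trans (K0 0) (kernel_le 0). Qed.

Lemma kernel_moment_integrable1 : leb.-integrable setT (EFin \o (fun u => `|u| * K u)).
Proof.
apply/integrableP; split.
  by apply/measurable_EFinP; apply: measurable_funM.
under eq_integral => u _ do rewrite /= ger0_norm ?mulr_ge0// -[`|u|]expr1.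
by have := kernel_moment1 HK; rewrite /abs_moment => ->; rewrite ltry.
Qed.

Lemma kernel_moment_integrable2 : leb.-integrable setT (EFin \o (fun u => u ^+ 2 * K u)).
Proof.
apply/integrableP; split.
  by apply/measurable_EFinP; apply: measurable_funM.
rewrite (_ : integral _ _ _ = abs_moment K 2).
  by rewrite (kernel_moment2 HK) ltry.
apply: eq_integral => u _ /=.
by rewrite real_normK ?num_real// ger0_norm// mulr_ge0// sqr_ge0.
Qed.

Lemma kernel_Rmoment1 : \int[leb]_u (`|u| * K u) = kap1.
Proof.
rewrite /Rintegral; under eq_integral => u _ do rewrite -[`|u|]expr1.
by have := kernel_moment1 HK; rewrite /abs_moment => ->.
Qed.

Lemma kernel_Rmoment2 : \int[leb]_u (u ^+ 2 * K u) = kap2.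
Proof.
rewrite /Rintegral (_ : integral _ _ _ = abs_moment K 2).
  by rewrite (kernel_moment2 HK).
by apply: eq_integral => u _; rewrite real_normK ?num_real.
Qed.

Lemma kernel_moment1_ge0 : 0 <= kap1.
Proof. by rewrite -kernel_Rmoment1 Rintegral_ge0// => z _; rewrite mulr_ge0. Qed.

Lemma kernel_moment2_ge0 : 0 <= kap2.
Proof. by rewrite -kernel_Rmoment2 Rintegral_ge0// => z _; rewrite mulr_ge0 ?sqr_ge0. Qed.

Variable h : R.
Hypothesis h_gt0 : 0 < h.
Local Notation G := (smooth_cdf K h).

Lemma smooth_cdf_ge0 a : 0 <= G a. Proof. exact: cdf_ge0. Qed.

Lemma smooth_cdf_le1 a : G a <= 1.
Proof. exact: (cdf_le1 mK K0 (kernel_int1 HK)). Qed.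

Lemma smooth_cdf_ndecr a b : a <= b -> G a <= G b.
Proof.
move=> ab; apply: (cdf_ndecr mK K0 (kernel_int1 HK)).
by rewrite ler_pM2r// invr_gt0.
Qed.

Lemma measurable_smooth_cdf : measurable_fun setT G.
Proof. by apply: nondecreasing_measurable => // a b; exact: smooth_cdf_ndecr. Qed.

Lemma smooth_cdf_lip a b : `|G b - G a| <= kapu / h * `|b - a|.
Proof.
apply: le_trans (cdf_lip mK K0 (kernel_int1 HK) kernel_le (a / h) (b / h)) _.
by rewrite -mulrBl normrM (gtr0_norm (x := h^-1)) ?invr_gt0// mulrA mulrAC.
Qed.

Lemma scaled_kernel_ge0 u : 0 <= scaled_kernel K h u.
Proof. by rewrite mulr_ge0// invr_ge0 ltW. Qed.

Lemma scaled_kernel_le u : scaled_kernel K h u <= kapu / h.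
Proof. by rewrite /scaled_kernel mulrC ler_wpM2r ?kernel_le// invr_ge0 ltW. Qed.

Lemma measurable_scaled_kernel : measurable_fun setT (scaled_kernel K h).
Proof.
apply: measurable_funM => //; apply: measurableT_comp => //.
exact: measurable_funM.
Qed.

Lemma measurable_rho tau : measurable_fun setT (@rho R tau).
Proof.
apply: measurable_funM => //; apply: measurable_funB => //.
apply: measurable_comparison => //; exact: measurable_fun_ltr.
Qed.

Lemma rho_ge0 (tau u : R) : 0 < tau < 1 -> 0 <= rho tau u.
Proof.
move=> /andP[t0 t1]; rewrite /rho; case: ltP => u0 /=.
  by rewrite mulr_le0 ?(ltW u0)//; lra.
by rewrite subr0 mulr_ge0// ltW.
Qed.

Lemma rho_le (tau u : R) : 0 < tau < 1 -> rho tau u <= `|u|.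
Proof.
move=> /andP[t0 t1]; rewrite /rho; case: ltP => u0 /=.
  rewrite ltr0_norm//; nra.
by rewrite ger0_norm//; nra.
Qed.

Lemma rho_subgradient (tau a b : R) : 0 < tau < 1 ->
  rho tau a + (tau - (a <= 0)%R%:R) * (b - a) <= rho tau b.
Proof.
move=> /andP[t0 t1]; rewrite /rho.
by case: (ltgtP a 0) => [a0|a0|->]; case: ltP => b0 /=; nra.
Qed.

(** The substitution moves the shift from the kernel to the check function, whose
    convexity in the shift becomes visible. *)
Lemma smooth_lossE (tau u : R) : 0 < tau < 1 ->
  smooth_loss tau K h u = \int[leb]_z (rho tau (h * z + u) * K z).
Proof.
move=> tau01; rewrite /smooth_loss /Rintegral.
have hn0 : h != 0 by rewrite gt_eqF.
rewrite (ge0_integral_affine u h_gt0).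
- rewrite -ge0_integralZl//.
  + congr fine; apply: eq_integral => z _; rewrite -EFinM /scaled_kernel addrK.
    congr EFin; rewrite [h * z]mulrC mulfK//; field; exact: hn0.
  + apply/measurable_EFinP; apply: measurable_funM.
      apply: measurableT_comp; first exact: measurable_rho.
      by apply: measurable_funD => //; exact: measurable_funM.
    apply: measurableT_comp; first exact: measurable_scaled_kernel.
    apply: measurable_funB => //.
    by apply: measurable_funD => //; exact: measurable_funM.
  + by move=> z _; rewrite lee_fin mulr_ge0 ?rho_ge0 ?scaled_kernel_ge0.
  + by rewrite lee_fin ltW.
- apply/measurable_EFinP; apply: measurable_funM; first exact: measurable_rho.
  apply: measurableT_comp; first exact: measurable_scaled_kernel.
  exact: measurable_funB.
- by move=> z; rewrite lee_fin mulr_ge0 ?rho_ge0 ?scaled_kernel_ge0.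
Qed.

Lemma smooth_loss_integrable (tau u : R) : 0 < tau < 1 ->
  leb.-integrable setT (fun z => (rho tau (h * z + u) * K z)%:E).
Proof.
move=> tau01.
apply: (@le_integrable _ (measurableTypeR R) _ leb setT measurableT _
  (fun z => (h%:E * (`|z| * K z)%:E + `|u|%:E * (K z)%:E)%E)).
- apply/measurable_EFinP; apply: measurable_funM => //.
  apply: measurableT_comp; first exact: measurable_rho.
  by apply: measurable_funD => //; exact: measurable_funM.
- move=> z _; rewrite -!EFinM -EFinD /= lee_fin ger0_norm; last first.
    by rewrite mulr_ge0 ?rho_ge0.
  apply: le_trans (ler_norm _); rewrite mulrA -mulrDl ler_wpM2r//.
  rewrite (le_trans (rho_le _ tau01))// (le_trans (ler_normD _ _))//.
  by rewrite normrM (gtr0_norm h_gt0).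
- apply: integrableD => //; apply: integrableZl => //.
    exact: kernel_moment_integrable1.
  exact: (density_integrable mK K0 (kernel_int1 HK)).
Qed.

(** The smoothed loss is an average of shifted check functions, and
    [tau - smooth_cdf (- u)] is the same average of their slopes. *)
Lemma smooth_loss_subgradient (tau u v : R) : 0 < tau < 1 ->
  smooth_loss tau K h u + (tau - G (- u)) * (v - u) <= smooth_loss tau K h v.
Proof.
move=> tau01; rewrite !smooth_lossE//.
have iK := density_integrable mK K0 (kernel_int1 HK) measurableT.
pose s z := tau - (h * z + u <= 0)%R%:R.
have GE : G (- u) = \int[leb]_z ((h * z + u <= 0)%R%:R * K z).
  rewrite /smooth_cdf Rintegral_mkcond; apply: eq_Rintegral => z _.
  rewrite patchE (_ : (z \in _) = (h * z + u <= 0)).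
    by case: ifP; rewrite ?mul1r ?mul0r.
  apply/idP/idP; rewrite inE /= in_itv /= ler_pdivlMr// mulrC -subr_ge0 => H.
    by rewrite -subr_ge0 -opprD addrC -[u + _]addrC in H *; lra.
  lra.
have mI : measurable_fun setT (fun z : R => (h * z + u <= 0)%R%:R : R).
  apply: measurable_comparison; apply: measurable_fun_ler => //.
  by apply: measurable_funD => //; exact: measurable_funM.
have iI : leb.-integrable setT (fun z => ((h * z + u <= 0)%R%:R * K z)%:E).
  apply: (@integrable_bounded_mul _ (measurableTypeR R) _ leb _ _ 1) => // z.
  by case: (h * z + u <= 0); rewrite ?normr1 ?normr0.
have -> : (tau - G (- u)) * (v - u) = \int[leb]_z (s z * (v - u) * K z).
  have -> : (fun z => s z * (v - u) * K z) =
      (fun z => (v - u) * (tau * K z - (h * z + u <= 0)%R%:R * K z)).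
    by apply/funext => z; rewrite /s; ring.
  have iT : leb.-integrable setT (fun z => (tau * K z)%:E).
    exact: (@integrable_bounded_mul _ (measurableTypeR R) _ leb _ _ `|tau|).
  rewrite RintegralZl//.
    rewrite RintegralB// -GE RintegralZl//.
    by rewrite (density_Rintegral1 (kernel_int1 HK)) mulr1 mulrC.
  rewrite (_ : _ \o _ = (fun z => (tau * K z)%:E - ((h * z + u <= 0)%R%:R * K z)%:E)%E)//.
  exact: integrableB.
have iS : leb.-integrable setT (fun z => (s z * (v - u) * K z)%:E).
  apply: (@integrable_bounded_mul _ (measurableTypeR R) _ leb _ _ ((`|tau| + 1) * `|v - u|)) => //.
    by apply: measurable_funM => //; exact: measurable_funB.
  move=> z; rewrite normrM ler_wpM2r// (le_trans (ler_normB _ _))// lerD2l.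
  by case: (h * z + u <= 0); rewrite ?normr1 ?normr0.
rewrite -RintegralD//; last exact: smooth_loss_integrable.
apply: le_Rintegral => //; [|exact: smooth_loss_integrable|].
  rewrite (_ : _ \o _ = (fun z => (rho tau (h * z + u) * K z)%:E + (s z * (v - u) * K z)%:E)%E)//.
  by apply: integrableD => //; exact: smooth_loss_integrable.
move=> z _; rewrite -mulrDl ler_wpM2r//.
have := rho_subgradient (h * z + u) (h * z + v) tau01.
by rewrite (_ : h * z + v - (h * z + u) = v - u)//; ring.
Qed.

End Kernel.

(** * The smoothed indicator averaged over the noise *)

Section ConditionalMeans.
Context (R : realType) (K : R -> R) (kap1 kap2 kapu : R).
Hypothesis HK : kernel_assumption K kap1 kap2 kapu.
Local Notation leb := (@lebesgue_measure R).
Variable h : R.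
Hypothesis h_gt0 : 0 < h.
Local Notation G := (smooth_cdf K h).

Let mK : measurable_fun setT K := kernel_measurable HK.
Let K0 : forall u, 0 <= K u := kernel_ge0 HK.
Let iK : leb.-integrable setT (EFin \o K) :=
  density_integrable mK K0 (kernel_int1 HK) measurableT.

Variables (f0 : R -> R) (l fbar : R).
Hypotheses (mf : measurable_fun setT f0) (f0_ge0 : forall u, 0 <= f0 u).
Hypothesis f0_int1 : (\int[leb]_u (f0 u)%:E = 1)%E.
Hypothesis l_ge0 : 0 <= l.
Hypothesis f0_lip : forall u v, `|f0 u - f0 v| <= l * `|u - v|.
Hypothesis f0_le : forall u, f0 u <= fbar.
Local Notation F := (distr_fun f0).

Let if0 : leb.-integrable setT (EFin \o f0) :=
  density_integrable mf f0_ge0 f0_int1 measurableT.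

Lemma cdf_normr_le1 (x : R) : `|F x| <= 1.
Proof.
by rewrite ger0_norm ?cdf_ge0// (cdf_le1 mf f0_ge0 f0_int1).
Qed.

Lemma measurable_cdf_affine (s c : R) : measurable_fun setT (fun z => F (s + c * z)).
Proof.
apply: measurableT_comp; first exact: (measurable_cdf mf f0_ge0 f0_int1).
by apply: measurable_funD => //; exact: measurable_funM.
Qed.

Let f0_norm_le u : `|f0 u| <= fbar.
Proof. by rewrite ger0_norm. Qed.

Lemma integrable_kernel_mul (phi : R -> R) (M : R) : measurable_fun setT phi ->
  (forall z, `|phi z| <= M) -> leb.-integrable setT (EFin \o (fun z => phi z * K z)).
Proof. move=> mphi phiM; exact: (integrable_bounded_mul iK mphi phiM). Qed.

(** The smoothed indicator of [e <= s] is the probability that [e + h Z <= s]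
    for [Z] distributed as [K]; conditioning on [Z] rather than on [e] gives the
    right-hand side. *)
Lemma Rintegral_smooth_cdf s :
  \int[leb]_u (G (s - u) * f0 u) = \int[leb]_z (F (s + - h * z) * K z).
Proof.
rewrite /Rintegral; congr fine.
pose g (w : R * R) := ((h * w.2 + w.1 <= s)%R%:R * (K w.2 * f0 w.1))%:E.
have mg : measurable_fun setT g.
  apply/measurable_EFinP; apply: measurable_funM.
    apply: measurable_comparison; apply: measurable_fun_ler => //.
    apply: measurable_funD => //; apply: measurable_funM => //.
  apply: measurable_funM.
    exact: (measurableT_comp mK).
  exact: (measurableT_comp mf).
have g0 w : (0 <= g w)%E by rewrite lee_fin !mulr_ge0.
transitivity (\int[leb]_u \int[leb]_z g (u, z))%E.
  apply: eq_integral => u _.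
  rewrite EFinM muleC /smooth_cdf /Rintegral fineK; last first.
    apply: integrable_fin_num => //.
    exact: (density_integrable mK K0 (kernel_int1 HK)).
  rewrite -ge0_integralZl//; last 3 first.
  - by apply/measurable_EFinP; exact: measurable_funTS.
  - by move=> z _; rewrite lee_fin.
  - by rewrite lee_fin.
  rewrite integral_mkcond; apply: eq_integral => z _; rewrite patchE /g /=.
  rewrite (_ : (z \in _) = (h * z + u <= s)).
    by case: ifP; rewrite ?mul1r ?mul0r// -EFinM [K z * _]mulrC.
  by apply/idP/idP; rewrite inE /= in_itv /= ler_pdivlMr// lerBrDr mulrC.
rewrite fubini_tonelli//.
apply: eq_integral => z _.
rewrite EFinM muleC /distr_fun /Rintegral fineK; last first.
  by apply: integrable_fin_num => //; exact: (density_integrable mf f0_ge0 f0_int1).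
rewrite -ge0_integralZl//; last 3 first.
- by apply/measurable_EFinP; exact: measurable_funTS.
- by move=> u _; rewrite lee_fin.
- by rewrite lee_fin.
rewrite [RHS]integral_mkcond; apply: eq_integral => u _; rewrite patchE /g /=.
rewrite (_ : (u \in _) = (h * z + u <= s)).
  by case: ifP; rewrite ?mul1r ?mul0r// -EFinM.
by apply/idP/idP; rewrite inE /= in_itv /= mulNr => ?; lra.
Qed.

Lemma Rintegral_scaled_kernel :
  \int[leb]_u (scaled_kernel K h u * f0 u) = \int[leb]_z (f0 (- h * z) * K z).
Proof.
rewrite /Rintegral; congr fine.
have mE : measurable_fun setT (fun u : R => (scaled_kernel K h u * f0 u)%:E).
  apply/measurable_EFinP; apply: measurable_funM => //.
  exact: (measurable_scaled_kernel HK).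
have E0 u : (0 <= (scaled_kernel K h u * f0 u)%:E)%E.
  by rewrite lee_fin mulr_ge0// (scaled_kernel_ge0 HK).
rewrite (ge0_integral_affine 0 h_gt0)// -ge0_integralZl//; last 2 first.
- by apply: (measurableT_comp mE); apply: measurable_funD => //; exact: measurable_funM.
- by rewrite lee_fin ltW.
have mA : measurable_fun setT (fun z : R =>
    (h%:E * (scaled_kernel K h (h * z + 0) * f0 (h * z + 0))%:E)%E).
  apply: emeasurable_funM => //.
  by apply: (measurableT_comp mE); apply: measurable_funD => //; exact: measurable_funM.
rewrite ge0_integral_opp//; last first.
  by move=> z; rewrite mule_ge0// lee_fin ltW.
apply: eq_integral => z _; rewrite -EFinM; congr EFin.
have hn0 : h != 0 by rewrite gt_eqF.
rewrite addr0 /scaled_kernel -(kernel_sym HK (_ / h)).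
rewrite (_ : - (h * - z / h) = z); last by field.
by rewrite mulrN -mulNr !mulrA mulfV// mul1r mulrC.
Qed.

Let integrable_f0_mul (phi : R -> R) (M : R) : measurable_fun setT phi ->
  (forall z, `|phi z| <= M) -> leb.-integrable setT (EFin \o (fun z => phi z * f0 z)).
Proof. move=> mphi phiM; exact: (integrable_bounded_mul if0 mphi phiM). Qed.

Let mG (s : R) : measurable_fun setT (fun u : R => G (s - u)).
Proof.
apply: measurableT_comp; first exact: (measurable_smooth_cdf HK h_gt0).
exact: measurable_funB.
Qed.

Let G_norm (s : R) : `|G s| <= 1.
Proof. by rewrite ger0_norm ?(smooth_cdf_le1 HK)// (smooth_cdf_ge0 HK). Qed.

Let iG (s : R) : leb.-integrable setT (EFin \o (fun u : R => G (s - u) * f0 u)).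
Proof. exact: (integrable_f0_mul (mG s) (fun u => G_norm (s - u))). Qed.

Let iF (s c : R) : leb.-integrable setT (EFin \o (fun z : R => F (s + c * z) * K z)).
Proof.
apply: (@integrable_kernel_mul _ 1); first exact: measurable_cdf_affine.
move=> z; exact: cdf_normr_le1.
Qed.

Let isK : leb.-integrable setT (EFin \o (fun u : R => scaled_kernel K h u * f0 u)).
Proof.
apply: (@integrable_f0_mul _ (kapu / h)).
  exact: (measurable_scaled_kernel HK h).
by move=> u; rewrite ger0_norm ?(scaled_kernel_le HK)// (scaled_kernel_ge0 HK).
Qed.

Let ifK : leb.-integrable setT (EFin \o (fun z : R => f0 (- h * z) * K z)).
Proof.
apply: (@integrable_kernel_mul _ fbar) => [|z]; last exact: f0_norm_le.
by apply: (measurableT_comp mf); exact: measurable_funM.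
Qed.

Let RK (c : R) : \int[leb]_z (c * K z) = c.
Proof. by rewrite (RintegralZl c measurableT iK) (density_Rintegral1 (kernel_int1 HK)) mulr1. Qed.

Let Rf (c : R) : \int[leb]_z (c * f0 z) = c.
Proof. by rewrite (RintegralZl c measurableT if0) (density_Rintegral1 f0_int1) mulr1. Qed.

(** The increment has a constant sign, so its absolute value has as mean an
    increment of the averaged distribution function. *)
Lemma conditional_mean_lip (s s' : R) :
  \int[leb]_u (`|G (s' - u) - G (s - u)| * f0 u) <= fbar * `|s' - s|.
Proof.
wlog ss : s s' / s <= s'.
  move=> H; case: (leP s s') => [/H//|/ltW/H].
  rewrite [`|s' - s|]distrC; apply: le_trans; apply: eq_ler.
  by apply: eq_Rintegral => u _; rewrite distrC.
have -> : \int[leb]_u (`|G (s' - u) - G (s - u)| * f0 u) =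
    \int[leb]_u (G (s' - u) * f0 u - G (s - u) * f0 u).
  apply: eq_Rintegral => u _; rewrite -mulrBl ger0_norm//.
  by rewrite subr_ge0 (smooth_cdf_ndecr HK h_gt0)// lerD2r.
rewrite (RintegralB measurableT (iG s') (iG s)).
rewrite (Rintegral_smooth_cdf s') (Rintegral_smooth_cdf s).
rewrite -(RintegralB measurableT (iF s' (- h)) (iF s (- h))).
rewrite -[leRHS]RK; apply: le_Rintegral => //.
- exact: (integrableRB (iF s' (- h)) (iF s (- h))).
- exact: (integrableRZ _ iK).
- move=> z _; rewrite -mulrBl ler_wpM2r//.
  have := cdf_lip mf f0_ge0 f0_int1 f0_le (s + - h * z) (s' + - h * z).
  rewrite (_ : s' + _ - _ = s' - s); last by ring.
  by apply: le_trans; exact: ler_norm.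
Qed.

(** Under the average over the kernel this is the Taylor expansion of [F]. *)
Lemma conditional_mean_linear (s : R) :
  `|\int[leb]_u ((G (s - u) - G (0 - u) - s * scaled_kernel K h u) * f0 u)|
  <= l * s ^+ 2.
Proof.
have -> : \int[leb]_u ((G (s - u) - G (0 - u) - s * scaled_kernel K h u) * f0 u) =
    \int[leb]_u (G (s - u) * f0 u - G (0 - u) * f0 u - s * (scaled_kernel K h u * f0 u)).
  by apply: eq_Rintegral => u _; ring.
rewrite (RintegralB measurableT (integrableRB (iG s) (iG 0)) (integrableRZ s isK)).
rewrite (RintegralB measurableT (iG s) (iG 0)) (RintegralZl s measurableT isK).
rewrite (Rintegral_smooth_cdf s) (Rintegral_smooth_cdf 0) Rintegral_scaled_kernel.
rewrite -(RintegralZl s measurableT ifK).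
rewrite -(RintegralB measurableT (iF s (- h)) (iF 0 (- h))).
rewrite -(RintegralB measurableT (integrableRB (iF s (- h)) (iF 0 (- h))) (integrableRZ s ifK)).
rewrite -[leRHS]RK; apply: le_normr_RintegralT.
- exact: (integrableRB (integrableRB (iF s (- h)) (iF 0 (- h))) (integrableRZ s ifK)).
- exact: (integrableRZ _ iK).
- move=> z; rewrite mulrA -!mulrBl normrM (ger0_norm (K0 z)) ler_wpM2r// add0r.
  by rewrite [s + _]addrC; exact: (cdf_taylor mf f0_ge0 f0_int1).
Qed.

Lemma conditional_mean_density :
  `|\int[leb]_u ((scaled_kernel K h u - f0 0) * f0 u)| <= l * h * kap1.
Proof.
have -> : \int[leb]_u ((scaled_kernel K h u - f0 0) * f0 u) =
    \int[leb]_u (scaled_kernel K h u * f0 u - f0 0 * f0 u).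
  by apply: eq_Rintegral => u _; rewrite mulrBl.
rewrite (RintegralB measurableT isK (integrableRZ (f0 0) if0)).
rewrite Rintegral_scaled_kernel Rf -[f0 0 in X in `|X|]RK.
rewrite -(RintegralB measurableT ifK (integrableRZ (f0 0) iK)).
have iK1 := kernel_moment_integrable1 HK.
rewrite -(kernel_Rmoment1 HK) -(RintegralZl (l * h) measurableT iK1).
apply: le_normr_RintegralT.
- exact: (integrableRB ifK (integrableRZ (f0 0) iK)).
- exact: (integrableRZ _ iK1).
- move=> z; rewrite -mulrBl normrM (ger0_norm (K0 z)) mulrA ler_wpM2r//.
  by apply: le_trans (f0_lip _ _) _; rewrite subr0 mulNr normrN normrM (gtr0_norm h_gt0) mulrA.
Qed.

(** The first-order term of the Taylor expansion of [F] vanishes because the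
    kernel is symmetric, so the bias is of second order in [h]. *)
Lemma conditional_mean_bias :
  `|\int[leb]_u ((G (0 - u) - F 0) * f0 u)| <= l * h ^+ 2 * kap2.
Proof.
have -> : \int[leb]_u ((G (0 - u) - F 0) * f0 u) =
    \int[leb]_u (G (0 - u) * f0 u - F 0 * f0 u).
  by apply: eq_Rintegral => u _; rewrite mulrBl.
rewrite (RintegralB measurableT (iG 0) (integrableRZ (F 0) if0)).
rewrite (Rintegral_smooth_cdf 0) Rf.
have sym : \int[leb]_z (F (0 + - h * z) * K z) = \int[leb]_z (F (0 + h * z) * K z).
  apply: (congr1 fine).
  rewrite (@ge0_integral_opp _ (fun z => (F (0 + - h * z) * K z)%:E)).
  - by apply: eq_integral => z _; rewrite (kernel_sym HK) mulrNN.
  - apply/measurable_EFinP; apply: measurable_funM => //.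
    exact: measurable_cdf_affine.
  - by move=> z; rewrite lee_fin mulr_ge0// cdf_ge0.
set I := \int[leb]_z _ in sym *.
pose A z := F (0 + - h * z) * K z + F (0 + h * z) * K z - 2 * F 0 * K z.
have iA : leb.-integrable setT (EFin \o A).
  exact: (integrableRB (integrableRD (iF 0 (- h)) (iF 0 h)) (integrableRZ (2 * F 0) iK)).
have -> : I - F 0 = 2^-1 * \int[leb]_z A z.
  rewrite (RintegralB measurableT (integrableRD (iF 0 (- h)) (iF 0 h)) (integrableRZ (2 * F 0) iK)).
  rewrite (RintegralD measurableT (iF 0 (- h)) (iF 0 h)) RK -sym -/I.
  by field.
suff : `|\int[leb]_z A z| <= 2 * (l * h ^+ 2) * kap2.
  have n2 : `|2^-1 : R| = 2^-1 by rewrite ger0_norm// invr_ge0 ler0n.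
  move: (\int[leb]_z A z) => J HJ.
  by rewrite normrM n2; lra.
have iK2 := kernel_moment_integrable2 HK.
rewrite -(kernel_Rmoment2 HK) -(RintegralZl (2 * (l * h ^+ 2)) measurableT iK2).
apply: (le_normr_RintegralT iA (integrableRZ _ iK2)).
move=> z; rewrite /A -!mulrDl -mulrBl normrM (ger0_norm (K0 z)) mulrA ler_wpM2r//.
have T1 := cdf_taylor mf f0_ge0 f0_int1 l_ge0 f0_lip 0 (- h * z).
have T2 := cdf_taylor mf f0_ge0 f0_int1 l_ge0 f0_lip 0 (h * z).
have -> : F (0 + - h * z) + F (0 + h * z) - 2 * F 0 =
    (F (0 + - h * z) - F 0 - - h * z * f0 0) + (F (0 + h * z) - F 0 - h * z * f0 0) by ring.
apply: le_trans (ler_normD _ _) _; apply: le_trans (lerD T1 T2) _.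
by apply: eq_ler; ring.
Qed.

End ConditionalMeans.

(** * Euclidean geometry, lattice nets and chaining *)

Section Euclid.
Context (R : realType) (p : nat).
Implicit Types (u v w : 'cV[R]_p) (a : R).

Lemma dotC u v : dot u v = dot v u.
Proof. by apply: eq_bigr => j _; rewrite mulrC. Qed.

Lemma dotDl u v w : dot (u + v) w = dot u w + dot v w.
Proof. by rewrite -big_split; apply: eq_bigr => j _; rewrite mxE mulrDl. Qed.

Lemma dotZl a u v : dot (a *: u) v = a * dot u v.
Proof. by rewrite /dot mulr_sumr; apply: eq_bigr => j _; rewrite mxE mulrA. Qed.

Lemma dotDr u v w : dot w (u + v) = dot w u + dot w v.
Proof. by rewrite dotC dotDl !(dotC _ w). Qed.

Lemma dotZr a u v : dot u (a *: v) = a * dot u v.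
Proof. by rewrite dotC dotZl dotC. Qed.

Lemma dotNl u v : dot (- u) v = - dot u v.
Proof. by rewrite -scaleN1r dotZl mulN1r. Qed.

Lemma dotNr u v : dot u (- v) = - dot u v.
Proof. by rewrite dotC dotNl dotC. Qed.

Lemma dotBl u v w : dot (u - v) w = dot u w - dot v w.
Proof. by rewrite dotDl dotNl. Qed.

Lemma dotBr u v w : dot w (u - v) = dot w u - dot w v.
Proof. by rewrite dotDr dotNr. Qed.

Lemma dot0l u : dot 0 u = 0.
Proof. by rewrite -(scale0r 0) dotZl mul0r. Qed.

Lemma dot0r u : dot u 0 = 0.
Proof. by rewrite dotC dot0l. Qed.

Lemma dot_sumr u (I : Type) (r : seq I) (F : I -> 'cV[R]_p) :
  dot u (\sum_(i <- r) F i) = \sum_(i <- r) dot u (F i).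
Proof.
elim: r => [|i r IH]; first by rewrite !big_nil dot0r.
by rewrite !big_cons dotDr IH.
Qed.

Lemma dot_mulmx (A : 'M[R]_p) u v : dot u (A *m v) = dot (A^T *m u) v.
Proof.
rewrite /dot; under eq_bigr do rewrite mxE mulr_sumr.
rewrite exchange_big /=; apply: eq_bigr => k _.
by rewrite mxE mulr_suml; apply: eq_bigr => j _; rewrite mxE mulrA [u j 0 * _]mulrC.
Qed.

Lemma dotvv_ge0 u : 0 <= dot u u.
Proof. by apply: sumr_ge0 => j _; rewrite -expr2 sqr_ge0. Qed.

Lemma norm2_ge0 u : 0 <= norm2 u. Proof. exact: sqrtr_ge0. Qed.

Lemma norm2_sqr u : norm2 u ^+ 2 = dot u u.
Proof. by rewrite sqr_sqrtr// dotvv_ge0. Qed.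

Lemma norm2_eq0 u : norm2 u = 0 -> u = 0.
Proof.
move=> u0; have : dot u u == 0 by rewrite -norm2_sqr u0 expr0n.
rewrite psumr_eq0; last by move=> j _; rewrite -expr2 sqr_ge0.
move=> /allP h; apply/matrixP => i j; rewrite ord1 mxE.
by have := h i (mem_index_enum i); rewrite mulf_eq0 orbb => /eqP.
Qed.

Lemma norm2_0 : norm2 (0 : 'cV[R]_p) = 0.
Proof. by rewrite /norm2 dot0l sqrtr0. Qed.

Lemma norm2Z a u : norm2 (a *: u) = `|a| * norm2 u.
Proof. by rewrite /norm2 dotZl dotZr mulrA -expr2 sqrtrM ?sqr_ge0// sqrtr_sqr. Qed.

Lemma norm2N u : norm2 (- u) = norm2 u.
Proof. by rewrite -scaleN1r norm2Z normrN1 mul1r. Qed.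

Lemma normr_dot_le u v : `|dot u v| <= norm2 u * norm2 v.
Proof.
rewrite -ler_sqr ?nnegrE ?mulr_ge0 ?norm2_ge0 ?normr_ge0//.
rewrite real_normK ?num_real// exprMn !norm2_sqr.
have [v0|v0] := eqVneq (norm2 v) 0.
  by rewrite (norm2_eq0 v0) !dot0r expr0n mulr0.
have vv : 0 < dot v v.
  by rewrite -norm2_sqr exprn_even_gt0.
have := dotvv_ge0 (dot v v *: u - dot u v *: v).
rewrite dotBl !dotBr !dotZl !dotZr (dotC v u) => H.
rewrite -subr_ge0 -(pmulr_rge0 _ vv); apply: le_trans H _.
by apply: eq_ler; ring.
Qed.

Lemma dot_le u v : dot u v <= norm2 u * norm2 v.
Proof. exact: le_trans (ler_norm _) (normr_dot_le u v). Qed.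

Lemma norm2D u v : norm2 (u + v) <= norm2 u + norm2 v.
Proof.
rewrite -ler_sqr ?nnegrE ?addr_ge0 ?norm2_ge0//.
rewrite norm2_sqr dotDl !dotDr (dotC v u) sqrrD !norm2_sqr.
by have := dot_le u v; lra.
Qed.

Lemma norm2B u v : norm2 (u - v) <= norm2 u + norm2 v.
Proof. by rewrite -(norm2N v) norm2D. Qed.

Lemma norm2BC u v : norm2 (u - v) = norm2 (v - u).
Proof. by rewrite -norm2N opprB. Qed.

Lemma norm2_normalize u : norm2 u != 0 -> norm2 ((norm2 u)^-1 *: u) = 1.
Proof.
by move=> u0; rewrite norm2Z ger0_norm ?invr_ge0 ?norm2_ge0// mulVf.
Qed.

Lemma norm2_polar u : exists2 v, norm2 v <= 1 & u = norm2 u *: v.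
Proof.
have [u0|u0] := eqVneq (norm2 u) 0.
  by exists 0; rewrite ?norm2_0// (norm2_eq0 u0) scaler0.
exists ((norm2 u)^-1 *: u); first by rewrite norm2_normalize.
by rewrite scalerA mulfV// scale1r.
Qed.

Lemma norm2_le_dot v (c : R) : 0 <= c ->
  (forall u, norm2 u <= 1 -> dot u v <= c) -> norm2 v <= c.
Proof.
move=> c0 H; have [v0|v0] := eqVneq (norm2 v) 0; first by rewrite v0.
have := H ((norm2 v)^-1 *: v); rewrite norm2_normalize// => /(_ (lexx _)).
by rewrite dotZl -norm2_sqr expr2 mulrA mulVf// mul1r.
Qed.

(** It is enough to test against the points of a net of the unit ball with
    mesh [1/2]. *)
Lemma norm2_le_net v (c : R) (r : 'cV[R]_p -> 'cV[R]_p) : 0 <= c ->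
  (forall u, norm2 u <= 1 -> norm2 (u - r u) <= 2^-1 /\ dot (r u) v <= c) ->
  norm2 v <= 2 * c.
Proof.
move=> c0 H; suff : norm2 v <= c + norm2 v / 2 by lra.
apply: norm2_le_dot; first by have := norm2_ge0 v; lra.
move=> u /H[ur rc]; rewrite -(subrK (r u) u) dotDl addrC.
apply: lerD => //; apply: (le_trans (dot_le _ _)).
by rewrite mulrC ler_wpM2l ?norm2_ge0.
Qed.

Lemma sum_normr_le u : \sum_(j < p) `|u j 0| <= Num.sqrt p%:R * norm2 u.
Proof.
pose s : 'cV[R]_p := \col_j Num.sg (u j 0).
have -> : \sum_(j < p) `|u j 0| = dot s u.
  by apply: eq_bigr => j _; rewrite mxE normrEsg.
apply: le_trans (dot_le _ _) _; rewrite ler_wpM2r ?norm2_ge0//.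
rewrite /norm2 ler_wsqrtr// /dot.
apply: (@le_trans _ _ (\sum_(j < p) 1)); last by rewrite sumr_const card_ord.
apply: ler_sum => j _; rewrite !mxE.
by case: sgrP => _; rewrite ?mul0r ?mulrNN ?mulr1.
Qed.

End Euclid.

Section Lattice.
Context (R : realType) (p : nat).
Hypothesis p_gt0 : (0 < p)%N.
Implicit Types (a : 'cV[R]_p) (k : nat).

(** A lattice point is encoded by a sign and a count per coordinate. The codes of a
    point need not be unique, which only makes the count of the net larger. *)
Definition lattice_idx k := {ffun 'I_p -> bool * 'I_(p * 2 ^ k).+1}.

(** Cubes of this side have diameter [2 ^ (- k)]. *)
Definition lattice_step k : R := ((2 ^ k)%:R * Num.sqrt p%:R)^-1.

Definition lattice_pt k (f : lattice_idx k) : 'cV[R]_p :=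
  \col_j ((-1) ^+ (f j).1 * (f j).2%:R * lattice_step k).

Definition in_net k : pred (lattice_idx k) :=
  [pred f : lattice_idx k | (\sum_(j < p) (f j).2 <= p * 2 ^ k)%N
    && (norm2 (lattice_pt f) <= 1)].

Definition round_count k a (j : 'I_p) : nat :=
  Num.truncn (`|a j 0| / lattice_step k).

(** Rounding towards 0 does not leave the unit ball. *)
Definition round_pt k a : 'cV[R]_p :=
  \col_j ((-1) ^+ (a j 0 < 0)%R * (round_count k a j)%:R * lattice_step k).

Let sqrtp_gt0 : 0 < Num.sqrt (p%:R : R).
Proof. by rewrite sqrtr_gt0 ltr0n. Qed.

Lemma lattice_step_gt0 k : 0 < lattice_step k.
Proof. by rewrite invr_gt0 mulr_gt0// ltr0n expn_gt0. Qed.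

Lemma round_count_itv k a j :
  (round_count k a j)%:R * lattice_step k <= `|a j 0|
    < (round_count k a j).+1%:R * lattice_step k.
Proof.
have /andP[h1 h2] := @truncn_itv R (`|a j 0| / lattice_step k)
  (divr_ge0 (normr_ge0 _) (ltW (lattice_step_gt0 k))).
by rewrite -ler_pdivlMr ?lattice_step_gt0// h1 -ltr_pdivrMr ?lattice_step_gt0.
Qed.

Lemma round_pt_coord k a j : `|a j 0 - round_pt k a j 0| <= lattice_step k /\
  `|round_pt k a j 0| <= `|a j 0|.
Proof.
have := round_count_itv k a j; rewrite mxE -natr1 mulrDl mul1r.
have : 0 <= (round_count k a j)%:R * lattice_step k.
  by rewrite mulr_ge0// ltW// lattice_step_gt0.
rewrite -mulrA; set x := _ * lattice_step k; set s := lattice_step k.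
case: (ltP (a j 0) 0) => a0 /= x0 /andP[h1 h2]; rewrite ?expr0 ?expr1 ?mulN1r ?mul1r.
  rewrite (ltr0_norm a0) in h1 h2 *; rewrite normrN (ger0_norm x0) opprK; split => //.
  rewrite ler_norml; lra.
rewrite (ger0_norm a0) in h1 h2 *; rewrite (ger0_norm x0); split => //.
rewrite ler_norml; lra.
Qed.

Lemma norm2_round_sub k a : norm2 (a - round_pt k a) <= (2 ^+ k)^-1.
Proof.
have k0 : (0 : R) <= (2 ^+ k)^-1 by rewrite invr_ge0 exprn_ge0.
rewrite -ler_sqr ?nnegrE ?norm2_ge0// norm2_sqr.
apply: (@le_trans _ _ (\sum_(j < p) lattice_step k ^+ 2)).
  apply: ler_sum => j _; rewrite -expr2 -[_ ^+ 2]real_normK ?num_real//.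
  rewrite ler_sqr ?nnegrE ?normr_ge0 ?(ltW (lattice_step_gt0 k))//.
  by have [+ _] := round_pt_coord k a j; rewrite !mxE.
rewrite sumr_const card_ord /lattice_step exprVn exprMn sqr_sqrtr ?ler0n//.
rewrite -[leLHS]mulr_natr invfM divfK ?pnatr_eq0 -?lt0n//.
by rewrite exprVn natrX.
Qed.

Lemma norm2_round_le k a : norm2 (round_pt k a) <= norm2 a.
Proof.
rewrite /norm2 ler_wsqrtr//; apply: ler_sum => j _.
rewrite -!expr2 -[X in X <= _]real_normK ?num_real// -[X in _ <= X]real_normK ?num_real//.
by rewrite ler_sqr ?nnegrE ?normr_ge0//; have [_ +] := round_pt_coord k a j.
Qed.

Lemma round_count_sum k a : norm2 a <= 1 ->
  (\sum_(j < p) round_count k a j <= p * 2 ^ k)%N.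
Proof.
move=> a1; rewrite -(ler_nat R) natr_sum.
rewrite -(ler_pM2r (lattice_step_gt0 k)) mulr_suml.
apply: (@le_trans _ _ (\sum_(j < p) `|a j 0|)).
  by apply: ler_sum => j _; have /andP[] := round_count_itv k a j.
apply: (le_trans (sum_normr_le a)).
apply: (@le_trans _ _ (Num.sqrt p%:R)); first by rewrite ler_piMr// sqrtr_ge0.
rewrite natrM /lattice_step invfM mulrA mulfK ?pnatr_eq0 ?expn_eq0//.
by rewrite -[X in _ <= X / _](@sqr_sqrtr _ p%:R) ?ler0n// expr2 mulfK// gt_eqF.
Qed.

Lemma round_pt_net k a : norm2 a <= 1 ->
  exists2 f : lattice_idx k, in_net f & lattice_pt f = round_pt k a.
Proof.
move=> a1; have Hs := round_count_sum k a1.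
pose f : lattice_idx k := [ffun j => (a j 0 < 0, inord (round_count k a j))].
have fE j : ((f j).2 : nat) = round_count k a j.
  rewrite ffunE /= inordK// ltnS; apply: leq_trans Hs.
  by rewrite (bigD1 j)//= leq_addr.
have ptE : lattice_pt f = round_pt k a.
  by apply/matrixP => i j; rewrite !mxE fE ffunE.
exists f => //; rewrite /in_net /= ptE (le_trans (norm2_round_le k a))// andbT.
by under eq_bigr do rewrite fE.
Qed.

Lemma zero_net k : exists2 f : lattice_idx k, in_net f & lattice_pt f = 0.
Proof.
have [|f fn fE] := @round_pt_net k 0; first by rewrite norm2_0.
exists f => //; rewrite fE; apply: norm2_eq0; apply/eqP.
by rewrite eq_le norm2_ge0 andbT -[X in _ <= X](@norm2_0 R p) norm2_round_le.
Qed.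

Lemma geometric_sum_le (m N : nat) : (0 < m)%N ->
  \sum_(n < N) expR (- (n%:R / m%:R)) <= m.+1%:R :> R.
Proof.
move=> m0; have m0' : (0 : R) < m%:R by rewrite ltr0n.
pose q : R := expR (- m%:R^-1).
have qm : q <= m%:R / m.+1%:R.
  rewrite /q expRN -[m%:R / _]invrK lef_pV2 ?posrE ?expR_gt0//; last first.
    by rewrite invr_gt0 divr_gt0// ltr0n.
  apply: le_trans (expR_ge1Dx _).
  by rewrite invf_div -natr1 mulrDl mulfV ?gt_eqF// mul1r.
have q1 : 0 < 1 - q.
  rewrite subr_gt0 (le_lt_trans qm)// ltr_pdivrMr ?ltr0n// mul1r ltr_nat//.
under eq_bigr => n _.
  rewrite (_ : expR _ = q ^+ n); last by rewrite /q -expRM_natl mulrN.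
  over.
set S := \sum_(n < N) _.
have S1 : S * (1 - q) <= 1.
  rewrite (_ : S * (1 - q) = 1 - q ^+ N); last first.
    by rewrite -[1 - q ^+ N]opprB subrX1 -/S; ring.
  by rewrite gerDl oppr_le0 exprn_ge0// expR_ge0.
rewrite -(ler_pM2r q1); apply: (le_trans S1).
have : q * m.+1%:R <= m%:R by rewrite -ler_pdivlMr ?ltr0n.
rewrite -natr1; lra.
Qed.

(** Weighting a sequence [n_1, .., n_p] by [exp (p - sum n_j / 2 ^ k)] makes the
    count of the net factor over the coordinates. *)
Lemma card_net k : #|@in_net k|%:R <= expR (p%:R * (3 + k%:R)) :> R.
Proof.
pose m := (2 ^ k)%N; have m0 : (0 < m)%N by rewrite expn_gt0.
pose F (x : bool * 'I_(p * 2 ^ k).+1) : R := expR (1 - x.2%:R / m%:R).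
apply: (@le_trans _ _ (\sum_(f : lattice_idx k) \prod_(j < p) F (f j))).
  rewrite -sum1_card natr_sum.
  apply: (@le_trans _ _ (\sum_(f | @in_net k f) \prod_(j < p) F (f j))); last first.
    rewrite [leRHS](bigID (@in_net k))/= lerDl sumr_ge0// => f _.
    by apply: prodr_ge0 => j _; exact: expR_ge0.
  apply: ler_sum => f /andP[fs _]; rewrite /F -expR_sum -[leLHS]expR0 ler_expR.
  rewrite sumrB sumr_const card_ord subr_ge0 -mulr_suml -natr_sum.
  by rewrite ler_pdivrMr ?ltr0n// -natrM ler_nat.
rewrite -(bigA_distr_bigA (fun=> F)) /= prodr_const card_ord.
have F0 : 0 <= \sum_x F x by apply: sumr_ge0 => x _; exact: expR_ge0.
rewrite expRM_natl; apply: lerXn2r; rewrite ?nnegrE ?expR_ge0// {F0}.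
have e2 : (2 : R) <= expR 1 by have := expR_ge1Dx (1 : R); lra.
rewrite -(pair_bigA _ (fun b n => F (b, n))) /= big_bool /F /=.
have -> : \sum_(n < (p * 2 ^ k).+1) expR (1 - n%:R / m%:R) =
    expR 1 * \sum_(n < (p * 2 ^ k).+1) expR (- (n%:R / m%:R)) :> R.
  by rewrite mulr_sumr; apply: eq_bigr => n _; rewrite expRD.
have gs := @geometric_sum_le m (p * 2 ^ k).+1 m0.
have m2 : m.+1%:R <= 2 * (2 ^+ k) :> R.
  have : (1 : R) <= m%:R by rewrite ler1n.
  by rewrite -natr1 /m natrX; lra.
have k2 : 2 ^+ k <= expR k%:R :> R.
  by rewrite -[k%:R]mulr1 expRM_natl; apply: lerXn2r; rewrite ?nnegrE ?expR_ge0.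
rewrite expRD (_ : 3 = 1 + (1 + 1))// !expRD.
set S := \sum_(n < _) _ in gs *; set e := expR 1 in e2 *.
have S2 : S <= 2 * expR k%:R by apply: le_trans gs (le_trans m2 _); rewrite ler_wpM2l.
have e0 : 0 < e by exact: expR_gt0.
apply: (@le_trans _ _ (e * (4 * expR k%:R))); first by nra.
rewrite -mulrA ler_wpM2l ?(ltW e0)// ler_wpM2r ?expR_ge0//; nra.
Qed.

End Lattice.

Section Chaining.
Context d (T : measurableType d) (R : realType) (P : probability T R) (p : nat).
Hypothesis p_gt0 : (0 < p)%N.
Variables (H : 'cV[R]_p -> T -> 'cV[R]_p) (Lam B t : R).
Hypothesis mH : forall a j, measurable_fun setT (fun w => H a w j 0).
Hypothesis H_0 : forall w, H 0 w = 0.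
Hypothesis H_lip : forall w, exists L : R, forall a b,
  norm2 (H a w - H b w) <= L * norm2 (a - b).
Hypotheses (Lam_gt0 : 0 < Lam) (B_ge0 : 0 <= B) (t_ge0 : 0 <= t).
Hypothesis H_mgf : forall a b u delta, norm2 a <= 1 -> norm2 b <= 1 ->
  norm2 u <= 1 -> 0 < delta -> norm2 (a - b) <= delta ->
  (\int[P]_w (expR (Lam / delta * dot u (H a w - H b w)))%:E <= (expR B)%:E)%E.

(* An index of level [k] is a pair of lattice points of consecutive levels at
   distance at most [delta k], and a direction from the net of mesh [1 / 2], whose
   points suffice to compute norms up to a factor 2. *)
Let delta k : R := 2 / 2 ^+ k.
Let idx k := (lattice_idx p k * lattice_idx p k.+1 * lattice_idx p 1)%type.
Let ok k : pred (idx k) := fun i =>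
  [&& @in_net R p k i.1.1, @in_net R p k.+1 i.1.2, @in_net R p 1 i.2 &
      norm2 (lattice_pt R i.1.2 - lattice_pt R i.1.1) <= delta k].
Let incr k (i : idx k) w : R :=
  dot (lattice_pt R i.2) (H (lattice_pt R i.1.2) w - H (lattice_pt R i.1.1) w).
Let level k w : R :=
  \sum_(i <- enum (@ok k)) expR (Lam / delta k * incr i w).
(* [11 + 2 k = (3 + k) + (3 + (k + 1)) + (3 + 1)] adds up the entropies of the three nets. *)
Let bound k : R := B + p%:R * (11 + 2 * k%:R).
Let bad k := [set w | expR (bound k + (t + k.+1%:R)) <= level k w].

Let delta_gt0 k : 0 < delta k. Proof. by rewrite divr_gt0// exprn_gt0. Qed.

Let mexp k i : measurable_fun setT (fun w => expR (Lam / delta k * @incr k i w)).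
Proof.
apply: measurableT_comp => //; apply: measurable_funM => //.
apply: measurable_sum => j; apply: measurable_funM => //.
by under eq_fun do rewrite !mxE; exact: measurable_funB.
Qed.

Let mlevel k : measurable_fun setT (level k).
Proof. by apply: measurable_sum => i. Qed.

Let mbad k : measurable (bad k).
Proof.
rewrite -[X in measurable X]setTI.
have := mlevel k measurableT
  (measurable_itv `[expR (bound k + (t + k.+1%:R)), +oo[).
rewrite (_ : level k @^-1` _ = bad k)//.
by apply/seteqP; split => w /=; rewrite in_itv /= andbT.
Qed.

Let level_mean k : (\int[P]_w (level k w)%:E <= (expR (bound k))%:E)%E.
Proof.
under eq_integral do rewrite /level -sumEFin.
rewrite ge0_integral_sum//; last by move=> i; exact/measurable_EFinP.
apply: (@le_trans _ _ (\sum_(i <- enum (@ok k)) (expR B)%:E)%E).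
  rewrite big_seq [leRHS]big_seq; apply: lee_sum => i.
  rewrite mem_enum => /and4P[/andP[_ n1] /andP[_ n2] /andP[_ n3] dd].
  exact: H_mgf.
rewrite sumEFin lee_fin big_const_seq count_predT iter_addr_0 -cardE.
rewrite -[expR B *+ _]mulr_natl.
apply: (@le_trans _ _ (expR (p%:R * (11 + 2 * k%:R)) * expR B)); last first.
  by rewrite -expRD addrC.
rewrite ler_wpM2r ?expR_ge0//.
apply: (@le_trans _ _ ((#|@in_net R p k| * #|@in_net R p k.+1| * #|@in_net R p 1|)%N%:R)).
  rewrite ler_nat -!cardX; apply: subset_leq_card.
  by apply/fintype.subsetP => i /and4P[h1 h2 h3 _]; rewrite !inE; apply/andP; split; [apply/andP; split|].
rewrite !natrM.
have c1 := card_net R p k; have c2 := card_net R p k.+1.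
have c3 := card_net R p 1.
apply: (@le_trans _ _ (expR (p%:R * (3 + k%:R)) * expR (p%:R * (3 + k.+1%:R)) * expR (p%:R * (3 + 1%:R)))).
  by rewrite !ler_pM.
by rewrite -!expRD ler_expR -natr1; lra.
Qed.

Let bad_prob k : (P (bad k) <= (expR (- t) / (2 ^ k.+1)%:R)%:E)%E.
Proof.
have e0 := expR_gt0 (bound k + (t + k.+1%:R)).
have h1 : ((expR (bound k + (t + k.+1%:R)))%:E * P (bad k) <= (expR (bound k))%:E)%E.
  apply: le_trans (level_mean k).
  have PE := integral_indic P measurableT (mbad k); rewrite setIT in PE.
  rewrite -PE.
  have m1 : measurable_fun setT (fun w => (\1_(bad k) w)%:E : \bar R).
    exact/measurable_EFinP/measurable_indic.
  have i0 w : setT w -> (0 <= (\1_(bad k) w)%:E :> \bar R)%E by rewrite lee_fin.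
  rewrite -ge0_integralZl ?lee_fin ?expR_ge0//.
  apply: ge0_le_integral => //.
  - exact: measurable_funeM.
  - exact/measurable_EFinP.
  - move=> w _; rewrite -EFinM lee_fin indicE; case: (boolP (w \in _)) => [/set_mem|_].
      by rewrite mulr1.
    by rewrite mulr0 sumr_ge0// => i _; exact: expR_ge0.
rewrite -(@lee_pmul2l _ (expR (bound k + (t + k.+1%:R)))%:E)// (le_trans h1)//.
rewrite -EFinM lee_fin expRD -mulrA ler_peMr ?expR_ge0//.
rewrite mulrA -expRD [t + _]addrC addrK natrX ler_pdivlMr ?exprn_gt0// mul1r.
rewrite -[k.+1%:R]mulr1 expRM_natl; apply: lerXn2r; rewrite ?nnegrE ?expR_ge0//.
by have := expR_ge1Dx (1 : R); lra.
Qed.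

Let good_incr k (i : idx k) w : ~ bad k w -> ok i ->
  incr i w <= (2 * (B + t + p%:R) / Lam) * ((12 + 3 * k%:R) / 2 ^+ k).
Proof.
move=> /negP; rewrite /bad /= -ltNge => wk oki.
have : expR (Lam / delta k * incr i w) < expR (bound k + (t + k.+1%:R)).
  apply: le_lt_trans wk; rewrite /level (bigD1_seq i) ?enum_uniq ?mem_enum//=.
  by rewrite lerDl sumr_ge0// => j _; exact: expR_ge0.
rewrite ltr_expR mulrC -ltr_pdivlMr ?divr_gt0//.
move=> /ltW /le_trans; apply.
rewrite invf_div mulrA [leRHS](_ : _ =
    (B + t + p%:R) * (12 + 3 * k%:R) * (delta k / Lam)); last first.
  have n2 : 2 ^+ k != 0 :> R by rewrite expf_neq0// pnatr_eq0.
  have nL : Lam != 0 by rewrite gt_eqF.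
  by rewrite /delta; field; rewrite ?n2 ?nL.
rewrite mulrA ler_wpM2r ?invr_ge0 ?(ltW Lam_gt0)// ler_wpM2r ?(ltW (delta_gt0 k))//.
have p1 : (1 : R) <= p%:R by rewrite ler1n.
have k0 : (0 : R) <= k%:R by rewrite ler0n.
have h1 : 0 <= (B + t) * (11 + 3 * k%:R) by rewrite mulr_ge0// addr_ge0// mulr_ge0.
have h2 : 0 <= (p%:R - 1) * (k%:R + 1) :> R by rewrite mulr_ge0 ?subr_ge0// addr_ge0.
rewrite /bound -natr1; lra.
Qed.

(* The chain starts at the origin, where the process vanishes, and not at the
   rounding of [a] of level 0. *)
Let chain a k : 'cV[R]_p := if k is 0 then 0 else round_pt k a.

Let chain_net a k : norm2 a <= 1 ->
  exists2 f : lattice_idx p k, @in_net R p k f & lattice_pt R f = chain a k.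
Proof.
case: k => [|k] a1; first exact: zero_net.
exact: round_pt_net.
Qed.

Let chain_step a k : norm2 a <= 1 -> norm2 (chain a k.+1 - chain a k) <= delta k.
Proof.
move=> a1; case: k => [|k] /=.
  rewrite subr0 (le_trans (norm2_round_le p_gt0 1 a))// (le_trans a1)//.
  by rewrite /delta expr0 divr1 ler1n.
rewrite -(subrK a (round_pt k.+2 a)) -addrA.
apply: le_trans (norm2D _ _) _; rewrite norm2BC.
have h1 := norm2_round_sub p_gt0 k.+1 a; have h2 := norm2_round_sub p_gt0 k.+2 a.
apply: le_trans (lerD h2 h1) _.
have : (2 ^+ k.+2)^-1 <= (2 ^+ k.+1)^-1 :> R.
  by rewrite lef_pV2 ?posrE ?exprn_gt0// ler_weXn2l// ler1n.
by rewrite /delta; lra.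
Qed.

(** A point [a] is joined to the origin by its roundings of level [k]. There are
    [exp (O (p (k + 1)))] pairs of consecutive roundings, at distance of order
    [2 ^ (- k)], so that a union bound through exponential moments controls
    all increments of level [k] by [O ((B + t + p) (k + 1) / (2 ^ k Lam))], which is
    summable. The Lipschitz constant of [H_lip] does not enter the bound: it makes
    the process converge along the chain. *)
Lemma chaining : exists Bad : set T, [/\ measurable Bad,
  (P Bad <= (expR (- t))%:E)%E &
  forall w, ~ Bad w -> forall a, norm2 a <= 1 ->
    norm2 (H a w) <= 120 * (B + t + p%:R) / Lam].
Proof.
exists (\bigcup_k bad k); split.
- by apply: bigcup_measurable => k _; exact: mbad.
- have := @measure_sigma_subadditive _ _ _ P (\bigcup_k bad k) bad mbad
    (bigcup_measurable (fun k _ => mbad k)) (@subset_refl _ _).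
  move=> /le_trans; apply.
  apply: (@le_trans _ _ (\sum_(k <oo) (expR (- t) / (2 ^ k.+1)%:R)%:E)%E).
    by apply: lee_nneseries => // k _; exact: bad_prob.
  by apply: epsilon_trick0; exact: expR_ge0.
move=> w wB a a1; pose A := 2 * (B + t + p%:R) / Lam.
have A0 : 0 <= A by rewrite divr_ge0 ?(ltW Lam_gt0)// mulr_ge0// !addr_ge0.
have -> : 120 * (B + t + p%:R) / Lam = 2 * (30 * A) by rewrite /A; field; rewrite gt_eqF.
apply: (@norm2_le_net _ _ _ _ (round_pt 1)); first by rewrite mulr_ge0.
move=> u u1; split; first by have := norm2_round_sub p_gt0 1 u; rewrite expr1.
have [v vn vE] := round_pt_net p_gt0 1 u1; rewrite -vE.
(* Telescoping along the chain; the weights sum to [30 - (30 + 6 m) / 2 ^ m]. *)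
have tele m : dot (lattice_pt R v) (H (chain a m) w) <=
    A * (30 - (30 + 6 * m%:R) / 2 ^+ m).
  elim: m => [|m IH] /=.
    by rewrite H_0 dot0r expr0 divr1 mulr0 addr0 subrr mulr0.
  have [f fn fE] := chain_net m a1; have [g gn gE] := chain_net m.+1 a1.
  have := @good_incr m (f, g, v) w (fun wm => wB (ex_intro2 _ _ m I wm)).
  rewrite /ok /incr /= fn gn vn fE gE chain_step// => /(_ isT).
  rewrite dotBr lerBlDr => /le_trans; apply.
  apply: le_trans (lerD (lexx _) IH) _; rewrite -mulrDr ler_wpM2l//.
  apply: eq_ler.
  have n2 : 2 ^+ m != 0 :> R by rewrite expf_neq0// pnatr_eq0.
  rewrite -natr1 exprS; move: (2 ^+ m) n2 => z n2; field; exact: n2.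
have [L HL] := H_lip w.
apply/ler_addgt0Pr => e e0.
pose M := Num.max L 0 ; have M0 : 0 <= M by rewrite le_max lexx orbT.
have [m mM] : exists m : nat, M / e < m%:R.
  by exists (Num.truncn (M / e)).+1; rewrite truncnS_gt.
have m2 : m.+1%:R <= 2 ^+ m.+1 :> R by rewrite -natrX ler_nat ltnW// ltn_expl.
have -> : H a w = H (chain a m.+1) w + (H a w - H (chain a m.+1) w) by rewrite addrC subrK.
rewrite dotDr; apply: lerD.
  apply: le_trans (tele m.+1) _; rewrite mulrC ler_wpM2r// gerDl oppr_le0.
  by rewrite divr_ge0 ?exprn_ge0// addr_ge0// mulr_ge0.
apply: le_trans (dot_le _ _) _.
have /andP[_ v1] := vn.
apply: (@le_trans _ _ (1 * (M * (2 ^+ m.+1)^-1))).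
  apply: ler_pM; rewrite ?norm2_ge0//; apply: le_trans (HL _ _) _.
  apply: (@le_trans _ _ (M * norm2 (a - chain a m.+1))).
    by rewrite ler_wpM2r ?norm2_ge0// le_max lexx.
  by rewrite ler_wpM2l// norm2_round_sub.
rewrite mul1r ler_pdivrMr ?exprn_gt0//.
move: mM; rewrite ltr_pdivrMr// => mM.
apply: le_trans (ltW mM) _; rewrite mulrC ler_wpM2l ?(ltW e0)//.
by apply: le_trans m2; rewrite ler_nat.
Qed.

End Chaining.

(** * Exponential moments and conditional densities *)

Lemma probability_integral_cst d (T : measurableType d) (R : realType)
  (P : probability T R) (c : \bar R) : (\int[P]_x c = c)%E.
Proof.
rewrite (integral_cst P measurableT c); transitivity (c * 1)%E; last by rewrite mule1.
by congr (_ * _)%E; exact: probability_setT.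
Qed.

Lemma maxe_EFinM (R : realType) (a c : R) : 0 <= c ->
  (maxe (a * c)%:E 0 = maxe a%:E 0 * c%:E)%E.
Proof. by move=> c0; rewrite -!(EFin_max _ 0%R) -EFinM maxr_pMl// mul0r. Qed.

Section SubGaussian.
Context d (T : measurableType d) (R : realType) (P : probability T R).

Definition sg_const : R := 4 * expR (5 / 4).

Lemma sg_const_ge1 : 1 <= sg_const.
Proof. by have := expR_ge1Dx (5 / 4 : R); rewrite /sg_const; lra. Qed.

(** Slicing according to the integer part [k] of [`|A w| / ups]. *)
Lemma subgaussian_exp_sqr (A : T -> R) (ups : R) :
  measurable_fun setT A -> 0 < ups ->
  (forall t, 0 <= t ->
    (P [set w | (ups * t <= `|A w|)%R] <= (2 * expR (- (t ^+ 2 / 2)))%:E)%E) ->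
  (\int[P]_w (expR (A w ^+ 2 / (8 * ups ^+ 2)))%:E <= sg_const%:E)%E.
Proof.
move=> mA ups0 tail.
pose E k := [set w | ups * k%:R <= `|A w|].
have mE k : measurable (E k).
  rewrite -[X in measurable X]setTI.
  have mnA : measurable_fun setT (fun w => `|A w|) by exact: measurableT_comp.
  have := mnA measurableT _ (measurable_itv `[ups * k%:R, +oo[).
  rewrite (_ : (fun w => `|A w|) @^-1` _ = E k)//.
  by apply/seteqP; split => w /=; rewrite in_itv /= andbT.
pose g k w : \bar R := ((expR (k.+1%:R ^+ 2 / 8))%:E * (\1_(E k) w)%:E)%E.
have g0 k w : (0 <= g k w)%E by rewrite mule_ge0// lee_fin ?expR_ge0.
have mg k : measurable_fun setT (g k).
  by apply: measurable_funeM; exact/measurable_EFinP/measurable_indic.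
apply: (@le_trans _ _ (\int[P]_w \sum_(k <oo) g k w)%E).
  apply: ge0_le_integral => //.
  - apply/measurable_EFinP; apply: measurableT_comp => //.
    by apply: measurable_funM => //; exact: measurable_funX.
  - exact: ge0_emeasurable_sum.
  - move=> w _; pose k := Num.truncn (`|A w| / ups).
    have /andP[k1 k2] : k%:R <= `|A w| / ups < k.+1%:R.
      by apply: truncn_itv; rewrite divr_ge0// ltW.
    have Ek : E k w by rewrite /E /= mulrC -ler_pdivlMr.
    apply: (@le_trans _ _ (\sum_(0 <= i < k.+1) g i w)%E); last first.
      by apply: nneseries_lim_ge => i _.
    rewrite big_nat_recr//= -[X in (X <= _)%E]add0e; apply: leeD.
      by apply: sume_ge0 => i _.
    rewrite /g indicE mem_set// mule1 lee_fin ler_expR.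
    rewrite ler_pdivrMr ?mulr_gt0 ?exprn_gt0//.
    rewrite [leRHS](_ : _ = (ups * k.+1%:R) ^+ 2); last by field.
    rewrite -[X in X <= _]real_normK ?num_real// ler_sqr ?nnegrE ?mulr_ge0 ?(ltW ups0)//.
    by move/ltW: k2; rewrite ler_pdivrMr// mulrC.
rewrite integral_nneseries//.
apply: (@le_trans _ _ (\sum_(k <oo) (sg_const / (2 ^ k.+1)%:R)%:E)%E); last first.
  by apply: epsilon_trick0; apply: le_trans sg_const_ge1.
apply: lee_nneseries => [k _ _|k _]; first exact: integral_ge0.
rewrite /g ge0_integralZl//; last exact/measurable_EFinP/measurable_indic.
rewrite integral_indic// setIT.
apply: (@le_trans _ _ ((expR (k.+1%:R ^+ 2 / 8))%:E * (2 * expR (- (k%:R ^+ 2 / 2)))%:E)%E).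
  by apply: lee_wpmul2l; [rewrite lee_fin expR_ge0|exact: tail].
rewrite -EFinM lee_fin mulrCA -expRD.
have k0 : 0 <= k%:R :> R by rewrite ler0n.
apply: (@le_trans _ _ (2 * expR (5 / 4 - k%:R))).
  (* The square gives [(k + 1) ^ 2 / 8 - k ^ 2 / 2 <= 5 / 4 - k]. *)
  have := sqr_ge0 (3 * k%:R - 5 : R).
  rewrite ler_pM2l// ler_expR -natr1; nra.
rewrite /sg_const expRD expnS natrM invfM -mulrA.
rewrite [leRHS](_ : _ = 2 * (expR (5 / 4) * ((2 ^ k)%:R)^-1)); last by field.
rewrite ler_pM2l// ler_pM2l ?expR_gt0// expRN lef_pV2 ?posrE ?expR_gt0 ?ltr0n ?expn_gt0//.
rewrite natrX -[k%:R]mulr1 expRM_natl; apply: lerXn2r; rewrite ?nnegrE ?expR_ge0//.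
by have := expR_ge1Dx (1 : R); lra.
Qed.

Lemma expR_le_quadratic (x : R) : expR x <= 1 + x + x ^+ 2 * expR `|x|.
Proof.
have h1 := expR_ge1Dx (- x).
have e0 := expR_gt0 x.
have h2 : expR x * (1 - x) <= 1.
  by rewrite -[leRHS](expRxMexpNx_1 x) ler_pM2l.
case: (leP 0 x) => x0.
  rewrite ger0_norm//; nra.
have h3 : 1 + x <= expR x by exact: expR_ge1Dx.
have h4 : 1 <= expR `|x| by rewrite -[leLHS]expR0 ler_expR.
have : x * (expR x - 1) <= x ^+ 2 by rewrite expr2; nra.
have : x ^+ 2 <= x ^+ 2 * expR `|x| by rewrite ler_peMr// sqr_ge0.
nra.
Qed.

(** Bernstein's bound on the exponential moment of a centred variable, in the
    form that only asks for an exponentially weighted second moment; it integrates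
    [exp x <= 1 + x + x ^ 2 * exp `|x|]. *)
Lemma centered_mgf_le (Y : T -> R) (lam V : R) :
  P.-integrable setT (EFin \o Y) ->
  (\int[P]_w (Y w ^+ 2 * expR (`|lam| * `|Y w|))%:E <= V%:E)%E ->
  (\int[P]_w (expR (lam * (Y w - \int[P]_w Y w)))%:E
    <= (expR (lam ^+ 2 * V))%:E)%E.
Proof.
move=> iY hV; set m := \int[P]_w Y w.
have mY : measurable_fun setT Y by apply/measurable_EFinP; exact: measurable_int iY.
pose Q w := Y w ^+ 2 * expR (`|lam| * `|Y w|).
have mQ : measurable_fun setT Q.
  apply: measurable_funM; first exact: measurable_funX.
  apply: measurableT_comp => //; apply: measurable_funM => //.
  exact: measurableT_comp.
have Q0 w : 0 <= Q w by rewrite mulr_ge0 ?sqr_ge0 ?expR_ge0.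
have iQ : P.-integrable setT (EFin \o Q).
  by apply: integrable_ge0_lty => //; rewrite (le_lt_trans hV)// ltry.
have RQ : \int[P]_w Q w <= V.
  rewrite -lee_fin fineK//; exact: integrable_fin_num.
have i1 : P.-integrable setT (EFin \o (fun=> 1 : R)).
  apply: integrable_ge0_lty => //.
  by rewrite (probability_integral_cst P) ltry.
pose U w := expR (- lam * m) * (1 + lam * Y w + lam ^+ 2 * Q w).
have iU : P.-integrable setT (EFin \o U).
  apply: integrableRZ; apply: integrableRD; last exact: integrableRZ.
  by apply: integrableRD => //; exact: integrableRZ.
have RU : \int[P]_w U w = expR (- lam * m) * (1 + lam * m + lam ^+ 2 * \int[P]_w Q w).
  rewrite (RintegralZl _ measurableT (integrableRD (integrableRD i1 (integrableRZ lam iY)) (integrableRZ _ iQ))).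
  rewrite (RintegralD measurableT (integrableRD i1 (integrableRZ lam iY)) (integrableRZ _ iQ)).
  rewrite (RintegralD measurableT i1 (integrableRZ lam iY)).
  rewrite (RintegralZl _ measurableT iY) (RintegralZl _ measurableT iQ).
  by rewrite /Rintegral (probability_integral_cst P).
apply: (@le_trans _ _ (\int[P]_w (U w)%:E)%E).
  apply: ge0_le_integral => //.
  - apply/measurable_EFinP; apply: measurableT_comp => //.
    by apply: measurable_funM => //; exact: measurable_funB.
  - exact: (measurable_int _ iU).
  - move=> w _; rewrite lee_fin /U mulrBr addrC expRD mulNr ler_pM2l ?expR_gt0//.
    apply: le_trans (expR_le_quadratic _) _.
    by rewrite normrM exprMn /Q mulrA.
rewrite -(fineK (integrable_fin_num measurableT iU)) lee_fin -/(Rintegral _ _ _) RU.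
rewrite -ler_pdivlMl ?expR_gt0// mulNr expRN invrK -expRD.
apply: le_trans (expR_ge1Dx _); rewrite addrA lerD2l.
by rewrite ler_wpM2l// sqr_ge0.
Qed.

End SubGaussian.

Section Iid.
Context d d' (T : measurableType d) (S : measurableType d') (R : realType).
Variables (P : probability T R) (n : nat) (Z : 'I_n -> T -> S) (Z0 : T -> S).
Hypothesis mZ : forall i, measurable_fun setT (Z i).
Hypothesis mZ0 : measurable_fun setT Z0.
Hypothesis lawZ : forall i, same_law P (Z i) Z0.
Hypothesis indepZ : mutually_independent P Z.

Lemma same_law_ge0_integral (phi : S -> \bar R) i :
  measurable_fun setT phi -> (forall s, 0 <= phi s)%E ->
  (\int[P]_w phi (Z i w) = \int[P]_w phi (Z0 w))%E.
Proof.
move=> mphi phi0.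
have pZ (F : T -> S) A : measurable_fun setT F -> measurable A -> measurable (F @^-1` A).
  by move=> mF mA; rewrite -[X in measurable X]setTI; exact: mF.
transitivity (\int[P]_w (phi (Z i w) * 1%:E))%E.
  by apply: eq_integral => w _; rewrite mule1.
transitivity (\int[P]_w (phi (Z0 w) * 1%:E))%E; last first.
  by apply: eq_integral => w _; rewrite mule1.
apply: (@ge0_weighted_law_eq _ _ _ _ _ _ R P P (Z i) Z0 (fun=> 1) (fun=> 1)
  (mZ i) mZ0 _ _ _ _ measurable) => //.
- by rewrite sigma_algebra_id//; exact: sigma_algebra_measurable.
- by move=> A B; exact: measurableI.
- by rewrite (probability_integral_cst P) ltry.
- move=> A mA; rewrite (integral_cst P (pZ _ _ (mZ i) mA) 1%E).
  by rewrite (integral_cst P (pZ _ _ mZ0 mA) 1%E); congr (_ * _)%E; exact: lawZ.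
Qed.

Lemma iid_mgf_le (phi : S -> R) (lam m b : R) :
  measurable_fun setT phi ->
  (\int[P]_w (expR (lam * (phi (Z0 w) - m)))%:E <= (expR b)%:E)%E ->
  (\int[P]_w (expR (lam * \sum_(i < n) (phi (Z i w) - m)))%:E
    <= (expR (n%:R * b))%:E)%E.
Proof.
move=> mphi hb.
pose F s := expR (lam * (phi s - m)).
have mF : measurable_fun setT F.
  by apply: measurableT_comp => //; apply: measurable_funM => //; exact: measurable_funB.
have F0 s : 0 <= F s by exact: expR_ge0.
have IF0 : (0 <= \int[P]_w (F (Z0 w))%:E)%E by apply: integral_ge0 => w _; rewrite lee_fin.
have IF : (\int[P]_w (F (Z0 w))%:E)%E \is a fin_num.
  by rewrite ge0_fin_numE// (le_lt_trans hb)// ltry.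
have := independent_integral_prod mZ indepZ (phi := fun=> F)
  (m := fun=> fine (\int[P]_w (F (Z0 w))%:E)) (fun=> mF) (fun=> F0) _.
have -> : (\int[P]_w (expR (lam * \sum_(i < n) (phi (Z i w) - m)))%:E =
    \int[P]_w (\prod_(i < n) F (Z i w))%:E)%E.
  by apply: eq_integral => w _; rewrite mulr_sumr expR_sum.
move=> -> => [|i].
  rewrite prodr_const card_ord lee_fin expRM_natl.
  by apply: lerXn2r; rewrite ?nnegrE ?fine_ge0 ?expR_ge0// -lee_fin fineK.
rewrite fineK// (same_law_ge0_integral (phi := EFin \o F))//.
  exact/measurable_EFinP.
Qed.

End Iid.

Section SignedDisintegration.
Local Open Scope ereal_scope.
Context d d' (T : measurableType d) (S : measurableType d') (R : realType).
Variables (P : probability T R) (X : T -> S) (e : T -> R) (f : S -> R -> R).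
Hypotheses (mX : measurable_fun setT X) (me : measurable_fun setT e).
Hypothesis ef : cond_density P X e f.

Lemma cond_prob_ae_unique (E : set T) (c : R) (g : S -> \bar R) : (0 <= c)%R ->
  (forall s, 0 <= g s) -> cond_prob P X E (fun=> c%:E) -> cond_prob P X E g ->
  {ae P, forall w, g (X w) = c%:E}.
Proof.
move=> c0 g0 [_ cP] [mg gP].
pose nu0 := (pushforward P X : {measure set S -> \bar R}); pose nu := nu0 mX.
have icst : nu.-integrable setT (fun=> c%:E).
  apply/integrableP; split; first exact: measurable_cst.
  rewrite (integral_cst nu measurableT `|c%:E|) /nu /nu0 /= /pushforward preimage_setT.
  by rewrite (probability_setT P) mule1 ltry.
have := @integral_ae_eq _ _ _ nu setT measurableT g (fun=> c%:E) icst mg _.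
case=> [A _ mA|N [mN N0 subN]].
  have mXA : measurable (X @^-1` A).
    by rewrite -[X in measurable X]setTI; exact: mX.
  transitivity (\int[P]_(w in X @^-1` A) c%:E).
    by rewrite (integral_cst nu mA c%:E) (integral_cst P mXA c%:E).
  rewrite -cP// gP//; apply/esym.
  have := @ge0_integral_pushforward _ _ _ _ _ _ mX P A g mA _ (fun s _ => g0 s).
  by apply; exact: measurable_funTS.
exists (X @^-1` N); split => //.
- by rewrite -[X in measurable X]setTI; exact: mX.
- move=> w /= H; apply: subN => /= h; apply: H; exact/esym/h.
Qed.

Lemma cond_density_total : {ae P, forall w,
  \int[lebesgue_measure]_u (f (X w) u)%:E = 1}.
Proof.
have [_ f0 fP] := ef; apply: cond_prob_ae_unique (fP setT measurableT) => //.
  by move=> s; apply: integral_ge0 => u _; rewrite lee_fin.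
split => // A mA; rewrite preimage_setT setTI.
have mXA : measurable (X @^-1` A).
  by rewrite -[X in measurable X]setTI; exact: mX.
by rewrite (integral_cst P mXA 1) mul1e.
Qed.

Lemma cond_prob_distr_fun (tau : R) : (0 <= tau)%R ->
  cond_prob P X [set w | (e w <= 0)%R] (fun=> tau%:E) ->
  {ae P, forall w, distr_fun (f (X w)) 0 = tau}.
Proof.
move=> tau0 tauP; have [_ f0 fP] := ef.
have h := @cond_prob_ae_unique _ tau _ tau0 _ tauP (fP `]-oo, 0%R]%classic (measurable_itv _)).
have : {ae P, forall w, \int[lebesgue_measure]_(u in `]-oo, 0%R]) (f (X w) u)%:E = tau%:E}.
  by apply: h => s; apply: integral_ge0 => u _; rewrite lee_fin.
by apply: filterS => w; rewrite /distr_fun /Rintegral => ->.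
Qed.

(** For integrable [phi] the disintegration holds for the positive and the negative
    part, so that the mean of [phi] is the integral of its conditional means. *)
Lemma disintegration_bound (phi : S * R -> R) (Bd : T -> R) :
  measurable_fun setT phi -> P.-integrable setT (EFin \o (fun w => phi (X w, e w))) ->
  measurable_fun setT Bd -> (forall w, 0 <= Bd w)%R ->
  {ae P, forall w, lebesgue_measure.-integrable setT
      (EFin \o (fun u => phi (X w, u) * f (X w) u)%R) /\
    (`|\int[lebesgue_measure]_u (phi (X w, u) * f (X w) u)| <= Bd w)%R} ->
  (`|\int[P]_w phi (X w, e w)|%R%:E <= \int[P]_w (Bd w)%:E).
Proof.
move=> mphi iphi mBd Bd0 ae_bd; have [_ f0 _] := ef.
have mXu : measurable_fun setT (fun z : T * R => (X z.1, z.2)).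
  apply/measurable_fun_pairP; split => /=; last exact: measurable_snd.
  exact: (measurableT_comp mX measurable_fst).
have mf2 := measurable_cond_density mX ef.
pose psi (z : T * R) : \bar R := (phi (X z.1, z.2) * f (X z.1) z.2)%R%:E.
have mpsi : measurable_fun setT psi.
  apply/measurable_EFinP; apply: measurable_funM => //.
  exact: (measurableT_comp mphi mXu).
have absE : \int[P]_w \int[lebesgue_measure]_u `|psi (w, u)| =
    \int[P]_w `|(phi (X w, e w))%:E|.
  rewrite (@ge0_disintegration _ _ _ _ _ P X e f mX me ef (fun z => `|(phi z)%:E|)) => [||z].
  - apply: eq_integral => w _; apply: eq_integral => u _.
    by rewrite /psi EFinM abseM [`|(f _ _)%:E|]gee0_abs// lee_fin.
  - by apply: measurableT_comp => //; exact/measurable_EFinP.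
  - exact: abse_ge0.
have ipsi : (P \x lebesgue_measure).-integrable setT psi.
  have [_ h] := @integrable12ltyP _ _ _ _ _ P lebesgue_measure _ mpsi.
  apply: h; rewrite absE.
  by case/integrableP: iphi.
have E1 : \int[P]_w (phi (X w, e w))%:E = \int[P]_w \int[lebesgue_measure]_u psi (w, u).
  have -> := integral12_prod_meas1 ipsi.
  rewrite integralE [RHS]integralE; congr (_ - _).
  - transitivity (\int[P]_w ((EFin \o phi)^\+ (X w, e w))).
      by apply: eq_integral => w _; rewrite !funeposE.
    rewrite (@ge0_disintegration _ _ _ _ _ P X e f mX me ef ((EFin \o phi)^\+)) => [||z].
    + rewrite [RHS]fubini_tonelli1; last 2 first.
      * exact: measurable_funepos.
      * exact: funepos_ge0.
      apply: eq_integral => w _; apply: eq_integral => u _.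
      by rewrite /psi !funeposE /= maxe_EFinM.
    + by apply: measurable_funepos; exact/measurable_EFinP.
    + exact: funepos_ge0.
  - transitivity (\int[P]_w ((EFin \o phi)^\- (X w, e w))).
      by apply: eq_integral => w _; rewrite !funenegE.
    rewrite (@ge0_disintegration _ _ _ _ _ P X e f mX me ef ((EFin \o phi)^\-)) => [||z].
    + rewrite [RHS]fubini_tonelli1; last 2 first.
      * exact: measurable_funeneg.
      * exact: funeneg_ge0.
      apply: eq_integral => w _; apply: eq_integral => u _.
      by rewrite /psi !funenegE /= -mulNr maxe_EFinM.
    + by apply: measurable_funeneg; exact/measurable_EFinP.
    + exact: funeneg_ge0.
have mF : measurable_fun setT (fun w => \int[lebesgue_measure]_u psi (w, u)).
  exact: (measurable_fubini_F ipsi).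
rewrite /Rintegral -abse_EFin fineK; last exact: (integrable_fin_num measurableT iphi).
rewrite E1; apply: le_trans (le_abse_integral _ measurableT mF) _.
apply: ae_ge0_le_integral => //.
- exact: measurableT_comp.
- by move=> w _; rewrite lee_fin.
- exact/measurable_EFinP.
apply: filterS ae_bd => w [iw bw] _.
have := integrable_fin_num measurableT iw; move=> /fineK.
rewrite /psi /= => <-; rewrite abse_EFin lee_fin; exact: bw.
Qed.

End SignedDisintegration.

(** * Moments of the standardized design *)

Section LinearForms.
Context d (T : measurableType d) (R : realType) (P : probability T R) (p : nat).
Variables (X : T -> p.-tuple R) (S : 'M[R]_p).
Hypothesis mX : measurable_fun setT X.

(** The coordinate in direction [u] of the standardized design vector. *)
Definition lin_form (u : 'cV[R]_p) (x : p.-tuple R) : R := dot u (S *m vec x).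

Lemma lin_formB u v x : lin_form (u - v) x = lin_form u x - lin_form v x.
Proof. exact: dotBl. Qed.

Lemma lin_formZ a u x : lin_form (a *: u) x = a * lin_form u x.
Proof. exact: dotZl. Qed.

Lemma lin_form0 x : lin_form 0 x = 0.
Proof. exact: dot0l. Qed.

Lemma measurable_lin_form u : measurable_fun setT (lin_form u).
Proof.
apply: measurable_sum => j; apply: measurable_funM => //.
under eq_fun => x do rewrite mxE.
apply: measurable_sum => k; apply: measurable_funM => //.
under eq_fun => x do rewrite mxE.
exact: measurable_tnth.
Qed.

Lemma measurable_lin_formX u : measurable_fun setT (fun w => lin_form u (X w)).
Proof. exact: measurableT_comp (measurable_lin_form u) mX. Qed.

Variable ups : R.
Hypothesis ups_gt0 : 0 < ups.
Hypothesis sgX : subgaussian_design P X S ups.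

Let c : R := 8 * ups ^+ 2.
Let c_gt0 : 0 < c. Proof. by rewrite mulr_gt0// exprn_gt0. Qed.
Let psi u w : R := expR (lin_form u (X w) ^+ 2 / c).
Let M0 : R := @sg_const R.
Let psi_ge1 u w : 1 <= psi u w.
Proof. by rewrite -[leLHS]expR0 ler_expR divr_ge0 ?sqr_ge0// ltW. Qed.
Let mpsi u : measurable_fun setT (psi u).
Proof.
apply: measurableT_comp => //; apply: measurable_funM => //.
apply: measurable_funX; exact: measurable_lin_formX.
Qed.

Lemma lin_form_exp_sqr u : norm2 u <= 1 ->
  (\int[P]_w (expR (lin_form u (X w) ^+ 2 / c))%:E <= M0%:E)%E.
Proof.
move=> u1; have [u0|u0] := eqVneq (norm2 u) 0.
  rewrite (norm2_eq0 u0); under eq_integral => w _ do rewrite lin_form0 expr0n mul0r expR0.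
  by rewrite probability_integral_cst lee_fin sg_const_ge1.
pose v := (norm2 u)^-1 *: u; have v1 : norm2 v = 1 by exact: norm2_normalize.
have := subgaussian_exp_sqr (measurable_lin_formX v) ups_gt0 (fun t t0 => @sgX v t v1 t0).
apply: le_trans; apply: ge0_le_integral => //.
- exact/measurable_EFinP/mpsi.
- exact/measurable_EFinP/mpsi.
- move=> w _; rewrite lee_fin ler_expR ler_pM2r ?invr_gt0//.
  rewrite lin_formZ exprMn ler_peMl ?sqr_ge0//.
  rewrite exprVn -[leLHS]invr1 lef_pV2 ?posrE// ?exprn_ile1 ?norm2_ge0//.
  by rewrite exprn_even_gt0.
Qed.

(** All moments are bounded by comparison with the exponential square. *)
Lemma le_integral_psi (g : T -> R) k u v : 0 <= k -> norm2 u <= 1 -> norm2 v <= 1 ->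
  measurable_fun setT g -> (forall w, 0 <= g w <= k * (psi u w + psi v w)) ->
  (\int[P]_w (g w)%:E <= (k * (2 * M0))%:E)%E.
Proof.
move=> k0 u1 v1 mg gk.
apply: (@le_trans _ _ (\int[P]_w (k%:E * ((psi u w)%:E + (psi v w)%:E)))%E).
  apply: ge0_le_integral => //.
  - by move=> w _; rewrite lee_fin; case/andP: (gk w).
  - exact/measurable_EFinP.
  - by apply: measurable_funeM; apply: emeasurable_funD; exact/measurable_EFinP/mpsi.
  - by move=> w _; rewrite -EFinD -EFinM lee_fin; case/andP: (gk w).
have pg0 z w : setT w -> (0 <= (psi z w)%:E)%E by rewrite lee_fin expR_ge0.
rewrite ge0_integralZl ?lee_fin//; last 2 first.
- by apply: emeasurable_funD; exact/measurable_EFinP/mpsi.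
- by move=> w _; rewrite adde_ge0 ?lee_fin ?expR_ge0.
rewrite EFinM; apply: lee_wpmul2l; first by rewrite lee_fin.
rewrite ge0_integralD//; try exact/measurable_EFinP/mpsi; try by move=> w; exact: pg0.
rewrite mulr_natl mulr2n EFinD; apply: leeD; exact: lin_form_exp_sqr.
Qed.

Lemma sqr_le_psi u w : lin_form u (X w) ^+ 2 <= c * psi u w.
Proof.
rewrite -ler_pdivrMl// mulrC.
by apply: le_trans (expR_ge1Dx _); rewrite lerDr.
Qed.

Lemma sqr_le_expR (y : R) : 0 <= y -> y ^+ 2 <= 4 * expR y.
Proof.
move=> y0; have h := expR_ge1Dx (y / 2).
have -> : expR y = expR (y / 2) ^+ 2 by rewrite -expRM_natl; congr expR; field.
have : (1 + y / 2) ^+ 2 <= expR (y / 2) ^+ 2.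
  by rewrite ler_sqr ?nnegrE ?expR_ge0// addr_ge0// divr_ge0.
by rewrite !expr2; nra.
Qed.

Lemma pow4_le_psi u w : lin_form u (X w) ^+ 4 <= 4 * c ^+ 2 * psi u w.
Proof.
have := @sqr_le_expR (lin_form u (X w) ^+ 2 / c) (divr_ge0 (sqr_ge0 _) (ltW c_gt0)).
rewrite -/(psi u w) expr_div_n ler_pdivrMr ?exprn_gt0// -exprM.
by rewrite mulrAC.
Qed.

Let normr_mul_le (a b : R) : `|a * b| <= (a ^+ 2 + b ^+ 2) / 2.
Proof.
rewrite normrM -[a ^+ 2]real_normK ?num_real// -[b ^+ 2]real_normK ?num_real//.
have := sqr_ge0 (`|a| - `|b|); rewrite sqrrB; nra.
Qed.

(** Moment bounds that depend on the sub-Gaussian constant only; [mom4] and [mom5]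
    are for second moments with an exponential weight. *)
Definition mom1 : R := (1 + c) / 2 * (2 * M0).
Definition mom2 : R := c / 2 * (2 * M0).
Definition mom3 : R := (4 * c ^+ 2 + c) / 2 * (2 * M0).
Definition mom4 : R := 8 * c ^+ 2 * (2 * M0).
Definition mom5 : R := 8 * c ^+ 2 * expR c^-1 * (2 * M0).

Let M0_ge1 : 1 <= M0. Proof. exact: sg_const_ge1. Qed.

Lemma mom1_gt0 : 0 < mom1. Proof. by rewrite /mom1; move: c_gt0 M0_ge1; nra. Qed.
Lemma mom2_gt0 : 0 < mom2. Proof. by rewrite /mom2; move: c_gt0 M0_ge1; nra. Qed.
Lemma mom3_gt0 : 0 < mom3.
Proof.
have M1 := lt_le_trans ltr01 M0_ge1.
by rewrite mulr_gt0 ?divr_gt0 ?addr_gt0 ?mulr_gt0 ?exprn_gt0.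
Qed.
Lemma mom4_gt0 : 0 < mom4.
Proof. have M1 := lt_le_trans ltr01 M0_ge1; by rewrite !mulr_gt0 ?exprn_gt0. Qed.
Lemma mom5_gt0 : 0 < mom5.
Proof.
have M1 := lt_le_trans ltr01 M0_ge1.
by rewrite !mulr_gt0 ?exprn_gt0 ?expR_gt0.
Qed.

Lemma lin_form_mom1 u : norm2 u <= 1 ->
  (\int[P]_w `|lin_form u (X w)|%:E <= mom1%:E)%E.
Proof.
move=> u1; apply: (@le_integral_psi _ _ u u) => //.
- by rewrite divr_ge0// addr_ge0// ltW.
- exact: measurableT_comp (measurable_lin_formX u).
- move=> w; rewrite normr_ge0 /=.
  have h := normr_mul_le 1 (lin_form u (X w)); rewrite mul1r expr1n in h.
  have p1 := psi_ge1 u w; have := mulr_ge0 (ltW c_gt0) (le_trans ler01 p1).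
  have := sqr_le_psi u w; lra.
Qed.

Lemma lin_form_mom2 u v : norm2 u <= 1 -> norm2 v <= 1 ->
  (\int[P]_w `|lin_form u (X w) * lin_form v (X w)|%:E <= mom2%:E)%E.
Proof.
move=> u1 v1; apply: (@le_integral_psi _ _ u v) => //.
- by rewrite divr_ge0// ltW.
- by apply: measurableT_comp => //; apply: measurable_funM; exact: measurable_lin_formX.
- move=> w; rewrite normr_ge0 /=.
  have h := normr_mul_le (lin_form u (X w)) (lin_form v (X w)).
  have := sqr_le_psi u w; have := sqr_le_psi v w; lra.
Qed.

Lemma lin_form_mom3 u v : norm2 u <= 1 -> norm2 v <= 1 ->
  (\int[P]_w (lin_form u (X w) ^+ 2 * `|lin_form v (X w)|)%:E <= mom3%:E)%E.
Proof.
move=> u1 v1; apply: (@le_integral_psi _ _ u v) => //.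
- by rewrite divr_ge0// addr_ge0 ?mulr_ge0 ?sqr_ge0// ltW.
- apply: measurable_funM.
    by apply: measurable_funX; exact: measurable_lin_formX.
  by apply: measurableT_comp => //; exact: measurable_lin_formX.
- move=> w; rewrite mulr_ge0 ?sqr_ge0//=.
  have := normr_mul_le (lin_form u (X w) ^+ 2) (lin_form v (X w)).
  rewrite normrM (ger0_norm (sqr_ge0 _)) -exprM => h.
  have h4 := pow4_le_psi u w; have h2 := sqr_le_psi v w.
  have pu := expR_ge0 (lin_form u (X w) ^+ 2 / c).
  have pv := expR_ge0 (lin_form v (X w) ^+ 2 / c).
  rewrite -/(psi u w) in pu; rewrite -/(psi v w) in pv.
  have := mulr_ge0 (ltW c_gt0) pu.
  have := mulr_ge0 (sqr_ge0 c) pv; lra.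
Qed.

(** By [`|x * y| <= (x ^ 2 + y ^ 2) / 2] the weight and the polynomial factor each
    take a quarter of [x ^ 2 / c + y ^ 2 / c] in the exponent. *)
Lemma lin_form_mom4 u v eta : norm2 u <= 1 -> norm2 v <= 1 -> 0 <= eta <= (2 * c)^-1 ->
  (\int[P]_w ((lin_form u (X w) * lin_form v (X w)) ^+ 2
    * expR (eta * `|lin_form u (X w) * lin_form v (X w)|))%:E <= mom4%:E)%E.
Proof.
move=> u1 v1 /andP[eta0 etac]; apply: (@le_integral_psi _ _ u v) => //.
- by rewrite mulr_ge0 ?sqr_ge0.
- have mM : measurable_fun setT (fun w => lin_form u (X w) * lin_form v (X w)).
    by apply: measurable_funM; exact: measurable_lin_formX.
  apply: measurable_funM; first exact: measurable_funX.
  by apply: measurableT_comp => //; apply: measurable_funM => //; exact: measurableT_comp.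
- move=> w; rewrite mulr_ge0 ?sqr_ge0 ?expR_ge0//=.
  set x := lin_form u (X w); set y := lin_form v (X w).
  pose z := `|x * y| / (2 * c).
  have z0 : 0 <= z by rewrite divr_ge0// mulr_ge0// ltW.
  have h1 : (x * y) ^+ 2 <= 16 * c ^+ 2 * expR z.
    have := sqr_le_expR z0; rewrite /z expr_div_n real_normK ?num_real//.
    rewrite ler_pdivrMr ?exprn_gt0 ?mulr_gt0// => /le_trans; apply.
    by rewrite exprMn -/z; apply: eq_ler; ring.
  have h2 : expR (eta * `|x * y|) <= expR z.
    by rewrite ler_expR /z mulrC ler_wpM2l.
  have h3 : expR z * expR z <= (psi u w + psi v w) / 2.
    rewrite -expRD; have zz : z + z <= (x ^+ 2 / c) / 2 + (y ^+ 2 / c) / 2.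
      rewrite (_ : z + z = `|x * y| / c); last by rewrite /z; field; exact: lt0r_neq0.
      rewrite [leRHS](_ : _ = (x ^+ 2 + y ^+ 2) / 2 / c); last by field; exact: lt0r_neq0.
      by rewrite ler_pM2r ?invr_gt0//; exact: normr_mul_le.
    apply: (@le_trans _ _ (expR (x ^+ 2 / c / 2) * expR (y ^+ 2 / c / 2))).
      by rewrite -expRD ler_expR.
    have e2 a : expR (a / c) = expR (a / c / 2) ^+ 2.
      by rewrite -expRM_natl; congr expR; field; exact: lt0r_neq0.
    rewrite /psi !e2 -/x -/y.
    have := sqr_ge0 (expR (x ^+ 2 / c / 2) - expR (y ^+ 2 / c / 2)).
    rewrite sqrrB; lra.
  apply: (@le_trans _ _ (16 * c ^+ 2 * expR z * expR z)).
    by apply: ler_pM; rewrite ?sqr_ge0 ?expR_ge0.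
  rewrite -mulrA; apply: (@le_trans _ _ (16 * c ^+ 2 * ((psi u w + psi v w) / 2))).
    have c16 : 0 <= 16 * c ^+ 2 by rewrite mulr_ge0 ?sqr_ge0.
    exact: ler_wpM2l c16 _ _ h3.
  by apply: eq_ler; field.
Qed.

Lemma lin_form_mom5 u eta : norm2 u <= 1 -> 0 <= eta <= (2 * c)^-1 ->
  (\int[P]_w (lin_form u (X w) ^+ 2 * expR (eta * `|lin_form u (X w)|))%:E
    <= mom5%:E)%E.
Proof.
move=> u1 /andP[eta0 etac]; apply: (@le_integral_psi _ _ u u) => //.
- by apply: mulr_ge0; [rewrite mulr_ge0 ?sqr_ge0|exact: expR_ge0].
- apply: measurable_funM; first by apply: measurable_funX; exact: measurable_lin_formX.
  apply: measurableT_comp => //; apply: measurable_funM => //.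
  by apply: measurableT_comp => //; exact: measurable_lin_formX.
- move=> w; rewrite mulr_ge0 ?sqr_ge0 ?expR_ge0//=.
  set x := lin_form u (X w).
  pose z := `|x| / (2 * c).
  have z0 : 0 <= z by rewrite divr_ge0// mulr_ge0// ltW.
  have h1 : x ^+ 2 <= 16 * c ^+ 2 * expR z.
    have := sqr_le_expR z0; rewrite /z expr_div_n real_normK ?num_real//.
    rewrite ler_pdivrMr ?exprn_gt0 ?mulr_gt0// => /le_trans; apply.
    by rewrite exprMn -/z; apply: eq_ler; ring.
  have h2 : expR (eta * `|x|) <= expR z.
    by rewrite ler_expR /z mulrC ler_wpM2l.
  have h3 : expR z * expR z <= expR c^-1 * psi u w.
    rewrite -expRD /psi -expRD ler_expR -/x.
    have h := normr_mul_le 1 x; rewrite mul1r expr1n in h.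
    rewrite (_ : z + z = `|x| / c); last by rewrite /z; field; exact: lt0r_neq0.
    rewrite -[c^-1 in X in _ <= X + _]mul1r -mulrDl ler_pM2r ?invr_gt0//.
    by have := sqr_ge0 x; lra.
  apply: (@le_trans _ _ (16 * c ^+ 2 * expR z * expR z)).
    by apply: ler_pM; rewrite ?sqr_ge0 ?expR_ge0.
  rewrite -mulrA; apply: (@le_trans _ _ (16 * c ^+ 2 * (expR c^-1 * psi u w))).
    have c16 : 0 <= 16 * c ^+ 2 by rewrite mulr_ge0 ?sqr_ge0.
    exact: ler_wpM2l c16 _ _ h3.
  by apply: eq_ler; field.
Qed.

Lemma lin_form_integrable u : P.-integrable setT (EFin \o (fun w => lin_form u (X w))).
Proof.
have [u0|u0] := eqVneq (norm2 u) 0.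
  rewrite (norm2_eq0 u0) (_ : _ \o _ = cst 0%E); first exact: integrable0.
  by apply/funext => w /=; rewrite lin_form0.
rewrite (_ : (fun w => _) = (fun w => norm2 u * lin_form ((norm2 u)^-1 *: u) (X w))).
  apply: integrableRZ; apply/integrableP; split.
    exact/measurable_EFinP/measurable_lin_formX.
  by apply: le_lt_trans (lin_form_mom1 _) (ltry _); rewrite norm2_normalize.
by apply/funext => w; rewrite lin_formZ mulrA mulfV// mul1r.
Qed.

Lemma lin_form2_integrable u v :
  P.-integrable setT (EFin \o (fun w => lin_form u (X w) * lin_form v (X w))).
Proof.
have [u0|u0] := eqVneq (norm2 u) 0.
  rewrite (norm2_eq0 u0) (_ : _ \o _ = cst 0%E); first exact: integrable0.
  by apply/funext => w /=; rewrite lin_form0 mul0r.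
have [v0|v0] := eqVneq (norm2 v) 0.
  rewrite (norm2_eq0 v0) (_ : _ \o _ = cst 0%E); first exact: integrable0.
  by apply/funext => w /=; rewrite lin_form0 mulr0.
rewrite (_ : (fun w => _) = (fun w => norm2 u * norm2 v *
   (lin_form ((norm2 u)^-1 *: u) (X w) * lin_form ((norm2 v)^-1 *: v) (X w)))).
  apply: integrableRZ; apply/integrableP; split.
    by apply/measurable_EFinP; apply: measurable_funM; exact: measurable_lin_formX.
  by apply: le_lt_trans (lin_form_mom2 _ _) (ltry _); rewrite norm2_normalize.
apply/funext => w; rewrite !lin_formZ; field.
by rewrite u0 v0.
Qed.

End LinearForms.

(** * One observation: increments and score *)

Section Population.
Context d (T : measurableType d) (R : realType) (P : probability T R) (p : nat).
Variables (X : T -> p.-tuple R) (e : T -> R) (f : p.-tuple R -> R -> R) (S : 'M[R]_p).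
Variables (K : R -> R) (kap1 kap2 kapu h ups tau l0 fbar flow kb : R).
Hypotheses (mX : measurable_fun setT X) (me : measurable_fun setT e).
Hypothesis ef : cond_density P X e f.
Hypothesis HK : kernel_assumption K kap1 kap2 kapu.
Hypothesis h_gt0 : 0 < h.
Hypothesis ups_gt0 : 0 < ups.
Hypothesis sgX : subgaussian_design P X S ups.
Hypothesis dens : density_assumption P X f flow l0 fbar.
Hypotheses (l0_ge0 : 0 <= l0) (fbar_ge0 : 0 <= fbar) (flow_ge0 : 0 <= flow).
Hypothesis tau_ge0 : 0 <= tau.
Hypothesis tauP : cond_prob P X [set w | e w <= 0] (fun=> tau%:E).
Hypotheses (kb_gt0 : 0 < kb) (kapu_le : kapu <= kb).

Local Notation leb := (@lebesgue_measure R).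
Local Notation G := (smooth_cdf K h).
Local Notation L := (lin_form S).
Let c : R := 8 * ups ^+ 2.

Lemma measurable_cond_density_section x : measurable_fun setT (f x).
Proof.
have [mf _ _] := ef.
exact: (measurableT_comp mf (pair1_measurable x)).
Qed.

Let f_ge0 x u : 0 <= f x u. Proof. by have [] := ef. Qed.

Lemma ae_regular : {ae P, forall w,
  [/\ (\int[leb]_u (f (X w) u)%:E = 1)%E, flow <= f (X w) 0,
      forall u v, `|f (X w) u - f (X w) v| <= l0 * `|u - v|,
      forall u, f (X w) u <= fbar & distr_fun (f (X w)) 0 = tau]}.
Proof.
apply: filterS3 (cond_density_total mX ef) (cond_prob_distr_fun mX ef tau_ge0 tauP) dens.
by move=> w h1 h2 [h3 h4 h5].
Qed.

(** The change of the smoothed indicator at an observation [z] of the design and the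
    noise, when the standardized parameter moves from [a] to [b]. *)
Definition cdf_incr (a b : 'cV[R]_p) (z : p.-tuple R * R) : R :=
  G (L b z.1 - z.2) - G (L a z.1 - z.2).

Let mL1 a : measurable_fun setT (fun z : p.-tuple R * R => L a z.1).
Proof. exact: (measurableT_comp (measurable_lin_form S a) measurable_fst). Qed.

Let mG : measurable_fun setT G := measurable_smooth_cdf HK h_gt0.

Let mGL a : measurable_fun setT (fun z : p.-tuple R * R => G (L a z.1 - z.2)).
Proof.
by apply: (measurableT_comp mG); exact: measurable_funB.
Qed.

Lemma measurable_cdf_incr a b : measurable_fun setT (cdf_incr a b).
Proof. by apply: measurable_funB; exact: mGL. Qed.

Let mXe : measurable_fun setT (fun w => (X w, e w)).
Proof. by apply/measurable_fun_pairP. Qed.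

Lemma cdf_incr_le1 a b z : `|cdf_incr a b z| <= 1.
Proof.
rewrite /cdf_incr ler_norml.
have g1 := smooth_cdf_ge0 HK h (L a z.1 - z.2).
have g2 := smooth_cdf_ge0 HK h (L b z.1 - z.2).
have g3 := smooth_cdf_le1 HK h (L a z.1 - z.2).
have g4 := smooth_cdf_le1 HK h (L b z.1 - z.2).
by apply/andP; split; lra.
Qed.

Lemma cdf_incr_lip a b z : `|cdf_incr a b z| <= kb / h * `|L (b - a) z.1|.
Proof.
apply: le_trans (smooth_cdf_lip HK h_gt0 _ _) _.
rewrite (_ : L b z.1 - z.2 - _ = L (b - a) z.1); last by rewrite lin_formB; ring.
by rewrite ler_wpM2r// ler_wpM2r// invr_ge0 ltW.
Qed.

Let iL u := lin_form_integrable mX ups_gt0 sgX u.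

Lemma cdf_incr_integrable a b u :
  P.-integrable setT (EFin \o (fun w => cdf_incr a b (X w, e w) * L u (X w))).
Proof.
apply: (integrable_bounded_mul (iL u) (M := 1)).
  exact: (measurableT_comp (measurable_cdf_incr a b) mXe).
by move=> w; exact: cdf_incr_le1.
Qed.

Let kbh : 0 < kb / h. Proof. by rewrite divr_gt0. Qed.

(** One factor of the squared increment, and the one in the exponential, are
    bounded through the Lipschitz constant [kb / h]; the remaining factor is
    averaged over the noise, which gains a factor [h] and leaves [1 / h] instead of
    [1 / h ^ 2]. *)
Lemma cdf_incr_second_moment (a b u : 'cV[R]_p) (lam delta : R) : norm2 u <= 1 -> 0 < delta ->
  norm2 (b - a) <= delta -> `|lam| * (kb * delta / h) <= (2 * c)^-1 ->
  (\int[P]_w ((cdf_incr a b (X w, e w) * L u (X w)) ^+ 2 *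
      expR (`|lam| * `|cdf_incr a b (X w, e w) * L u (X w)|))%:E <=
   (kb * fbar * delta ^+ 2 / h * mom4 ups)%:E)%E.
Proof.
move=> u1 dl0 bad lamc.
pose s x := L (b - a) x.
pose Phi x := kb / h * `|s x| * L u x ^+ 2 * expR (`|lam| * (kb / h * `|s x| * `|L u x|)).
have ms : measurable_fun setT (fun x => `|s x|).
  exact: (measurableT_comp _ (measurable_lin_form S (b - a))).
have mPhi : measurable_fun setT Phi.
  apply: measurable_funM.
    apply: measurable_funM; first exact: measurable_funM.
    by apply: measurable_funX; exact: measurable_lin_form.
  apply: measurableT_comp => //; apply: measurable_funM => //.
  apply: measurable_funM; first exact: measurable_funM.
  by apply: measurableT_comp => //; exact: measurable_lin_form.
have Phi0 x : 0 <= Phi x.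
  apply: mulr_ge0; last exact: expR_ge0.
  by apply: mulr_ge0; [rewrite mulr_ge0// ltW | exact: sqr_ge0].
pose phi (z : p.-tuple R * R) := `|cdf_incr a b z| * Phi z.1.
have mphi : measurable_fun setT phi.
  apply: measurable_funM; last exact: (measurableT_comp mPhi measurable_fst).
  by apply: measurableT_comp => //; exact: measurable_cdf_incr.
have phi0 z : 0 <= phi z by rewrite mulr_ge0.
have mD : measurable_fun setT (fun w => cdf_incr a b (X w, e w)).
  exact: (measurableT_comp (measurable_cdf_incr a b) mXe).
have mLu := measurable_lin_formX S mX u.
apply: (@le_trans _ _ (\int[P]_w (phi (X w, e w))%:E)%E).
  apply: ge0_le_integral => //.
  - by move=> w _; rewrite lee_fin mulr_ge0 ?sqr_ge0 ?expR_ge0.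
  - apply/measurable_EFinP; apply: measurable_funM.
      by apply: measurable_funX; exact: measurable_funM.
    apply: measurableT_comp => //; apply: measurable_funM => //.
    by apply: measurableT_comp => //; exact: measurable_funM.
  - by apply/measurable_EFinP; exact: (measurableT_comp mphi mXe).
  - move=> w _; rewrite lee_fin /phi /Phi /=.
    have := cdf_incr_lip a b (X w, e w); rewrite /= -/(s (X w)).
    set D := cdf_incr a b (X w, e w) => HD.
    have H1 : (D * L u (X w)) ^+ 2 <= `|D| * (kb / h * `|s (X w)| * L u (X w) ^+ 2).
      rewrite exprMn -[D ^+ 2]real_normK ?num_real// [`|D| ^+ 2]expr2 -[leLHS]mulrA.
      by rewrite ler_wpM2l// ler_wpM2r ?sqr_ge0.
    have H2 : expR (`|lam| * `|D * L u (X w)|) <=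
        expR (`|lam| * (kb / h * `|s (X w)| * `|L u (X w)|)).
      by rewrite ler_expR ler_wpM2l// normrM ler_wpM2r.
    by rewrite mulrA; apply: ler_pM; rewrite ?sqr_ge0 ?expR_ge0.
have mphiE : measurable_fun setT (EFin \o phi) by exact/measurable_EFinP.
have := ge0_disintegration mX me ef mphiE (fun z => _ : (0 <= (EFin \o phi) z)%E).
move=> -> ; last by move=> z; rewrite lee_fin.
pose B w := Phi (X w) * (fbar * `|s (X w)|).
have mB : measurable_fun setT B.
  apply: measurable_funM; first exact: (measurableT_comp mPhi mX).
  by apply: measurable_funM => //; exact: (measurableT_comp ms mX).
have mXu : measurable_fun setT (fun z : T * R => (X z.1, z.2)).
  apply/measurable_fun_pairP; split => /=; last exact: measurable_snd.
  exact: (measurableT_comp mX measurable_fst).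
have B0 w : 0 <= B w by rewrite mulr_ge0// mulr_ge0.
pose F (z : T * R) : \bar R := ((phi (X z.1, z.2))%:E * (f (X z.1) z.2)%:E)%E.
have mF : measurable_fun setT F.
  apply: emeasurable_funM.
    by apply/measurable_EFinP; exact: (measurableT_comp mphi mXu).
  by apply/measurable_EFinP; exact: (measurable_cond_density mX ef).
have F0 z : (0 <= F z)%E by rewrite mule_ge0 ?lee_fin//; exact: phi0.
have mfub := measurable_fun_fubini_tonelli_F (m2 := leb) F mF F0.
apply: (@le_trans _ _ (\int[P]_w (B w)%:E)%E).
  apply: ae_ge0_le_integral => //.
  - move=> w _; apply: integral_ge0 => z _; rewrite mule_ge0 ?lee_fin//; exact: phi0.
  - by move=> w _; rewrite lee_fin.
  - exact/measurable_EFinP.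
  apply: filterS ae_regular => w [f1 f2 f3 f4 f5] _.
  have mfw := measurable_cond_density_section (X w).
  have iD : leb.-integrable setT (EFin \o (fun u => `|cdf_incr a b (X w, u)| * f (X w) u)).
    apply: (integrable_bounded_mul (density_integrable mfw (f_ge0 _) f1 measurableT) (M := 1)).
      apply: measurableT_comp => //.
      exact: (measurableT_comp (measurable_cdf_incr a b) (pair1_measurable (X w))).
    by move=> z; rewrite normr_id; exact: cdf_incr_le1.
  rewrite (_ : (\int[leb]_u _)%E = ((Phi (X w))%:E *
      (\int[leb]_u (`|cdf_incr a b (X w, u)| * f (X w) u)%:E))%E); last first.
    rewrite -ge0_integralZl//; last 3 first.
    - exact: (measurable_int _ iD).
    - by move=> z _; rewrite lee_fin mulr_ge0.
    - by rewrite lee_fin.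
    by apply: eq_integral => z _; rewrite -!EFinM /phi /= mulrAC mulrC.
  rewrite -(fineK (integrable_fin_num measurableT iD)) -EFinM lee_fin.
  rewrite /B ler_wpM2l//.
  apply: le_trans (conditional_mean_lip HK h_gt0 mfw (f_ge0 _) f1 f4 (L a (X w)) (L b (X w))) _.
  by rewrite /s lin_formB.
have dl1 := ltW dl0.
pose v := delta^-1 *: (b - a).
have v1 : norm2 v <= 1.
  by rewrite norm2Z ger0_norm ?invr_ge0// ler_pdivrMl// mulr1.
have sv x : s x = delta * L v x.
  by rewrite /v lin_formZ mulrA mulfV ?mul1r// gt_eqF.
pose eta := `|lam| * (kb * delta / h).
have eta0 : 0 <= eta by rewrite mulr_ge0// mulr_ge0 ?invr_ge0 ?(ltW h_gt0)// mulr_ge0// ltW.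
pose Q w := (L v (X w) * L u (X w)) ^+ 2 * expR (eta * `|L v (X w) * L u (X w)|).
have BQ w : B w = kb * fbar * delta ^+ 2 / h * Q w.
  rewrite /B /Phi /Q /eta !sv !normrM (ger0_norm dl1) exprMn.
  rewrite -[L v (X w) ^+ 2]real_normK ?num_real//.
  rewrite (_ : `|lam| * (kb / h * (delta * `|L v (X w)|) * `|L u (X w)|) =
     `|lam| * (kb * delta / h) * (`|L v (X w)| * `|L u (X w)|)); last by ring.
  by ring.
under eq_integral => w _ do rewrite BQ EFinM.
have Q0 w : 0 <= Q w by rewrite mulr_ge0 ?sqr_ge0 ?expR_ge0.
have mLv := measurable_lin_formX S mX v.
have mQ : measurable_fun setT Q.
  apply: measurable_funM; first by apply: measurable_funX; exact: measurable_funM.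
  apply: measurableT_comp => //; apply: measurable_funM => //.
  by apply: measurableT_comp => //; exact: measurable_funM.
have k0 : 0 <= kb * fbar * delta ^+ 2 / h.
  by rewrite mulr_ge0 ?invr_ge0 ?(ltW h_gt0)// !mulr_ge0 ?sqr_ge0// ltW.
rewrite ge0_integralZl ?lee_fin//; last 2 first.
- exact/measurable_EFinP.
- by move=> w _; rewrite lee_fin.
rewrite [leRHS]EFinM; apply: lee_wpmul2l; first by rewrite lee_fin.
by apply: lin_form_mom4 => //; rewrite eta0.
Qed.

Lemma cdf_incr_mgf (a b u : 'cV[R]_p) (lam delta : R) : norm2 u <= 1 -> 0 < delta ->
  norm2 (b - a) <= delta -> `|lam| * (kb * delta / h) <= (2 * c)^-1 ->
  (\int[P]_w (expR (lam * (cdf_incr a b (X w, e w) * L u (X w) -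
      \int[P]_w (cdf_incr a b (X w, e w) * L u (X w)))))%:E <=
   (expR (lam ^+ 2 * (kb * fbar * delta ^+ 2 / h * mom4 ups)))%:E)%E.
Proof.
move=> u1 dl0 bad lamc; apply: centered_mgf_le; first exact: cdf_incr_integrable.
exact: cdf_incr_second_moment.
Qed.

(** The score of one observation at the true parameter. *)
Definition score (z : p.-tuple R * R) : R := tau - G (- z.2).

Hypothesis tau_le1 : tau <= 1.

Lemma score_le1 z : `|score z| <= 1.
Proof.
have g1 := smooth_cdf_ge0 HK h (- z.2); have g2 := smooth_cdf_le1 HK h (- z.2).
by rewrite ler_norml /score; apply/andP; split; move: tau_ge0 tau_le1; lra.
Qed.

Lemma measurable_score : measurable_fun setT score.
Proof.
apply: measurable_funB => //; apply: (measurableT_comp mG).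
by apply: measurableT_comp => //; exact: measurable_snd.
Qed.

Lemma score_integrable u :
  P.-integrable setT (EFin \o (fun w => score (X w, e w) * L u (X w))).
Proof.
apply: (integrable_bounded_mul (iL u) (M := 1)).
  exact: (measurableT_comp measurable_score mXe).
by move=> w; exact: score_le1.
Qed.

Lemma score_mgf (u : 'cV[R]_p) (lam : R) : norm2 u <= 1 -> `|lam| <= (2 * c)^-1 ->
  (\int[P]_w (expR (lam * (score (X w, e w) * L u (X w) -
      \int[P]_w (score (X w, e w) * L u (X w)))))%:E <=
   (expR (lam ^+ 2 * mom5 ups))%:E)%E.
Proof.
move=> u1 lamc; apply: centered_mgf_le; first exact: score_integrable.
have mLu := measurable_lin_formX S mX u.
have mS : measurable_fun setT (fun w => score (X w, e w)).
  exact: (measurableT_comp measurable_score mXe).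
apply: le_trans (lin_form_mom5 mX ups_gt0 sgX u1 (eta := `|lam|) _); last by rewrite normr_ge0.
apply: ge0_le_integral => //.
- by move=> w _; rewrite lee_fin mulr_ge0 ?sqr_ge0 ?expR_ge0.
- apply/measurable_EFinP; apply: measurable_funM.
    by apply: measurable_funX; exact: measurable_funM.
  apply: measurableT_comp => //; apply: measurable_funM => //.
  by apply: measurableT_comp => //; exact: measurable_funM.
- apply/measurable_EFinP; apply: measurable_funM; first exact: measurable_funX.
  by apply: measurableT_comp => //; apply: measurable_funM => //; exact: measurableT_comp.
- move=> w _; rewrite lee_fin; have s1 := score_le1 (X w, e w).
  have hle : `|score (X w, e w) * L u (X w)| <= `|L u (X w)|.
    by rewrite normrM ler_piMl.
  apply: ler_pM; rewrite ?sqr_ge0 ?expR_ge0//.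
    by rewrite -[leLHS]real_normK ?num_real// -[leRHS]real_normK ?num_real// ler_sqr ?nnegrE.
  by rewrite ler_expR ler_wpM2l.
Qed.

(** Given the design, [g] is a constant and comes out of the conditional mean. *)
Lemma conditional_bound (A : p.-tuple R * R -> R) (g B : p.-tuple R -> R) :
  measurable_fun setT A -> measurable_fun setT g -> measurable_fun setT B ->
  (forall x, 0 <= B x) ->
  P.-integrable setT (EFin \o (fun w => A (X w, e w) * g (X w))) ->
  {ae P, forall w, (exists M, forall u, `|A (X w, u)| <= M) /\
     `|\int[leb]_u (A (X w, u) * f (X w) u)| <= B (X w)} ->
  (`|\int[P]_w (A (X w, e w) * g (X w))|%:E <=
    \int[P]_w (B (X w) * `|g (X w)|)%:E)%E.
Proof.
move=> mA mg mB B0 iA hA.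
pose phi (z : p.-tuple R * R) := A z * g z.1.
apply: (disintegration_bound (phi := phi) mX me ef) => //.
- by apply: measurable_funM => //; exact: (measurableT_comp mg measurable_fst).
- apply: measurable_funM; first exact: (measurableT_comp mB mX).
  by apply: measurableT_comp => //; exact: (measurableT_comp mg mX).
- by move=> w; rewrite mulr_ge0.
apply: filterS2 hA ae_regular => w [[M AM] AB] [f1 _ _ _ _].
have mfw := measurable_cond_density_section (X w).
have iA1 : leb.-integrable setT (EFin \o (fun u => A (X w, u) * f (X w) u)).
  apply: (integrable_bounded_mul (density_integrable mfw (f_ge0 _) f1 measurableT) (M := M)) => //.
  exact: (measurableT_comp mA (pair1_measurable (X w))).
have E : (fun u => phi (X w, u) * f (X w) u) = (fun u => g (X w) * (A (X w, u) * f (X w) u)).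
  by apply/funext => u; rewrite /phi /=; ring.
rewrite E; split; first exact: (integrableRZ (g (X w)) iA1).
by rewrite (RintegralZl (g (X w)) measurableT iA1) normrM mulrC ler_wpM2r.
Qed.

Let msK : measurable_fun setT (fun z : p.-tuple R * R => scaled_kernel K h z.2).
Proof. exact: (measurableT_comp (measurable_scaled_kernel HK h) measurable_snd). Qed.

Let sK_norm u : `|scaled_kernel K h u| <= kb / h.
Proof.
rewrite ger0_norm ?(scaled_kernel_ge0 HK)// (le_trans (scaled_kernel_le HK h_gt0 u))//.
by rewrite ler_wpM2r// invr_ge0 ltW.
Qed.

Let le_integralZ (F : T -> R) (k M : R) : 0 <= k -> measurable_fun setT F ->
  (forall w, 0 <= F w) -> (\int[P]_w (F w)%:E <= M%:E)%E ->
  (\int[P]_w (k * F w)%:E <= (k * M)%:E)%E.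
Proof.
move=> k0 mF F0 FM; under eq_integral => w _ do rewrite EFinM.
rewrite ge0_integralZl ?lee_fin//; last 2 first.
- exact/measurable_EFinP.
- by move=> w _; rewrite lee_fin.
by rewrite EFinM; apply: lee_wpmul2l; rewrite ?lee_fin.
Qed.

Lemma kernel_weighted_integrable (a u : 'cV[R]_p) : P.-integrable setT
  (EFin \o (fun w => scaled_kernel K h (e w) * (L a (X w) * L u (X w)))).
Proof.
apply: (integrable_bounded_mul (lin_form2_integrable mX ups_gt0 sgX a u) (M := kb / h)) => //.
exact: (measurableT_comp (measurable_scaled_kernel HK h) me).
Qed.

(** The conditional error [l0 * L a x ^ 2] is integrated against a third moment. *)
Lemma population_linearization (a u : 'cV[R]_p) : norm2 u <= 1 ->
  `|\int[P]_w (cdf_incr 0 a (X w, e w) * L u (X w)) -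
    \int[P]_w (scaled_kernel K h (e w) * (L a (X w) * L u (X w)))|
  <= l0 * norm2 a ^+ 2 * mom3 ups.
Proof.
move=> u1; have [v v1 av] := norm2_polar a.
have i1 := cdf_incr_integrable 0 a u; have i2 := kernel_weighted_integrable a u.
rewrite -(RintegralB measurableT i1 i2).
pose A (z : p.-tuple R * R) := cdf_incr 0 a z - L a z.1 * scaled_kernel K h z.2.
have E : (fun w => cdf_incr 0 a (X w, e w) * L u (X w) -
      scaled_kernel K h (e w) * (L a (X w) * L u (X w))) =
    (fun w => A (X w, e w) * L u (X w)).
  by apply/funext => w; rewrite /A /=; ring.
have iA : P.-integrable setT (EFin \o (fun w => A (X w, e w) * L u (X w))).
  by rewrite -E; exact: integrableRB.
rewrite E -lee_fin.
apply: le_trans (conditional_bound (A := A) (g := L u) (B := fun x => l0 * L a x ^+ 2) _ _ _ _ iA _) _.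
- apply: measurable_funB; first exact: measurable_cdf_incr.
  by apply: measurable_funM.
- exact: measurable_lin_form.
- by apply: measurable_funM => //; apply: measurable_funX; exact: measurable_lin_form.
- by move=> x; rewrite mulr_ge0 ?sqr_ge0.
- apply: filterS ae_regular => w [f1 f2 f3 f4 f5].
  have mfw := measurable_cond_density_section (X w); split.
    exists (1 + `|L a (X w)| * (kb / h)) => z; rewrite /A /=.
    apply: le_trans (ler_normB _ _) _; apply: lerD; first exact: cdf_incr_le1.
    by rewrite normrM ler_wpM2l.
  have := conditional_mean_linear HK h_gt0 mfw (f_ge0 _) f1 l0_ge0 f3 f4 (L a (X w)).
  by rewrite /A /cdf_incr /= lin_form0.
have mLu := measurable_lin_formX S mX u; have mLv := measurable_lin_formX S mX v.
pose F w := L v (X w) ^+ 2 * `|L u (X w)|.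
have -> : (fun w => (l0 * L a (X w) ^+ 2 * `|L u (X w)|)%:E) =
    (fun w => (l0 * norm2 a ^+ 2 * F w)%:E).
  by apply/funext => w; rewrite /F [in LHS]av lin_formZ exprMn; congr EFin; ring.
apply: le_integralZ.
- by rewrite mulr_ge0 ?sqr_ge0.
- by apply: measurable_funM; [exact: measurable_funX|exact: measurableT_comp].
- by move=> w; rewrite mulr_ge0 ?sqr_ge0.
- exact: (lin_form_mom3 mX ups_gt0 sgX v1 u1).
Qed.

Let mf0 : measurable_fun setT (fun x => f x 0).
Proof.
have [mf _ _] := ef.
apply: (measurableT_comp mf (g := fun x : p.-tuple R => (x, 0 : R))).
by apply/measurable_fun_pairP; split; [exact: measurable_id | exact: measurable_cst].
Qed.

Lemma density_weighted_integrable (a u : 'cV[R]_p) : P.-integrable setT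
  (EFin \o (fun w => f (X w) 0 * (L a (X w) * L u (X w)))).
Proof.
have i2 := lin_form2_integrable mX ups_gt0 sgX a u.
have mi2 : measurable_fun setT (fun w => L a (X w) * L u (X w)).
  by apply: measurable_funM; exact: measurable_lin_formX.
have mF : measurable_fun setT (fun w => f (X w) 0 * (L a (X w) * L u (X w))).
  by apply: measurable_funM => //; exact: (measurableT_comp mf0 mX).
apply/integrableP; split; first exact/measurable_EFinP.
have /integrableP[_ +] := integrableRZ fbar i2; apply: le_lt_trans.
apply: ae_ge0_le_integral => //.
- by apply: measurableT_comp => //; exact/measurable_EFinP.
- by apply: measurableT_comp => //; apply/measurable_EFinP; exact: measurable_funM.
apply: filterS ae_regular => w [f1 f2 f3 f4 f5] _.
by rewrite /= lee_fin !normrM ler_wpM2r ?mulr_ge0// !ger0_norm.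
Qed.

Lemma population_density (a u : 'cV[R]_p) : norm2 a <= 1 -> norm2 u <= 1 ->
  `|\int[P]_w (scaled_kernel K h (e w) * (L a (X w) * L u (X w))) -
    \int[P]_w (f (X w) 0 * (L a (X w) * L u (X w)))| <= l0 * h * kap1 * mom2 ups.
Proof.
move=> a1 u1.
have i1 := kernel_weighted_integrable a u; have i2 := density_weighted_integrable a u.
rewrite -(RintegralB measurableT i1 i2).
pose A (z : p.-tuple R * R) := scaled_kernel K h z.2 - f z.1 0.
have E : (fun w => scaled_kernel K h (e w) * (L a (X w) * L u (X w)) -
      f (X w) 0 * (L a (X w) * L u (X w))) =
    (fun w => A (X w, e w) * (L a (X w) * L u (X w))).
  by apply/funext => w; rewrite /A /=; ring.
have iA : P.-integrable setT (EFin \o (fun w => A (X w, e w) * (L a (X w) * L u (X w)))).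
  by rewrite -E; exact: integrableRB.
have kap1_ge0 := kernel_moment1_ge0 HK.
have mLa := measurable_lin_form S a; have mLu := measurable_lin_form S u.
rewrite E -lee_fin.
apply: le_trans (conditional_bound (A := A) (g := fun x => L a x * L u x)
  (B := fun=> l0 * h * kap1) _ _ _ _ iA _) _.
- by apply: measurable_funB => //; exact: (measurableT_comp mf0 measurable_fst).
- exact: measurable_funM.
- exact: measurable_cst.
- by move=> x; rewrite !mulr_ge0// ltW.
- apply: filterS ae_regular => w [f1 f2 f3 f4 f5].
  have mfw := measurable_cond_density_section (X w); split.
    exists (kb / h + fbar) => z; rewrite /A /=.
    apply: le_trans (ler_normB _ _) _; apply: lerD => //.
    by rewrite ger0_norm.
  exact: (conditional_mean_density HK h_gt0 mfw (f_ge0 _) f1 f3 f4).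
apply: le_integralZ.
- by rewrite !mulr_ge0// ltW.
- apply: measurableT_comp => //.
  by apply: measurable_funM; exact: measurable_lin_formX.
- by move=> w.
- exact: (lin_form_mom2 mX ups_gt0 sgX a1 u1).
Qed.

Lemma population_bias (u : 'cV[R]_p) : norm2 u <= 1 ->
  `|\int[P]_w (score (X w, e w) * L u (X w))| <= l0 * h ^+ 2 * kap2 * mom1 ups.
Proof.
move=> u1; have i1 := score_integrable u.
have kap2_ge0 := kernel_moment2_ge0 HK.
have k0 : 0 <= l0 * h ^+ 2 * kap2 by do 2 apply: mulr_ge0 => //; exact: sqr_ge0.
pose A (z : p.-tuple R * R) := G (0 - z.2) - tau.
have E : (fun w => score (X w, e w) * L u (X w)) =
    (fun w => A (X w, e w) * (- L u (X w))).
  by apply/funext => w; rewrite /A /score /= sub0r; ring.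
rewrite E in i1 *; rewrite -lee_fin.
apply: le_trans (conditional_bound (A := A) (g := fun x => - L u x)
  (B := fun=> l0 * h ^+ 2 * kap2) _ _ _ _ i1 _) _.
- apply: measurable_funB => //; apply: (measurableT_comp mG).
  by apply: measurable_funB => //; exact: measurable_snd.
- by apply: measurableT_comp => //; exact: measurable_lin_form.
- exact: measurable_cst.
- by [].
- apply: filterS ae_regular => w [f1 f2 f3 f4 f5].
  have mfw := measurable_cond_density_section (X w); split.
    by exists 1 => z; rewrite distrC sub0r; exact: (score_le1 (X w, z)).
  have := conditional_mean_bias HK h_gt0 mfw (f_ge0 _) f1 l0_ge0 f3.
  by rewrite f5.
under eq_integral => w _ do rewrite normrN.
apply: le_integralZ.
- by [].
- by apply: measurableT_comp => //; exact: measurable_lin_formX.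
- by move=> w.
- exact: (lin_form_mom1 mX ups_gt0 sgX u1).
Qed.

Lemma population_curvature (a : 'cV[R]_p) :
  flow * \int[P]_w (L a (X w) * L a (X w)) <=
  \int[P]_w (f (X w) 0 * (L a (X w) * L a (X w))).
Proof.
have i2 := lin_form2_integrable mX ups_gt0 sgX a a.
rewrite -(RintegralZl flow measurableT i2).
have iF := integrableRZ flow i2; have iD := density_weighted_integrable a a.
apply: fine_le; rewrite ?integrable_fin_num//.
have mLa := measurable_lin_formX S mX a.
apply: ae_ge0_le_integral => //.
- by move=> w _; rewrite lee_fin mulr_ge0// -expr2 sqr_ge0.
- exact: (measurable_int _ iF).
- by move=> w _; rewrite lee_fin mulr_ge0// -expr2 sqr_ge0.
- exact: (measurable_int _ iD).
apply: filterS ae_regular => w [f1 f2 f3 f4 f5] _.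
by rewrite lee_fin ler_wpM2r// -expr2 sqr_ge0.
Qed.

End Population.

(** * Standardized Gram matrices *)

Section RintegralSum.
Context d (T : measurableType d) (R : realType) (mu : {measure set T -> \bar R}).
Variables (I : Type) (F : I -> T -> R).
Hypothesis iF : forall i, mu.-integrable setT (EFin \o F i).

Lemma integrableR_sum (r : seq I) :
  mu.-integrable setT (EFin \o (fun w => \sum_(i <- r) F i w)).
Proof.
elim: r => [|i r IH].
  rewrite (_ : _ \o _ = cst 0%E); first exact: integrable0.
  by apply/funext => w /=; rewrite big_nil.
rewrite (_ : (fun w => _) = (fun w => F i w + \sum_(i <- r) F i w)).
  exact: integrableRD.
by apply/funext => w; rewrite big_cons.
Qed.

Lemma Rintegral_sum (r : seq I) :
  \int[mu]_w (\sum_(i <- r) F i w) = \sum_(i <- r) \int[mu]_w F i w.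
Proof.
elim: r => [|i r IH].
  by under eq_Rintegral => w _ do rewrite big_nil; rewrite big_nil /Rintegral integral0.
rewrite big_cons -IH -(RintegralD measurableT (iF i) (integrableR_sum r)).
by apply: eq_Rintegral => w _; rewrite big_cons.
Qed.

End RintegralSum.

Section PositiveDefinite.
Context (R : realType) (p : nat).

Lemma posdefmx_unit (A : 'M[R]_p) : posdefmx A -> A \in unitmx.
Proof.
move=> [As Apos]; rewrite unitmxE unitfE; apply/negP => /det0P[v v0 vA].
have := Apos v^T; rewrite (_ : A *m v^T = 0); last first.
  by rewrite -[A]As -trmx_mul vA trmx0.
rewrite dot0r ltxx => h; suff : false by []; apply: h.
by apply: contra v0 => /eqP h; rewrite -[v]trmxK h trmx0.
Qed.

Lemma inv_sqrtmx_congr (A S : 'M[R]_p) : posdefmx A -> is_inv_sqrtmx A S ->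
  S *m A *m S = 1%:M.
Proof.
move=> Apos [Spos SS]; have Au := posdefmx_unit Apos.
have h : S *m (S *m A) = 1%:M by rewrite mulmxA SS mulVmx.
exact: (mulmx1C h).
Qed.

End PositiveDefinite.

Section Gram.
Context d (T : measurableType d) (R : realType) (P : probability T R) (p : nat).
Variables (X : T -> p.-tuple R) (S : 'M[R]_p).
Hypothesis Ssym : S^T = S.
Hypothesis Sunit : S \in unitmx.
Local Notation L := (lin_form S).

Lemma lin_formE u x : L u x = dot (S *m u) (vec x).
Proof. by rewrite /lin_form dot_mulmx Ssym. Qed.

Lemma tnth_lin_form (j : 'I_p) x : tnth x j = L (invmx S *m delta_mx j 0) x.
Proof.
rewrite lin_formE mulmxA mulmxV// mul1mx /dot (bigD1 j)//= big1.
  by rewrite !mxE !eqxx mul1r addr0.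
by move=> k /negbTE kj; rewrite !mxE kj mul0r.
Qed.

Variable Z : T -> R.
Hypothesis iZ : forall a u : 'cV[R]_p,
  P.-integrable setT (EFin \o (fun w => Z w * (L a (X w) * L u (X w)))).

Lemma weighted_gramE (j k : 'I_p) : weighted_gram P X Z j k =
  \int[P]_w (Z w * (tnth (X w) j * tnth (X w) k)).
Proof. by rewrite mxE unlock. Qed.

Lemma dot_weighted_gram (u v : 'cV[R]_p) :
  dot u (S *m weighted_gram P X Z *m (S *m v)) =
  \int[P]_w (Z w * (L v (X w) * L u (X w))).
Proof.
pose F (jk : 'I_p * 'I_p) w := (S *m u) jk.1 0 * (S *m v) jk.2 0 *
  (Z w * (tnth (X w) jk.1 * tnth (X w) jk.2)).
have iF jk : P.-integrable setT (EFin \o F jk).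
  apply: integrableRZ.
  have := iZ (invmx S *m delta_mx jk.1 0) (invmx S *m delta_mx jk.2 0).
  rewrite (_ : (fun w => _) = (fun w => Z w * (tnth (X w) jk.1 * tnth (X w) jk.2)))//.
  by apply/funext => w; rewrite -!tnth_lin_form.
rewrite -mulmxA dot_mulmx Ssym.
transitivity (\sum_(jk <- index_enum ('I_p * 'I_p)%type) \int[P]_w F jk w).
  rewrite -[RHS](pair_bigA _ (fun j k => \int[P]_w F (j, k) w)) /=.
  rewrite /dot; apply: eq_bigr => j _.
  rewrite [(weighted_gram P X Z *m _) j 0]mxE mulr_sumr; apply: eq_bigr => k _.
  rewrite weighted_gramE [RHS](RintegralZl _ measurableT).
    by rewrite /=; ring.
  have := iZ (invmx S *m delta_mx j 0) (invmx S *m delta_mx k 0).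
  rewrite (_ : (fun w => _) = (fun w => Z w * (tnth (X w) j * tnth (X w) k)))//.
  by apply/funext => w; rewrite -!tnth_lin_form.
rewrite -(Rintegral_sum iF); apply: eq_Rintegral => w _.
rewrite -(pair_bigA _ (fun j k => F (j, k) w)) /= !lin_formE [dot (S *m v) _ * _]mulrC.
rewrite /dot mulr_suml mulr_sumr; apply: eq_bigr => j _.
rewrite !mulr_sumr; apply: eq_bigr => k _.
by rewrite /F /= [vec _ j 0]mxE [vec _ k 0]mxE; ring.
Qed.

End Gram.

Section Standardized.
Context d (T : measurableType d) (R : realType) (P : probability T R) (p : nat).
Variables (X : T -> p.-tuple R) (S : 'M[R]_p) (ups : R).
Hypothesis mX : measurable_fun setT X.
Hypothesis ups_gt0 : 0 < ups.
Hypothesis sgX : subgaussian_design P X S ups.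
Hypothesis Sigma_pos : posdefmx (Sigma_mx P X).
Hypothesis S_sqrt : is_inv_sqrtmx (Sigma_mx P X) S.
Local Notation L := (lin_form S).

(** The design standardized by [S] has the identity as second moment matrix. *)
Lemma lin_form_isometry (u : 'cV[R]_p) : \int[P]_w (L u (X w) * L u (X w)) = norm2 u ^+ 2.
Proof.
have [[Ssym Spos] _] := S_sqrt.
have Su : S \in unitmx by apply: posdefmx_unit; have [] := S_sqrt.
have i1 a b : P.-integrable setT (EFin \o (fun w => 1 * (L a (X w) * L b (X w)))).
  have := lin_form2_integrable mX ups_gt0 sgX a b.
  by rewrite (_ : (fun w => 1 * _) = (fun w => L a (X w) * L b (X w)))//; apply/funext => w; rewrite mul1r.
have := dot_weighted_gram Ssym Su i1 u u.
rewrite -/(Sigma_mx P X) mulmxA inv_sqrtmx_congr// mul1mx -norm2_sqr => ->.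
by apply: eq_Rintegral => w _; rewrite mul1r.
Qed.

Lemma norm2_delta (j : 'I_p) : norm2 (delta_mx j 0 : 'cV[R]_p) = 1.
Proof.
rewrite /norm2 /dot (bigD1 j)//= big1 ?mxE ?eqxx ?mulr1 ?addr0 ?sqrtr1//.
by move=> k /negbTE kj; rewrite !mxE kj mul0r.
Qed.

(** In every unit direction the second moment is 1, and [2 |a| ^ 3 >= 3 a ^ 2 - 1]. *)
Lemma m3_ge1 : (0 < p)%N -> 1 <= m3 P X S.
Proof.
move=> p0; pose j := Ordinal p0.
pose E (u : 'cV[R]_p) := (\int[P]_w (`|L u (X w)| ^+ 3)%:E)%E.
have mL3 u : measurable_fun setT (fun w => `|L u (X w)| ^+ 3).
  by apply: measurable_funX; apply: measurableT_comp => //; exact: measurable_lin_formX.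
have E_le u : norm2 u = 1 -> (E u <= (mom3 ups)%:E)%E.
  move=> u1; apply: le_trans (lin_form_mom3 mX ups_gt0 sgX (u := u) (v := u) _ _).
  - apply: ge0_le_integral => //.
    + exact/measurable_EFinP.
    + apply/measurable_EFinP; apply: measurable_funM.
        by apply: measurable_funX; exact: measurable_lin_formX.
      by apply: measurableT_comp => //; exact: measurable_lin_formX.
    + by move=> w _; rewrite lee_fin exprSr real_normK ?num_real.
  - by rewrite u1.
  - by rewrite u1.
have E_ge u : norm2 u = 1 -> (1 <= E u)%E.
  move=> u1; have i2 := lin_form2_integrable mX ups_gt0 sgX u u.
  have i1 : P.-integrable setT (EFin \o (fun=> 2^-1 : R)).
    apply: integrable_ge0_lty => //.
    by rewrite (probability_integral_cst P) ltry.
  pose g w := 3 / 2 * (L u (X w) * L u (X w)) - 2^-1.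
  have ig : P.-integrable setT (EFin \o g).
    by apply: integrableRB => //; exact: integrableRZ.
  have Rg : \int[P]_w g w = 1.
    rewrite (RintegralB measurableT (integrableRZ (3 / 2) i2) i1).
    rewrite (RintegralZl _ measurableT i2) lin_form_isometry u1 expr1n.
    by rewrite /Rintegral (probability_integral_cst P) /=; field.
  rewrite -Rg /Rintegral fineK; last exact: (integrable_fin_num measurableT ig).
  have i3 : P.-integrable setT (EFin \o (fun w => `|L u (X w)| ^+ 3)).
    apply: integrable_ge0_lty => //.
    by apply: le_lt_trans (E_le u u1) (ltry _).
  apply: le_integral => // w _; rewrite lee_fin /g.
  rewrite -expr2 -[L u (X w) ^+ 2]real_normK ?num_real//.
  have a0 := normr_ge0 (L u (X w)); move: `|_| a0 => a a0.
  have : 0 <= (a - 1) ^+ 2 * (2 * a + 1) by rewrite mulr_ge0 ?sqr_ge0// addr_ge0// mulr_ge0.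
  by lra.
rewrite /m3; set A := [set _ | _ in _].
have sup_le : (ereal_sup A <= (mom3 ups)%:E)%E.
  by apply: ge_ereal_sup => _ [u u1 <-]; rewrite unlock; exact: E_le.
have sup_ge : (1 <= ereal_sup A)%E.
  apply: le_trans (E_ge _ (norm2_delta j)) _.
  apply: ereal_sup_ubound; exists (delta_mx j 0); first exact: norm2_delta.
  by rewrite unlock.
rewrite -lee_fin fineK// fin_numE; apply/andP; split.
  by rewrite gt_eqF// (lt_le_trans _ sup_ge)// ltNyr.
by rewrite lt_eqF// (le_lt_trans sup_le)// ltry.
Qed.

End Standardized.

(** * Empirical means of the standardized design *)

Section EmpiricalProcess.
Context d (T : measurableType d) (R : realType) (P : probability T R) (p n : nat).
Hypotheses (p_gt0 : (0 < p)%N) (n_gt0 : (0 < n)%N).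
Variables (X : T -> p.-tuple R) (e : T -> R) (S : 'M[R]_p) (ups : R).
Variables (Xs : 'I_n -> T -> p.-tuple R) (es : 'I_n -> T -> R).
Hypotheses (mX : measurable_fun setT X) (me : measurable_fun setT e).
Hypothesis mXs : forall i, measurable_fun setT (Xs i).
Hypothesis mes : forall i, measurable_fun setT (es i).
Hypothesis ups_gt0 : 0 < ups.
Hypothesis sgX : subgaussian_design P X S ups.
Hypothesis lawX : forall i, same_law P (fun w => (Xs i w, es i w)) (fun w => (X w, e w)).
Hypothesis indepX : mutually_independent P (fun i w => (Xs i w, es i w)).
Local Notation L := (lin_form S).

Definition emp_mean (psi : p.-tuple R * R -> R) (w : T) : 'cV[R]_p :=
  n%:R^-1 *: \sum_(i < n) psi (Xs i w, es i w) *: (S *m vec (Xs i w)).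

(** The mean of [psi (X, e) *: (S *m vec X)]. *)
Definition pop_mean (psi : p.-tuple R * R -> R) : 'cV[R]_p :=
  \col_j \int[P]_w (psi (X w, e w) * L (delta_mx j 0) (X w)).

Let mXe : measurable_fun setT (fun w => (X w, e w)).
Proof. exact: measurable_fun_pair. Qed.

Let mXes i : measurable_fun setT (fun w => (Xs i w, es i w)).
Proof. exact: measurable_fun_pair. Qed.

Lemma lin_form_sum u x : L u x = \sum_(j < p) u j 0 * L (delta_mx j 0) x.
Proof.
rewrite /lin_form /dot; apply: eq_bigr => j _; congr (_ * _).
rewrite (bigD1 j)//= big1 ?addr0 ?mxE ?eqxx ?mul1r//.
by move=> k /negbTE kj; rewrite !mxE kj mul0r.
Qed.

Lemma dot_emp_mean psi u w :
  dot u (emp_mean psi w) = n%:R^-1 * \sum_(i < n) psi (Xs i w, es i w) * L u (Xs i w).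
Proof.
rewrite /emp_mean dotZr dot_sumr; congr (_ * _); apply: eq_bigr => i _.
by rewrite dotZr.
Qed.

Lemma dot_pop_mean psi u :
  (forall v, P.-integrable setT (EFin \o (fun w => psi (X w, e w) * L v (X w)))) ->
  dot u (pop_mean psi) = \int[P]_w (psi (X w, e w) * L u (X w)).
Proof.
move=> ipsi.
pose F j w := u j 0 * (psi (X w, e w) * L (delta_mx j 0) (X w)).
have iF j : P.-integrable setT (EFin \o F j) by exact: integrableRZ.
transitivity (\int[P]_w \sum_(j < p) F j w); last first.
  apply: eq_Rintegral => w _; rewrite [L u _]lin_form_sum mulr_sumr.
  by apply: eq_bigr => j _; rewrite /F; ring.
rewrite (Rintegral_sum iF); apply: eq_bigr => j _.
by rewrite mxE (RintegralZl (u j 0) measurableT (ipsi (delta_mx j 0))).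
Qed.

Variable psi : 'cV[R]_p -> p.-tuple R * R -> R.
Hypothesis mpsi : forall a, measurable_fun setT (psi a).
Hypothesis psi_0 : forall z, psi 0 z = 0.
Hypothesis psi_integrable : forall a v,
  P.-integrable setT (EFin \o (fun w => psi a (X w, e w) * L v (X w))).
Variable M : R.
Hypothesis M_ge0 : 0 <= M.
Hypothesis psi_lip : forall a b z,
  `|psi a z - psi b z| <= M * (`|L (a - b) z.1| + norm2 (a - b)).

Let iL u := lin_form_integrable mX ups_gt0 sgX u.
Let iL2 u v := lin_form2_integrable mX ups_gt0 sgX u v.

Lemma pop_mean_lip a b :
  norm2 (pop_mean (psi a) - pop_mean (psi b)) <= M * (mom2 ups + mom1 ups) * norm2 (a - b).
Proof.
have N0 := norm2_ge0 (a - b); have m1 := mom1_gt0 ups_gt0; have m2 := mom2_gt0 ups_gt0.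
apply: norm2_le_dot => [|u u1].
  by rewrite mulr_ge0// mulr_ge0// addr_ge0// ltW.
rewrite dotBr !dot_pop_mean//.
rewrite -(RintegralB measurableT (psi_integrable a u) (psi_integrable b u)).
apply: le_trans (ler_norm _) _.
have [v v1 abv] := norm2_polar (a - b).
have iD := integrableRB (psi_integrable a u) (psi_integrable b u).
apply: le_trans (le_normr_Rintegral measurableT iD) _.
rewrite -lee_fin /Rintegral fineK; last first.
  by apply: (integrable_fin_num measurableT); exact: (integrable_norm iD).
apply: (@le_trans _ _ (\int[P]_w ((M * norm2 (a - b))%:E *
    (`|L v (X w) * L u (X w)|%:E + `|L u (X w)|%:E)))%E).
  apply: ge0_le_integral => //.
  - exact: (measurable_int _ (integrable_norm iD)).
  - apply: emeasurable_funM => //; apply: emeasurable_funD.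
    + exact: (measurable_int _ (integrable_norm (iL2 v u))).
    + exact: (measurable_int _ (integrable_norm (iL u))).
  - move=> w _; rewrite -EFinD -EFinM lee_fin -mulrBl normrM.
    apply: le_trans (ler_wpM2r (normr_ge0 _) (psi_lip a b (X w, e w))) _.
    rewrite [in L _ _]abv lin_formZ !normrM (ger0_norm N0) /=.
    by apply: eq_ler; ring.
rewrite ge0_integralZl ?lee_fin ?mulr_ge0//; last 2 first.
- apply: emeasurable_funD.
  + exact: (measurable_int _ (integrable_norm (iL2 v u))).
  + exact: (measurable_int _ (integrable_norm (iL u))).
- by move=> w _; rewrite adde_ge0 ?lee_fin.
rewrite ge0_integralD//; last 2 first.
- exact: (measurable_int _ (integrable_norm (iL2 v u))).
- exact: (measurable_int _ (integrable_norm (iL u))).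
rewrite (_ : M * _ * _ = M * norm2 (a - b) * (mom2 ups + mom1 ups)); last by ring.
rewrite [leRHS]EFinM; apply: lee_wpmul2l; first by rewrite lee_fin mulr_ge0.
rewrite EFinD; apply: leeD.
- exact: (lin_form_mom2 mX ups_gt0 sgX v1 u1).
- exact: (lin_form_mom1 mX ups_gt0 sgX u1).
Qed.

Let n0 : 0 < n%:R :> R. Proof. by rewrite ltr0n. Qed.

Lemma emp_mean_lip w a b :
  norm2 (emp_mean (psi a) w - emp_mean (psi b) w) <=
  n%:R^-1 * (\sum_(i < n) M * (norm2 (S *m vec (Xs i w)) + 1) * norm2 (S *m vec (Xs i w)))
    * norm2 (a - b).
Proof.
apply: norm2_le_dot => [|u u1].
  rewrite mulr_ge0 ?norm2_ge0// mulr_ge0 ?invr_ge0//.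
  apply: sumr_ge0 => i _.
  by rewrite mulr_ge0 ?norm2_ge0// mulr_ge0// addr_ge0 ?norm2_ge0.
rewrite dotBr !dot_emp_mean -mulrBr -mulrA ler_wpM2l ?invr_ge0//.
rewrite -sumrB mulr_suml; apply: ler_sum => i _; rewrite -mulrBl.
apply: le_trans (ler_norm _) _; rewrite normrM.
have N0 := norm2_ge0 (S *m vec (Xs i w)); have N1 := norm2_ge0 (a - b).
rewrite mulrAC; apply: ler_pM => //.
  apply: le_trans (psi_lip _ _ _) _; rewrite -mulrA ler_wpM2l// mulrDl mul1r lerD2r.
  by rewrite mulrC; exact: normr_dot_le.
by apply: le_trans (normr_dot_le _ _) _; rewrite ler_piMl.
Qed.

Lemma measurable_emp_mean phi j : measurable_fun setT phi ->
  measurable_fun setT (fun w => emp_mean phi w j 0).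
Proof.
move=> mphi.
rewrite (_ : (fun w => _) = (fun w => n%:R^-1 *
    \sum_(i < n) phi (Xs i w, es i w) * L (delta_mx j 0) (Xs i w))); last first.
  apply/funext => w; rewrite -dot_emp_mean /dot (bigD1 j)//= big1.
    by rewrite !mxE !eqxx mul1r addr0.
  by move=> k /negbTE kj; rewrite !mxE kj mul0r.
apply: measurable_funM => //; apply: measurable_sum => i.
apply: measurable_funM; first exact: (measurableT_comp mphi (mXes i)).
exact: measurable_lin_formX.
Qed.

Variables (Lam B t : R).
Hypotheses (Lam_gt0 : 0 < Lam) (B_ge0 : 0 <= B) (t_ge0 : 0 <= t).
Hypothesis psi_mgf : forall (a b u : 'cV[R]_p) (delta : R),
  norm2 u <= 1 -> 0 < delta -> norm2 (a - b) <= delta ->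
  (\int[P]_w (expR (Lam / delta / n%:R * ((psi a (X w, e w) - psi b (X w, e w)) * L u (X w)
     - \int[P]_w ((psi a (X w, e w) - psi b (X w, e w)) * L u (X w)))))%:E
   <= (expR (B / n%:R))%:E)%E.

(** Chaining for the centred empirical means: by independence the exponent [B]
    allowed for the sample leaves [B / n] to each observation. *)
Lemma empirical_process_bound : exists Bad : set T,
  [/\ measurable Bad, (P Bad <= (expR (- t))%:E)%E &
    forall w, ~ Bad w -> forall a, norm2 a <= 1 ->
      norm2 (emp_mean (psi a) w - pop_mean (psi a)) <= 120 * (B + t + p%:R) / Lam].
Proof.
apply: (chaining p_gt0 (H := fun a w => emp_mean (psi a) w - pop_mean (psi a))) => //.
- move=> a j; under eq_fun => w do rewrite mxE [X in _ + X]mxE.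
  by apply: measurable_funB => //; exact: measurable_emp_mean.
- move=> w; rewrite /emp_mean big1 => [|i _]; last by rewrite psi_0 scale0r.
  rewrite scaler0 sub0r; apply/eqP; rewrite oppr_eq0; apply/eqP/matrixP => j k.
  rewrite !mxE; under eq_Rintegral => z _ do rewrite psi_0 mul0r.
  by rewrite /Rintegral integral0.
- move=> w; eexists => a b.
  rewrite (_ : _ - _ = (emp_mean (psi a) w - emp_mean (psi b) w)
    - (pop_mean (psi a) - pop_mean (psi b))); last first.
    by rewrite !opprB addrACA [X in _ + X]addrC addrACA; congr (_ + _); rewrite addrC.
  apply: le_trans (norm2B _ _) _.
  apply: le_trans (lerD (emp_mean_lip w a b) (pop_mean_lip a b)) _.
  by rewrite -mulrDl.
move=> a b u delta a1 b1 u1 delta0 abd.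
pose phi (z : p.-tuple R * R) := (psi a z - psi b z) * L u z.1.
have mphi : measurable_fun setT phi.
  apply: measurable_funM; first by apply: measurable_funB.
  exact: (measurableT_comp (measurable_lin_form S u) measurable_fst).
pose m := \int[P]_w ((psi a (X w, e w) - psi b (X w, e w)) * L u (X w)).
have E w : Lam / delta * dot u (emp_mean (psi a) w - pop_mean (psi a) -
    (emp_mean (psi b) w - pop_mean (psi b))) =
  Lam / delta / n%:R * \sum_(i < n) (phi (Xs i w, es i w) - m).
  rewrite !dotBr !dot_emp_mean !dot_pop_mean// sumrB sumr_const card_ord -mulr_natr.
  have -> : m = \int[P]_w (psi a (X w, e w) * L u (X w)) - \int[P]_w (psi b (X w, e w) * L u (X w)).
    rewrite -(RintegralB measurableT (psi_integrable a u) (psi_integrable b u)).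
    by apply: eq_Rintegral => z _; rewrite mulrBl.
  have -> : \sum_(i < n) phi (Xs i w, es i w) =
     \sum_(i < n) psi a (Xs i w, es i w) * L u (Xs i w) -
     \sum_(i < n) psi b (Xs i w, es i w) * L u (Xs i w).
    by rewrite -sumrB; apply: eq_bigr => i _; rewrite /phi mulrBl.
  by field; rewrite !gt_eqF.
under eq_integral => w _ do rewrite E.
have := iid_mgf_le mXes mXe lawX indepX mphi (psi_mgf u1 delta0 abd).
by rewrite mulrCA mulfV ?mulr1// gt_eqF.
Qed.

End EmpiricalProcess.

Section SampleBounds.
Context d (T : measurableType d) (R : realType) (P : probability T R) (p n : nat).
Hypotheses (p_gt0 : (0 < p)%N) (n_gt0 : (0 < n)%N).
Variables (X : T -> p.-tuple R) (e : T -> R) (f : p.-tuple R -> R -> R) (S : 'M[R]_p).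
Variables (Xs : 'I_n -> T -> p.-tuple R) (es : 'I_n -> T -> R).
Variables (K : R -> R) (kap1 kap2 kapu h ups tau l0 fbar flow kb t s g : R).
Hypotheses (mX : measurable_fun setT X) (me : measurable_fun setT e).
Hypothesis mXs : forall i, measurable_fun setT (Xs i).
Hypothesis mes : forall i, measurable_fun setT (es i).
Hypothesis lawX : forall i, same_law P (fun w => (Xs i w, es i w)) (fun w => (X w, e w)).
Hypothesis indepX : mutually_independent P (fun i w => (Xs i w, es i w)).
Hypothesis ef : cond_density P X e f.
Hypothesis HK : kernel_assumption K kap1 kap2 kapu.
Hypothesis h_gt0 : 0 < h.
Hypothesis ups_gt0 : 0 < ups.
Hypothesis sgX : subgaussian_design P X S ups.
Hypothesis dens : density_assumption P X f flow l0 fbar.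
Hypotheses (fbar_ge0 : 0 <= fbar) (tau_ge0 : 0 <= tau) (tau_le1 : tau <= 1).
Hypothesis tauP : cond_prob P X [set w | e w <= 0] (fun=> tau%:E).
Hypotheses (kb_gt0 : 0 < kb) (kapu_le : kapu <= kb).
Hypotheses (t_ge0 : 0 <= t) (s_gt0 : 0 < s) (g_gt0 : 0 < g).
Hypotheses (s_sqr : s ^+ 2 * n%:R = p%:R + t) (g_sqr : g ^+ 2 = h).
Local Notation L := (lin_form S).
Local Notation W := (cdf_incr S K h 0).
Local Notation psi0 := (score K h tau).
Let c : R := 8 * ups ^+ 2.
Let n0 : 0 < n%:R :> R. Proof. by rewrite ltr0n. Qed.

(** In the variables [s = sqrt ((p + t) / n)] and [g = sqrt h], an increment over a
    distance [rho * delta] is tested with the parameter [s g / (rho delta)] per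
    observation. Its second moment of order [(rho delta) ^ 2 / g ^ 2] turns
    this into an exponent of order [s ^ 2], hence of order [p + t] for the whole
    sample, which matches the entropy of the ball. *)
Lemma increment_process_bound (rho : R) : 0 < rho -> kb * (s / g) <= (2 * c)^-1 ->
  exists Bad : set T, [/\ measurable Bad, (P Bad <= (expR (- t))%:E)%E &
    forall w, ~ Bad w -> forall a, norm2 a <= rho ->
      norm2 (emp_mean S Xs es (W a) w - pop_mean P X e S (W a))
      <= 120 * (1 + kb * fbar * mom4 ups) * (rho * (s / g))].
Proof.
move=> rho0 sc; have m4 := mom4_gt0 ups_gt0; have r0 := ltW rho0.
have Vm4 : 0 <= kb * fbar * mom4 ups by rewrite !mulr_ge0// ltW.
pose psi a := W (rho *: a).
have dpsi a b z : psi a z - psi b z = cdf_incr S K h (rho *: b) (rho *: a) z.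
  by rewrite /psi /cdf_incr !lin_form0; ring.
have [||||||Bad [mBad PBad HBad]] := @empirical_process_bound _ _ _ P p n p_gt0 n_gt0 X e S ups
  Xs es mX me mXs mes ups_gt0 sgX lawX indepX psi
  (fun a => measurable_cdf_incr S HK h_gt0 0 (rho *: a)) _
  (fun a v => cdf_incr_integrable mX me HK h_gt0 ups_gt0 sgX 0 (rho *: a) v)
  (kb / h * rho) _ _ (n%:R * s * g / rho) ((p%:R + t) * (kb * fbar * mom4 ups)) t _ _ t_ge0 _.
- by move=> z; rewrite /psi scaler0 /cdf_incr subrr.
- by rewrite mulr_ge0// divr_ge0// ltW.
- move=> a b z; rewrite dpsi; apply: le_trans (cdf_incr_lip S HK h_gt0 kapu_le _ _ _) _.
  rewrite -scalerBr lin_formZ normrM (ger0_norm r0) -[leRHS]mulrA ler_wpM2l//.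
    by rewrite divr_ge0// ltW.
  by rewrite ler_wpM2l// lerDl norm2_ge0.
- by rewrite divr_gt0// !mulr_gt0.
- by rewrite mulr_ge0// addr_ge0.
- move=> a b u delta u1 delta0 abd.
  have -> : n%:R * s * g / rho / delta / n%:R = s * g / (rho * delta).
    by field; rewrite !gt_eqF.
  under eq_integral => w _ do rewrite dpsi.
  under eq_Rintegral => w _ do rewrite dpsi.
  have := @cdf_incr_mgf _ _ _ P p X e f S K kap1 kap2 kapu h ups tau l0 fbar flow kb
    mX me ef HK h_gt0 ups_gt0 sgX dens fbar_ge0 tau_ge0 tauP kb_gt0 kapu_le
    (rho *: b) (rho *: a) u (s * g / (rho * delta)) (rho * delta) u1.
  have rd : 0 < rho * delta by rewrite mulr_gt0.
  have hg : h = g * g by rewrite -expr2.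
  have lam0 : 0 <= s * g / (rho * delta) by rewrite divr_ge0 ?mulr_ge0 ?ltW.
  move=> /(_ rd); rewrite -scalerBr norm2Z (ger0_norm r0) ler_wpM2l// (ger0_norm lam0).
  have -> : s * g / (rho * delta) * (kb * (rho * delta) / h) = kb * (s / g).
    by rewrite hg; field; rewrite !gt_eqF.
  move=> /(_ isT sc).
  have -> // : (s * g / (rho * delta)) ^+ 2 *
    (kb * fbar * (rho * delta) ^+ 2 / h * mom4 ups) =
    (p%:R + t) * (kb * fbar * mom4 ups) / n%:R.
  by rewrite -s_sqr hg; field; rewrite !gt_eqF.
- exists Bad; split => // w /HBad Hw a arho.
  have := Hw (rho^-1 *: a); rewrite norm2Z ger0_norm ?invr_ge0// ler_pdivrMl// mulr1.
  move=> /(_ arho); rewrite /psi scalerA mulfV ?scale1r ?gt_eqF// => /le_trans; apply.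
  rewrite (_ : _ + t + p%:R = (1 + kb * fbar * mom4 ups) * (p%:R + t)); last by ring.
  rewrite -s_sqr; apply: eq_ler.
  by field; rewrite !gt_eqF.
Qed.

(** A single random vector is the value at a unit vector [v] of the process
    [a |-> dot v a * score], to which the uniform bound applies. *)
Lemma score_process_bound : s <= (2 * c)^-1 ->
  exists Bad : set T, [/\ measurable Bad, (P Bad <= (expR (- t))%:E)%E &
    forall w, ~ Bad w ->
      norm2 (emp_mean S Xs es psi0 w - pop_mean P X e S psi0)
      <= 120 * (1 + mom5 ups) * s].
Proof.
move=> sc; have m5 := mom5_gt0 ups_gt0; have m5' := ltW m5.
pose v : 'cV[R]_p := delta_mx (Ordinal p_gt0) 0.
have v1 : norm2 v = 1 by exact: norm2_delta.
pose psi a (z : p.-tuple R * R) := dot v a * psi0 z.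
have mpsi0 := measurable_score (p := p) tau HK h_gt0.
have dpsi a b z : psi a z - psi b z = dot v (a - b) * psi0 z.
  by rewrite /psi dotBr mulrBl.
have ipsi0 u := score_integrable mX me HK h_gt0 ups_gt0 sgX tau_ge0 tau_le1 u.
have ipsi a u : P.-integrable setT (EFin \o (fun w => psi a (X w, e w) * L u (X w))).
  rewrite (_ : (fun w => _) = (fun w => dot v a * (psi0 (X w, e w) * L u (X w)))).
    exact: integrableRZ.
  by apply/funext => w; rewrite mulrA.
have [||||||Bad [mBad PBad HBad]] := @empirical_process_bound _ _ _ P p n p_gt0 n_gt0 X e S ups
  Xs es mX me mXs mes ups_gt0 sgX lawX indepX psi _ _ ipsi
  1 ler01 _ (n%:R * s) ((p%:R + t) * mom5 ups) t _ _ t_ge0 _.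
- by move=> a; apply: measurable_funM.
- by move=> z; rewrite /psi dot0r mul0r.
- move=> a b z; rewrite dpsi mul1r normrM.
  apply: (@le_trans _ _ (norm2 (a - b))); last by rewrite lerDr.
  apply: (@le_trans _ _ (norm2 (a - b) * 1)); last by rewrite mulr1.
  apply: ler_pM => //; last exact: (score_le1 h HK tau_ge0 tau_le1).
  by apply: le_trans (normr_dot_le _ _) _; rewrite v1 mul1r.
- by rewrite mulr_gt0.
- by rewrite mulr_ge0// addr_ge0.
- move=> a b u delta u1 delta0 abd.
  pose q := dot v (a - b) / delta.
  have q1 : `|q| <= 1.
    rewrite normrM normfV (gtr0_norm delta0) ler_pdivrMr// mul1r.
    by apply: le_trans (normr_dot_le _ _) _; rewrite v1 mul1r.
  have := @score_mgf _ _ _ P p X e S K kap1 kap2 kapu h ups tau mX me HK h_gt0 ups_gt0 sgX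
    tau_ge0 tau_le1 u (s * q) u1.
  have sq : `|s * q| <= s by rewrite normrM (gtr0_norm s_gt0) ler_piMr// ltW.
  move=> /(_ (le_trans sq sc)).
  set m := \int[P]_w (psi0 (X w, e w) * L u (X w)).
  have -> : \int[P]_w ((psi a (X w, e w) - psi b (X w, e w)) * L u (X w)) = dot v (a - b) * m.
    rewrite -(RintegralZl (dot v (a - b)) measurableT (ipsi0 u)).
    by apply: eq_Rintegral => w _; rewrite dpsi mulrA.
  have E w : n%:R * s / delta / n%:R *
      ((psi a (X w, e w) - psi b (X w, e w)) * L u (X w) - dot v (a - b) * m) =
      s * q * (psi0 (X w, e w) * L u (X w) - m).
    by rewrite dpsi /q; field; rewrite !gt_eqF.
  under [X in _ -> (X <= _)%E]eq_integral => w _ do rewrite E.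
  move=> /le_trans; apply; rewrite lee_fin ler_expR.
  rewrite -s_sqr (_ : s ^+ 2 * n%:R * mom5 ups / n%:R = s ^+ 2 * mom5 ups); last first.
    by field; rewrite gt_eqF.
  rewrite ler_wpM2r// -[leLHS]real_normK ?num_real// ler_sqr ?nnegrE//.
  exact: ltW.
- exists Bad; split => // w /HBad /(_ v); rewrite v1 lexx => /(_ isT).
  rewrite (_ : psi v = psi0); last first.
    by apply/funext => z; rewrite /psi -norm2_sqr v1 expr1n mul1r.
  move=> /le_trans; apply.
  rewrite (_ : _ + t + p%:R = (1 + mom5 ups) * (p%:R + t)); last by ring.
  rewrite -s_sqr; apply: eq_ler.
  by field; rewrite !gt_eqF.
Qed.

End SampleBounds.

(** * The estimator: first-order condition and localization *)

Section PopulationMeans.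
Context d (T : measurableType d) (R : realType) (P : probability T R) (p : nat).
Variables (X : T -> p.-tuple R) (e : T -> R) (f : p.-tuple R -> R -> R) (S : 'M[R]_p).
Variables (K : R -> R) (kap1 kap2 kapu h ups tau l0 fbar flow : R).
Hypotheses (mX : measurable_fun setT X) (me : measurable_fun setT e).
Hypothesis ef : cond_density P X e f.
Hypothesis HK : kernel_assumption K kap1 kap2 kapu.
Hypothesis h_gt0 : 0 < h.
Hypothesis ups_gt0 : 0 < ups.
Hypothesis sgX : subgaussian_design P X S ups.
Hypothesis Sigma_pos : posdefmx (Sigma_mx P X).
Hypothesis S_sqrt : is_inv_sqrtmx (Sigma_mx P X) S.
Hypothesis dens : density_assumption P X f flow l0 fbar.
Hypotheses (l0_ge0 : 0 <= l0) (fbar_ge0 : 0 <= fbar) (flow_ge0 : 0 <= flow).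
Hypotheses (tau_ge0 : 0 <= tau) (tau_le1 : tau <= 1).
Hypothesis tauP : cond_prob P X [set w | e w <= 0] (fun=> tau%:E).
Local Notation L := (lin_form S).
Local Notation W := (cdf_incr S K h 0).
Local Notation psi0 := (score K h tau).
Local Notation Jh := (Jh_mx P X e K h).
Local Notation J := (J_mx P X f).

Let Ssym : S^T = S. Proof. by have [[]] := S_sqrt. Qed.
Let Sunit : S \in unitmx.
Proof. by apply: posdefmx_unit; have [] := S_sqrt. Qed.

Let iW a u := cdf_incr_integrable mX me HK h_gt0 ups_gt0 sgX 0 a u.
Let iK a u := kernel_weighted_integrable mX me HK h_gt0 ups_gt0 sgX (lexx kapu) a u.
Let iD a u := density_weighted_integrable mX ef ups_gt0 sgX dens fbar_ge0 tau_ge0 tauP a u.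

Lemma kernel_gram_pop_mean a :
  norm2 (S *m Jh *m (S *m a) - pop_mean P X e S (W a)) <= l0 * norm2 a ^+ 2 * mom3 ups.
Proof.
have m3 := mom3_gt0 ups_gt0.
apply: norm2_le_dot => [|u u1]; first exact: mulr_ge0 (mulr_ge0 l0_ge0 (sqr_ge0 _)) (ltW m3).
rewrite dotBr (dot_weighted_gram Ssym Sunit iK) (dot_pop_mean u (iW a)).
apply: le_trans (ler_norm _) _; rewrite distrC.
exact: (population_linearization mX me ef HK h_gt0 ups_gt0 sgX dens l0_ge0 tau_ge0 tauP
  (lexx kapu) a u1).
Qed.

Lemma density_gram_kernel_gram a :
  norm2 (S *m J *m (S *m a) - S *m Jh *m (S *m a)) <= l0 * h * kap1 * mom2 ups * norm2 a.
Proof.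
have m2 := mom2_gt0 ups_gt0.
have kap1_ge0 := kernel_moment1_ge0 HK.
have k0 : 0 <= l0 * h * kap1 * mom2 ups.
  by apply: mulr_ge0; [rewrite !mulr_ge0// ltW | exact: ltW].
have [a0|a0] := eqVneq (norm2 a) 0.
  by rewrite (norm2_eq0 a0) !mulmx0 subrr !norm2_0 mulr0.
have [v nv av] : exists2 v, norm2 v = 1 & a = norm2 a *: v.
  by exists ((norm2 a)^-1 *: a); rewrite ?norm2_normalize// scalerA mulfV// scale1r.
have v1 : norm2 v <= 1 by rewrite nv.
rewrite [in leLHS]av -!scalemxAr -scalerBr norm2Z (ger0_norm (norm2_ge0 a)).
rewrite mulrC ler_wpM2r ?norm2_ge0//.
apply: norm2_le_dot => // u u1; rewrite dotBr.
rewrite (dot_weighted_gram Ssym Sunit iK) (dot_weighted_gram Ssym Sunit iD).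
apply: le_trans (ler_norm _) _; rewrite distrC.
exact: (population_density mX me ef HK h_gt0 ups_gt0 sgX dens l0_ge0 fbar_ge0 tau_ge0 tauP
  (lexx kapu) v1 u1).
Qed.

Lemma pop_mean_score_le : norm2 (pop_mean P X e S psi0) <= l0 * h ^+ 2 * kap2 * mom1 ups.
Proof.
have m1 := mom1_gt0 ups_gt0.
have kap2_ge0 := kernel_moment2_ge0 HK.
apply: norm2_le_dot => [|u u1].
  exact: mulr_ge0 (mulr_ge0 (mulr_ge0 l0_ge0 (sqr_ge0 _)) kap2_ge0) (ltW m1).
rewrite (dot_pop_mean u (score_integrable mX me HK h_gt0 ups_gt0 sgX tau_ge0 tau_le1)).
apply: le_trans (ler_norm _) _.
exact: (population_bias mX me ef HK h_gt0 ups_gt0 sgX dens l0_ge0 tau_ge0 tauP tau_le1 u1).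
Qed.

(** The curvature is that of [J], the second moment matrix being the identity in
    standardized coordinates; the two errors are those of the passage from [J] to
    [J_h] and from [J_h] to the increments. *)
Lemma pop_mean_curvature a :
  (flow - l0 * h * kap1 * mom2 ups - l0 * mom3 ups * norm2 a) * norm2 a ^+ 2 <=
  dot a (pop_mean P X e S (W a)).
Proof.
have N0 := norm2_ge0 a.
have h1 : flow * norm2 a ^+ 2 <= dot a (S *m J *m (S *m a)).
  rewrite (dot_weighted_gram Ssym Sunit iD) -(lin_form_isometry mX ups_gt0 sgX Sigma_pos S_sqrt).
  exact: (population_curvature mX ef ups_gt0 sgX dens fbar_ge0 flow_ge0 tau_ge0 tauP).
have h2 := le_trans (dot_le a _) (ler_wpM2l N0 (density_gram_kernel_gram a)).
have h3 := le_trans (dot_le a _) (ler_wpM2l N0 (kernel_gram_pop_mean a)).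
rewrite !dotBr in h2 h3.
have -> : (flow - l0 * h * kap1 * mom2 ups - l0 * mom3 ups * norm2 a) * norm2 a ^+ 2 =
  flow * norm2 a ^+ 2 - norm2 a * (l0 * h * kap1 * mom2 ups * norm2 a)
   - norm2 a * (l0 * norm2 a ^+ 2 * mom3 ups) by ring.
lra.
Qed.

End PopulationMeans.

Section FirstOrderCondition.
Context (R : realType) (p n : nat).
Hypothesis n_gt0 : (0 < n)%N.
Variables (K : R -> R) (kap1 kap2 kapu h tau : R).
Hypothesis HK : kernel_assumption K kap1 kap2 kapu.
Hypothesis h_gt0 : 0 < h.
Hypothesis tau01 : 0 < tau < 1.
Local Notation G := (smooth_cdf K h).

(** Let [v] be the left-hand side. By the subgradient inequality at [b + c *: v],
    minimality of [b] makes the scalar product of [v] with the sum taken at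
    [b + c *: v] nonpositive for every [c > 0]. The sum is Lipschitz, so
    [dot v v <= 0] in the limit. *)
Lemma minimizer_first_order (y : 'I_n -> R) (x : 'I_n -> 'cV[R]_p) (b : 'cV[R]_p) :
  is_minimizer (smooth_risk tau K h y x) b ->
  \sum_(i < n) (tau - G (dot (x i) b - y i)) *: x i = 0.
Proof.
move=> bmin; set v := \sum_(i < n) _.
pose F c := \sum_(i < n) (tau - G (dot (x i) b + c * dot (x i) v - y i)) * dot (x i) v.
have F0 : dot v v = F 0.
  rewrite {2}/v dot_sumr; apply: eq_bigr => i _.
  by rewrite dotZr mul0r addr0 (dotC v).
have F_le0 c : 0 < c -> F c <= 0.
  move=> c0; have := bmin (b + c *: v); rewrite /smooth_risk ler_pM2l ?invr_gt0 ?ltr0n//.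
  rewrite -subr_ge0 -sumrB => hmin.
  rewrite -(ler_pM2l c0) mulr0 -oppr_ge0; apply: le_trans hmin _.
  rewrite mulr_sumr -sumrN; apply: ler_sum => i _.
  have := smooth_loss_subgradient HK h_gt0 (y i - dot (x i) (b + c *: v)) (y i - dot (x i) b) tau01.
  rewrite dotDr dotZr (_ : - (y i - _) = dot (x i) b + c * dot (x i) v - y i); last by ring.
  rewrite (_ : y i - dot (x i) b + _ = c * dot (x i) v); last by ring.
  lra.
pose M := \sum_(i < n) kapu / h * dot (x i) v ^+ 2.
have F_lip c : 0 < c -> F 0 <= c * M.
  move=> c0; have Fc := F_le0 c c0.
  suff : F 0 - F c <= c * M by lra.
  rewrite /F /M -sumrB mulr_sumr; apply: ler_sum => i _; rewrite -mulrBl mul0r addr0.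
  rewrite (_ : _ - _ = G (dot (x i) b + c * dot (x i) v - y i) - G (dot (x i) b - y i)); last by ring.
  apply: le_trans (ler_norm _) _; rewrite normrM.
  apply: le_trans (ler_wpM2r (normr_ge0 _) (smooth_cdf_lip HK h_gt0 _ _)) _.
  rewrite (_ : _ - _ - (_ - _) = c * dot (x i) v); last by ring.
  rewrite normrM (gtr0_norm c0) -[dot (x i) v ^+ 2]real_normK ?num_real//.
  by apply: eq_ler; ring.
have M0 : 0 <= M.
  apply: sumr_ge0 => i _; rewrite mulr_ge0 ?sqr_ge0// divr_ge0 ?(ltW h_gt0)//.
  exact: kernel_bound_ge0 HK.
have Fle : F 0 <= 0.
  rewrite leNgt; apply/negP => F0p.
  have M1 : 0 < M + 1 by rewrite ltr_wpDl.
  have := F_lip (F 0 / (2 * (M + 1))) (divr_gt0 F0p (mulr_gt0 (ltr0n _ 2) M1)).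
  rewrite mulrAC ler_pdivlMr ?mulr_gt0//; nra.
apply: norm2_eq0; apply/eqP; rewrite -sqrf_eq0 norm2_sqr eq_le F0 Fle /=.
by rewrite -F0 dotvv_ge0.
Qed.

End FirstOrderCondition.

Section Estimator.
Context d (T : measurableType d) (R : realType) (p n : nat).
Hypothesis n_gt0 : (0 < n)%N.
Variables (Xs : 'I_n -> T -> p.-tuple R) (Ys : 'I_n -> T -> R) (S : 'M[R]_p).
Variables (K : R -> R) (kap1 kap2 kapu h tau : R) (betastar : 'cV[R]_p).
Hypotheses (Ssym : S^T = S) (Sunit : S \in unitmx).
Hypothesis HK : kernel_assumption K kap1 kap2 kapu.
Hypothesis h_gt0 : 0 < h.
Hypothesis tau01 : 0 < tau < 1.
Local Notation L := (lin_form S).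
Local Notation G := (smooth_cdf K h).
Local Notation W := (cdf_incr S K h 0).
Local Notation psi0 := (score K h tau).
Let es i := noise (Xs i) (Ys i) betastar.

(** At the estimate, the residual of an observation is its noise minus the linear
    form in direction [S^-1 (b - betastar)]. *)
Lemma minimizer_emp_mean (b : 'cV[R]_p) w :
  is_minimizer (smooth_risk tau K h (fun i => Ys i w) (fun i => vec (Xs i w))) b ->
  emp_mean S Xs es (W (invmx S *m (b - betastar))) w = emp_mean S Xs es psi0 w.
Proof.
move=> bmin; have := minimizer_first_order n_gt0 HK h_gt0 tau01 bmin.
move=> /(congr1 (fun v => S *m v)); rewrite mulmx0 mulmx_sumr => H.
rewrite /emp_mean; congr (_ *: _); apply/eqP; rewrite eq_sym -subr_eq0 -sumrB -[X in _ == X]H.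
apply/eqP; apply: eq_bigr => i _; rewrite -scalerBl -scalemxAr; congr (_ *: _).
have E : L (invmx S *m (b - betastar)) (Xs i w) - es i w = dot (vec (Xs i w)) b - Ys i w.
  rewrite /es /noise /lin_form dot_mulmx Ssym mulmxA mulmxV// mul1mx dotBl.
  by rewrite (dotC b) (dotC betastar); ring.
by rewrite /score /cdf_incr /= E lin_form0 sub0r; ring.
Qed.

Lemma bahadur_remainderE (J : 'M[R]_p) (betahat : T -> 'cV[R]_p) w :
  is_minimizer (smooth_risk tau K h (fun i => Ys i w) (fun i => vec (Xs i w))) (betahat w) ->
  let delta := invmx S *m (betahat w - betastar) in
  bahadur_remainder tau K h Xs Ys S J betastar betahat w =
  norm2 (S *m J *m (S *m delta) - emp_mean S Xs es (W delta) w).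
Proof.
move=> bmin delta; rewrite (minimizer_emp_mean bmin) /bahadur_remainder.
by rewrite /delta [S *m (invmx S *m _)]mulmxA mulmxV// mul1mx.
Qed.

(** The smoothed indicator is monotone, so each increment has the sign of the
    linear form and grows along the ray. *)
Lemma emp_mean_ray (a : 'cV[R]_p) (th : R) w : 0 < th <= 1 ->
  dot a (emp_mean S Xs es (W (th *: a)) w) <= dot a (emp_mean S Xs es (W a) w).
Proof.
move=> /andP[th0 th1]; rewrite !dot_emp_mean ler_wpM2l ?invr_ge0//.
apply: ler_sum => i _; rewrite -subr_ge0 -mulrBl /cdf_incr /= lin_formZ.
set l := L a _; set z := es i w.
rewrite [X in X * _](_ : _ = G (l - z) - G (th * l - z)); last by ring.
have [l0|l0] := leP 0 l.
  rewrite mulr_ge0// subr_ge0; apply: (smooth_cdf_ndecr HK h_gt0).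
  by rewrite lerD2r ler_piMl.
rewrite mulr_le0 ?(ltW l0)// subr_le0; apply: (smooth_cdf_ndecr HK h_gt0).
by rewrite lerD2r ler_niMl// ltW.
Qed.

(** Otherwise the multiple of [delta] of norm [rho] would have, by monotonicity
    along the ray, a scalar product with its empirical mean of at most [A * rho]. *)
Lemma emp_mean_localization (delta : 'cV[R]_p) (rho A k : R) w :
  0 < rho ->
  emp_mean S Xs es (W delta) w = emp_mean S Xs es psi0 w ->
  norm2 (emp_mean S Xs es psi0 w) <= A ->
  (forall a, norm2 a = rho -> k * rho < dot a (emp_mean S Xs es (W a) w)) ->
  A <= k -> norm2 delta <= rho.
Proof.
move=> rho0 Ed nA hk Ak; rewrite leNgt; apply/negP => drho.
have d0 : 0 < norm2 delta := lt_trans rho0 drho.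
pose th := rho / norm2 delta.
have th0 : 0 < th by rewrite divr_gt0.
have th1 : th <= 1 by rewrite ler_pdivrMr// mul1r ltW.
have nth : norm2 (th *: delta) = rho.
  by rewrite norm2Z gtr0_norm// divfK// gt_eqF.
have := hk _ nth; rewrite dotZl => /lt_le_trans.
have r1 : dot delta (emp_mean S Xs es (W (th *: delta)) w) <= norm2 delta * A.
  apply: le_trans (emp_mean_ray delta w _) _; first by rewrite th0.
  rewrite Ed; apply: le_trans (dot_le _ _) _.
  by rewrite ler_wpM2l// ltW.
move=> /(_ _ (ler_wpM2l (ltW th0) r1)).
rewrite mulrA divfK ?gt_eqF// [k * _]mulrC ltr_pM2l//.
by rewrite ltNge Ak.
Qed.

End Estimator.

(** * The expansion on an event of high probability *)

Section BahadurBounds.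
Context d (T : measurableType d) (R : realType) (P : probability T R) (p n : nat).
Hypotheses (p_gt0 : (0 < p)%N) (n_gt0 : (0 < n)%N).
Variables (X : T -> p.-tuple R) (Y : T -> R) (f : p.-tuple R -> R -> R) (S : 'M[R]_p).
Variables (Xs : 'I_n -> T -> p.-tuple R) (Ys : 'I_n -> T -> R) (betastar : 'cV[R]_p).
Variables (K : R -> R) (kap1 kap2 kapu h ups tau l0 fbar flow kb t s g : R).
Let e := noise X Y betastar.
Let es i := noise (Xs i) (Ys i) betastar.
Hypotheses (mX : measurable_fun setT X) (me : measurable_fun setT e).
Hypothesis mXs : forall i, measurable_fun setT (Xs i).
Hypothesis mes : forall i, measurable_fun setT (es i).
Hypothesis lawX : forall i, same_law P (fun w => (Xs i w, es i w)) (fun w => (X w, e w)).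
Hypothesis indepX : mutually_independent P (fun i w => (Xs i w, es i w)).
Hypothesis ef : cond_density P X e f.
Hypothesis HK : kernel_assumption K kap1 kap2 kapu.
Hypothesis h_gt0 : 0 < h.
Hypothesis ups_gt0 : 0 < ups.
Hypothesis sgX : subgaussian_design P X S ups.
Hypothesis Sigma_pos : posdefmx (Sigma_mx P X).
Hypothesis S_sqrt : is_inv_sqrtmx (Sigma_mx P X) S.
Hypothesis dens : density_assumption P X f flow l0 fbar.
Hypotheses (l0_gt0 : 0 < l0) (fbar_gt0 : 0 < fbar) (flow_gt0 : 0 < flow).
Hypothesis tau01 : 0 < tau < 1.
Hypothesis tauP : cond_prob P X [set w | e w <= 0] (fun=> tau%:E).
Hypotheses (kb_gt0 : 0 < kb) (kapu_le : kapu <= kb).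
Hypotheses (t_gt0 : 0 < t) (s_gt0 : 0 < s) (g_gt0 : 0 < g).
Hypotheses (s_sqr : s ^+ 2 * n%:R = p%:R + t) (g_sqr : g ^+ 2 = h).
Local Notation L := (lin_form S).
Local Notation W := (cdf_incr S K h 0).
Local Notation psi0 := (score K h tau).
Let c : R := 8 * ups ^+ 2.
Let C1 : R := 120 * (1 + kb * fbar * mom4 ups).
Let C2 : R := 120 * (1 + mom5 ups).
Let C0 : R := 1 + 2 / flow * (C2 + l0 * kap2 * mom1 ups).
Let rho : R := C0 * (s + h ^+ 2).
Hypotheses (s_small : s <= (2 * c)^-1) (sg_small : kb * (s / g) <= (2 * c)^-1).
Hypothesis curvature_left :
  l0 * h * kap1 * mom2 ups + l0 * mom3 ups * rho + C1 * (s / g) <= flow / 2.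

(** Outside of the two exceptional sets, of the increments over the ball of radius
    [rho] and of the score, the argument is deterministic. *)
Lemma bahadur_bounds : exists Bad : set T,
  [/\ measurable Bad, (P Bad <= (2 * expR (- t))%:E)%E &
    forall w (betahat : T -> 'cV[R]_p), ~ Bad w ->
    is_minimizer (smooth_risk tau K h (fun i => Ys i w) (fun i => vec (Xs i w))) (betahat w) ->
    bahadur_remainder tau K h Xs Ys S (Jh_mx P X e K h) betastar betahat w <=
      l0 * rho ^+ 2 * mom3 ups + C1 * (rho * (s / g)) /\
    bahadur_remainder tau K h Xs Ys S (J_mx P X f) betastar betahat w <=
      l0 * rho ^+ 2 * mom3 ups + C1 * (rho * (s / g)) + l0 * h * kap1 * mom2 ups * rho].
Proof.
have /andP[tau_gt0 tau_lt1] := tau01; have tau_ge0 := ltW tau_gt0; have tau_le1 := ltW tau_lt1.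
have l0_ge0 := ltW l0_gt0; have fbar_ge0 := ltW fbar_gt0; have flow_ge0 := ltW flow_gt0.
have t_ge0 := ltW t_gt0.
have m1 := ltW (mom1_gt0 ups_gt0); have m2 := ltW (mom2_gt0 ups_gt0).
have m3 := ltW (mom3_gt0 ups_gt0); have m5 := ltW (mom5_gt0 ups_gt0).
have kap1_ge0 := kernel_moment1_ge0 HK.
have kap2_ge0 := kernel_moment2_ge0 HK.
have lk2 : 0 <= l0 * kap2 * mom1 ups by exact: mulr_ge0 (mulr_ge0 l0_ge0 kap2_ge0) m1.
have C2_gt0 : 0 < C2 by rewrite /C2 mulr_gt0// ltr_wpDr.
have C0_gt0 : 0 < C0.
  rewrite /C0 addr_gt0//; apply: mulr_gt0; first exact: divr_gt0.
  by rewrite ltr_wpDr.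
have sh_gt0 : 0 < s + h ^+ 2 by rewrite addr_gt0// exprn_gt0.
have rho_gt0 : 0 < rho by exact: mulr_gt0.
have [Ssym _] : posdefmx S by have [] := S_sqrt.
have Sunit : S \in unitmx by apply: posdefmx_unit; have [] := S_sqrt.
have [B1 [mB1 PB1 HB1]] := increment_process_bound p_gt0 n_gt0 mX me mXs mes lawX indepX ef
  HK h_gt0 ups_gt0 sgX dens fbar_ge0 tau_ge0 tauP kb_gt0 kapu_le t_ge0 s_gt0 g_gt0
  s_sqr g_sqr rho_gt0 sg_small.
have [B2 [mB2 PB2 HB2]] := score_process_bound p_gt0 n_gt0 mX me mXs mes lawX indepX
  HK h_gt0 ups_gt0 sgX tau_ge0 tau_le1 t_ge0 s_gt0 s_sqr s_small.
exists (B1 `|` B2); split; first exact: measurableU.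
  apply: le_trans (measureU2 _ mB1 mB2) _.
  rewrite (_ : (2 * expR (- t))%:E = ((expR (- t))%:E + (expR (- t))%:E)%E); last first.
    by rewrite -EFinD; congr EFin; ring.
  exact: leeD.
move=> w betahat nB bmin.
have {nB} [nB1 nB2] : ~ B1 w /\ ~ B2 w by split=> h'; apply: nB; [left|right].
have H1 := HB1 w nB1; have H2 := HB2 w nB2; rewrite -/C1 in H1; rewrite -/C2 in H2.
rewrite !(bahadur_remainderE n_gt0 betastar Ssym Sunit HK h_gt0 tau01 _ bmin).
have Ed := minimizer_emp_mean n_gt0 betastar Ssym Sunit HK h_gt0 tau01 bmin.
rewrite -/es in H1 H2 Ed *.
move: Ed; set delta := invmx S *m _ => Ed.
have bias := pop_mean_score_le mX me ef HK h_gt0 ups_gt0 sgX dens l0_ge0 tau_ge0 tau_le1 tauP.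
have g0_le : norm2 (emp_mean S Xs es psi0 w) <= C2 * s + l0 * h ^+ 2 * kap2 * mom1 ups.
  rewrite -(subrK (pop_mean P X e S psi0) (emp_mean S Xs es psi0 w)).
  by apply: le_trans (norm2D _ _) _; exact: lerD.
have A_le : C2 * s + l0 * h ^+ 2 * kap2 * mom1 ups <=
    (C2 + l0 * kap2 * mom1 ups) * (s + h ^+ 2).
  have := mulr_ge0 lk2 (ltW s_gt0); have := mulr_ge0 (ltW C2_gt0) (sqr_ge0 h).
  have -> : l0 * h ^+ 2 * kap2 * mom1 ups = l0 * kap2 * mom1 ups * h ^+ 2 by ring.
  by rewrite mulrDr !mulrDl; lra.
(* [curvature_left] leaves half of the curvature [flow] on the sphere of radius
   [rho], and [C0] is such that this half exceeds the size of the score. *)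
have delta_le : norm2 delta <= rho.
  apply: (emp_mean_localization HK h_gt0 rho_gt0 Ed g0_le _ A_le) => a na.
  have := pop_mean_curvature mX me ef HK h_gt0 ups_gt0 sgX Sigma_pos S_sqrt dens l0_ge0
    fbar_ge0 flow_ge0 tau_ge0 tauP a.
  rewrite na => Hc.
  have Hd : dot a (pop_mean P X e S (W a)) - dot a (emp_mean S Xs es (W a) w) <=
      rho * (C1 * (rho * (s / g))).
    rewrite -dotBr; apply: le_trans (dot_le _ _) _; rewrite na ler_wpM2l ?(ltW rho_gt0)//.
    by rewrite norm2BC; apply: H1; rewrite na.
  have Hk : (C2 + l0 * kap2 * mom1 ups) * (s + h ^+ 2) < flow / 2 * rho.
    rewrite /rho /C0 mulrA ltr_pM2r// mulrDr mulr1.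
    rewrite (_ : flow / 2 * (2 / flow * _) = C2 + l0 * kap2 * mom1 ups).
      by rewrite ltrDr divr_gt0.
    by field; rewrite gt_eqF.
  have Hq := ler_wpM2r (sqr_ge0 rho) curvature_left.
  have Hr : (C2 + l0 * kap2 * mom1 ups) * (s + h ^+ 2) * rho < flow / 2 * rho ^+ 2.
    by rewrite [rho ^+ 2]expr2 [ltRHS]mulrA ltr_pM2r.
  apply: lt_le_trans Hr _; rewrite -subr_ge0.
  have E1 : rho * (C1 * (rho * (s / g))) = C1 * (s / g) * rho ^+ 2 by ring.
  rewrite E1 in Hd.
  move: Hc Hq Hd; rewrite !mulrDl !mulNr.
  rewrite (_ : flow / 2 * rho ^+ 2 = flow * rho ^+ 2 / 2); last by ring.
  lra.
have Jh_le : norm2 (S *m Jh_mx P X e K h *m (S *m delta) - emp_mean S Xs es (W delta) w) <=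
    l0 * rho ^+ 2 * mom3 ups + C1 * (rho * (s / g)).
  rewrite -(subrK (pop_mean P X e S (W delta)) (S *m _ *m _)) -addrA.
  apply: le_trans (norm2D _ _) _; apply: lerD; last by rewrite norm2BC; exact: H1.
  apply: le_trans (kernel_gram_pop_mean mX me ef HK h_gt0 ups_gt0 sgX S_sqrt dens l0_ge0
    tau_ge0 tauP delta) _.
  rewrite ler_wpM2r// ler_wpM2l// ler_sqr// nnegrE ?norm2_ge0//; exact: ltW.
split=> //.
rewrite -(subrK (S *m Jh_mx P X e K h *m (S *m delta)) (S *m J_mx P X f *m (S *m delta))) -addrA.
apply: le_trans (norm2D _ _) _; rewrite [leRHS]addrC; apply: lerD => //.
apply: le_trans (density_gram_kernel_gram mX me ef HK h_gt0 ups_gt0 sgX S_sqrt dens l0_ge0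
    fbar_ge0 tau_ge0 tauP delta) _.
by rewrite ler_wpM2l// mulr_ge0// mulr_ge0// mulr_ge0// ltW.
Qed.

End BahadurBounds.

(** * Choice of the bandwidth, rates and measurability *)

Section Rates.
Context (R : realType).
Variables (flow k1 k3 C0 C1 kb b h s g : R).
Hypotheses (flow_gt0 : 0 < flow) (k1_ge0 : 0 <= k1) (k3_ge0 : 0 <= k3).
Hypotheses (C0_gt0 : 0 < C0) (C1_gt0 : 0 < C1) (kb_gt0 : 0 < kb) (b_gt0 : 0 < b).

(** The terms give in turn [h <= 1], the admissible parameter in the exponential
    moments of the score, the three shares of [flow / 2] in the curvature, and the
    admissible parameter for the increments. *)
Definition bandwidth_cap : R :=
  Num.min 1 (Num.min b (Num.min (flow / (8 * (k1 + 1)))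
    (Num.min (flow / (16 * (k3 * C0 + 1)))
      (Num.min ((flow / (4 * C1)) ^+ 2) ((b / kb) ^+ 2))))).

Lemma bandwidth_cap_gt0 : 0 < bandwidth_cap.
Proof.
have k1' : 0 < k1 + 1 by rewrite ltr_wpDl.
have k3' : 0 < k3 * C0 + 1 by rewrite ltr_wpDl// mulr_ge0// ltW.
by rewrite /bandwidth_cap !lt_min ltr01 b_gt0 !exprn_gt0 ?divr_gt0 ?mulr_gt0.
Qed.

Hypotheses (s_gt0 : 0 < s) (s_le : s <= h) (g_gt0 : 0 < g) (g_sqr : g ^+ 2 = h).

(** The relative fluctuation [sqrt (r / h)], for [s = sqrt r] and [g = sqrt h]. *)
Lemma ratio_le : s / g <= g.
Proof. by rewrite ler_pdivrMr// -expr2 g_sqr. Qed.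

Lemma bandwidth_cap_small : h <= bandwidth_cap ->
  [/\ h <= 1, s <= b, kb * (s / g) <= b &
      k1 * h + k3 * (C0 * (s + h ^+ 2)) + C1 * (s / g) <= flow / 2].
Proof.
have h_gt0 : 0 < h := lt_le_trans s_gt0 s_le.
have k1' : 0 < k1 + 1 by rewrite ltr_wpDl.
have k3C : 0 <= k3 * C0 by rewrite mulr_ge0// ltW.
have k3' : 0 < k3 * C0 + 1 by rewrite ltr_wpDl.
rewrite /bandwidth_cap !le_min => /and5P[h1 hb h2 h3 /andP[h4 h5]].
have g_le x : 0 < x -> h <= x ^+ 2 -> g <= x.
  by move=> x0; rewrite -g_sqr ler_sqr// nnegrE; exact: ltW.
have g4 := g_le _ (divr_gt0 flow_gt0 (mulr_gt0 (ltr0n _ 4) C1_gt0)) h4.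
have g5 := g_le _ (divr_gt0 b_gt0 kb_gt0) h5.
have sg := ratio_le.
split => //.
- exact: le_trans s_le hb.
- by rewrite mulrC -ler_pdivlMr//; exact: le_trans sg g5.
have q1 : k1 * h <= flow / 8.
  move: h2; rewrite ler_pdivlMr ?mulr_gt0// => h2.
  have := mulr_ge0 k1_ge0 (ltW h_gt0); have := h_gt0; lra.
have q2 : k3 * (C0 * (s + h ^+ 2)) <= flow / 8.
  move: h3; rewrite ler_pdivlMr ?mulr_gt0// => h3.
  have sh : s + h ^+ 2 <= 2 * h.
    have : h ^+ 2 <= h by rewrite expr2 ler_piMl// ltW.
    by move: s_le; lra.
  have := ler_wpM2l k3C sh; rewrite -mulrA => q; apply: le_trans q _.
  have := mulr_ge0 k3C (ltW h_gt0); have := h_gt0; lra.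
have q3 : C1 * (s / g) <= flow / 4.
  have := le_trans sg g4; rewrite ler_pdivlMr ?mulr_gt0// => q.
  lra.
lra.
Qed.

Hypothesis h_le1 : h <= 1.

Let h_gt0 : 0 < h. Proof. exact: lt_le_trans s_gt0 s_le. Qed.

Let g_le1 : g <= 1.
Proof. by rewrite -(@ler_sqr _ g 1) ?nnegrE ?ler01 ?(ltW g_gt0)// g_sqr expr1n. Qed.

Lemma remainder_rate_Jh :
  k3 * (C0 * (s + h ^+ 2)) ^+ 2 + C1 * (C0 * (s + h ^+ 2) * (s / g)) <=
  (2 * k3 * C0 ^+ 2 + C1 * C0 + 1) * (s ^+ 2 / g + g ^+ 3 * s + h ^+ 4).
Proof.
set A := s ^+ 2 / g; set B := g ^+ 3 * s; set D := h ^+ 4.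
have A0 : 0 <= A by rewrite divr_ge0 ?sqr_ge0// ltW.
have B0 : 0 <= B by rewrite mulr_ge0 ?exprn_ge0 ?ltW.
have D0 : 0 <= D by rewrite exprn_ge0// ltW.
have P0 : 0 <= k3 * C0 ^+ 2 by rewrite mulr_ge0 ?sqr_ge0.
have Q0 : 0 <= C1 * C0 by rewrite mulr_ge0 ?ltW.
have E1 : C1 * (C0 * (s + h ^+ 2) * (s / g)) = C1 * C0 * (A + B).
  by rewrite /A /B -g_sqr; field; rewrite gt_eqF.
have sA : s ^+ 2 <= A by rewrite /A ler_pdivlMr// ler_piMr// sqr_ge0.
have E2 : (s + h ^+ 2) ^+ 2 <= 2 * (A + D).
  have := sqr_ge0 (s - h ^+ 2); rewrite sqrrB sqrrD -exprM -/D; move: sA; lra.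
rewrite E1 exprMn mulrA.
have q1 := ler_wpM2l P0 E2; have q2 := mulr_ge0 P0 B0; have q3 := mulr_ge0 Q0 D0.
rewrite -[leRHS]/((2 * k3 * C0 ^+ 2 + C1 * C0 + 1) * (A + B + D)).
by rewrite -[2 * k3 * _]mulrA; lra.
Qed.

(** The additional term has the rate [h rho], and [h <= 1] makes the other rates
    smaller than those of the conclusion. *)
Lemma remainder_rate_J :
  k3 * (C0 * (s + h ^+ 2)) ^+ 2 + C1 * (C0 * (s + h ^+ 2) * (s / g)) +
    k1 * h * (C0 * (s + h ^+ 2)) <=
  (2 * k3 * C0 ^+ 2 + C1 * C0 + 1 + k1 * C0) * (s ^+ 2 / g + h * s + h ^+ 3).
Proof.
have M0 : 0 <= 2 * k3 * C0 ^+ 2 + C1 * C0 + 1.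
  by rewrite !addr_ge0// !mulr_ge0 ?sqr_ge0// ltW.
rewrite mulrDl; apply: lerD.
  apply: le_trans remainder_rate_Jh _; rewrite ler_wpM2l// -!addrA lerD2l; apply: lerD.
    by rewrite ler_wpM2r ?(ltW s_gt0)// -g_sqr ler_wiXn2l// ltW.
  by rewrite ler_wiXn2l// ltW.
rewrite (_ : k1 * h * _ = k1 * C0 * (h * s + h ^+ 3)); last by ring.
rewrite ler_wpM2l ?mulr_ge0 ?(ltW C0_gt0)// -addrA lerDr.
by rewrite divr_ge0 ?sqr_ge0// ltW.
Qed.

End Rates.

Section Transfer.
Context d d1 d2 (T : measurableType d) (S1 : measurableType d1) (S2 : measurableType d2).
Context (R : realType) (P : probability T R) (phi : S1 -> S2).
Hypothesis mphi : measurable_fun setT phi.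

Let mpre A : measurable A -> measurable (phi @^-1` A).
Proof. by move=> mA; rewrite -[_ @^-1` _]setTI; exact: mphi. Qed.

Lemma same_law_comp (Z Z' : T -> S1) : same_law P Z Z' -> same_law P (phi \o Z) (phi \o Z').
Proof. by move=> ZZ' A mA; exact: (ZZ' _ (mpre mA)). Qed.

Lemma mutually_independent_comp n (Z : 'I_n -> T -> S1) :
  mutually_independent P Z -> mutually_independent P (fun i => phi \o Z i).
Proof. by move=> indep I A mA; apply: (indep I (fun i => phi @^-1` A i)) => i; exact: mpre. Qed.

End Transfer.

Section Measurability.
Context d (T : measurableType d) (R : realType) (p n : nat).

Lemma measurable_dot (u v : T -> 'cV[R]_p) :
  (forall j, measurable_fun setT (fun w => u w j 0)) ->
  (forall j, measurable_fun setT (fun w => v w j 0)) ->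
  measurable_fun setT (fun w => dot (u w) (v w)).
Proof. by move=> mu mv; apply: measurable_sum => j; exact: measurable_funM. Qed.

Lemma measurable_noise (X : T -> p.-tuple R) (Y : T -> R) b :
  measurable_fun setT X -> measurable_fun setT Y -> measurable_fun setT (noise X Y b).
Proof.
move=> mX mY; apply: measurable_funB => //; apply: measurable_dot => // j.
rewrite (_ : (fun w => _) = (fun w => tnth (X w) j)).
  exact: (measurableT_comp (measurable_tnth j) mX).
by apply/funext => w; rewrite mxE.
Qed.

Lemma measurable_norm2 (u : T -> 'cV[R]_p) :
  (forall j, measurable_fun setT (fun w => u w j 0)) ->
  measurable_fun setT (fun w => norm2 (u w)).
Proof.
move=> mu; apply: (@measurableT_comp _ _ _ _ _ _ (@Num.sqrt R)); last exact: measurable_dot.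
by apply: continuous_measurable_fun; exact: sqrt_continuous.
Qed.

Lemma measurable_bahadur_remainder (Xs : 'I_n -> T -> p.-tuple R) (Ys : 'I_n -> T -> R)
    (S J : 'M[R]_p) (betastar : 'cV[R]_p) (betahat : T -> 'cV[R]_p)
    (K : R -> R) (kap1 kap2 kapu h tau : R) :
  (forall i, measurable_fun setT (Xs i)) -> (forall i, measurable_fun setT (Ys i)) ->
  (forall j, measurable_fun setT (fun w => betahat w j 0)) ->
  kernel_assumption K kap1 kap2 kapu -> 0 < h ->
  measurable_fun setT (bahadur_remainder tau K h Xs Ys S J betastar betahat).
Proof.
move=> mXs mYs mb HK h_gt0; apply: measurable_norm2 => j.
under eq_fun => w do rewrite mxE [X in _ + X]mxE.
apply: measurable_funB.
  under eq_fun => w do rewrite mxE.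
  apply: measurable_sum => k; apply: measurable_funM => //.
  under eq_fun => w do rewrite mxE [X in _ + X]mxE.
  exact: measurable_funB.
have mes i : measurable_fun setT (noise (Xs i) (Ys i) betastar) by exact: measurable_noise.
apply: (@measurable_emp_mean _ _ _ _ _ S Xs _ mXs mes (score K h tau)).
exact: measurable_score HK h_gt0.
Qed.

End Measurability.

(** * The Bahadur representation *)

Lemma probability_ge_compl d (T : measurableType d) (R : realType) (P : probability T R)
    (A Bad : set T) (eta : R) :
  measurable A -> measurable Bad -> (P Bad <= eta%:E)%E -> ~` Bad `<=` A ->
  ((1 - eta)%:E <= P A)%E.
Proof.
move=> mA mB PB BA; apply: (@le_trans _ _ (P (~` Bad))).
  rewrite (probability_setC P mB) EFinB; exact: leeB.
by apply: le_measure => //; rewrite inE//; exact: measurableC.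
Qed.

Theorem theorem4p2 (R : realType) (ups1 kap2 kapu l0 fbar flow : R)
    (ups1_gt0 : 0 < ups1) (l0_gt0 : 0 < l0) (fbar_gt0 : 0 < fbar)
    (flow_gt0 : 0 < flow) :
  exists C : R, 0 < C /\
  forall tau kap1 : R, 0 < tau < 1 ->
  exists c1 c2 C' : R, [/\ 0 < c1, 0 < c2 & 0 < C'] /\
  forall (d : measure_display) (T : measurableType d) (P : probability T R)
    (p n : nat) (X : {RV P >-> p.-tuple R}) (Y : {RV P >-> R})
    (Xs : 'I_n -> {RV P >-> p.-tuple R}) (Ys : 'I_n -> {RV P >-> R})
    (betastar : 'cV[R]_p) (f : p.-tuple R -> R -> R) (S : 'M[R]_p)
    (K : R -> R) (h t : R) (betahat : T -> 'cV[R]_p),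
  (2 <= p)%N -> (0 < n)%N ->
  let eps := noise X Y betastar in
  design_assumption P X ->
  is_inv_sqrtmx (Sigma_mx P X) S ->
  cond_prob P X [set w | eps w <= 0] (fun=> tau%:E) ->
  cond_density P X eps f ->
  (forall i, same_law P (fun w => (Ys i w, Xs i w)) (fun w => (Y w, X w))) ->
  mutually_independent P (fun i w => (Ys i w, Xs i w)) ->
  kernel_assumption K kap1 kap2 kapu ->
  density_assumption P X f flow l0 fbar ->
  subgaussian_design P X S ups1 ->
  (forall j, measurable_fun setT (fun w => betahat w j 0)) ->
  (forall w, is_minimizer
    (smooth_risk tau K h (fun i => Ys i w) (fun i => vec (Xs i w)))
    (betahat w)) ->
  0 < t -> 0 < h ->
  let r := (p%:R + t) / n%:R in
  c1 * flow^-1 * Num.sqrt (m3 P X S) * ups1 * Num.sqrt r <= h ->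
  h <= c2 * flow * (Num.sqrt (m3 P X S))^-1 ->
  ((1 - 3 * expR (- t))%:E <=
    P [set w | (bahadur_remainder tau K h Xs Ys S (Jh_mx P X eps K h)
                  betastar betahat w
      <= C * (r / Num.sqrt h + h `^ (3 / 2) * Num.sqrt r + h ^+ 4))%R])%E
  /\
  ((1 - 3 * expR (- t))%:E <=
    P [set w | (bahadur_remainder tau K h Xs Ys S (J_mx P X f)
                  betastar betahat w
      <= C' * (r / Num.sqrt h + h * Num.sqrt r + h ^+ 3))%R])%E.
Proof.
(* The absolute values make the constants positive before a kernel is known; the
   moments of a kernel are nonnegative. *)
pose kb := `|kapu| + 1; pose b := (2 * (8 * ups1 ^+ 2))^-1.
pose C1 := 120 * (1 + kb * fbar * mom4 ups1); pose C2 := 120 * (1 + mom5 ups1).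
pose C0 := 1 + 2 / flow * (C2 + l0 * `|kap2| * mom1 ups1).
pose k3 := l0 * mom3 ups1.
have m1 := ltW (mom1_gt0 ups1_gt0); have m2 := ltW (mom2_gt0 ups1_gt0).
have mu3 := ltW (mom3_gt0 ups1_gt0); have m4 := ltW (mom4_gt0 ups1_gt0).
have m5 := ltW (mom5_gt0 ups1_gt0).
have kb_gt0 : 0 < kb by rewrite ltr_wpDl.
have b_gt0 : 0 < b by rewrite invr_gt0 !mulr_gt0// exprn_gt0.
have C1_gt0 : 0 < C1.
  have : 0 <= kb * fbar * mom4 ups1 by exact: mulr_ge0 (mulr_ge0 (ltW kb_gt0) (ltW fbar_gt0)) m4.
  by move=> q; rewrite /C1 mulr_gt0// ltr_wpDr.
have C2_gt0 : 0 < C2 by rewrite /C2 mulr_gt0// ltr_wpDr.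
have C0_gt0 : 0 < C0.
  have : 0 <= l0 * `|kap2| * mom1 ups1 by exact: mulr_ge0 (mulr_ge0 (ltW l0_gt0) (normr_ge0 _)) m1.
  by move=> q; rewrite /C0 addr_gt0//; apply: mulr_gt0; rewrite ?divr_gt0// ltr_wpDr.
have k3_ge0 : 0 <= k3 by exact: mulr_ge0 (ltW l0_gt0) mu3.
pose C := 2 * k3 * C0 ^+ 2 + C1 * C0 + 1.
have C_gt0 : 0 < C.
  have : 0 <= 2 * k3 * C0 ^+ 2 by rewrite mulr_ge0 ?sqr_ge0// mulr_ge0.
  by move=> q; rewrite /C ltr_wpDl// addr_ge0// ltW// mulr_gt0.
exists C; split=> // tau kap1 tau01.
pose k1 := l0 * `|kap1| * mom2 ups1.
have k1_ge0 : 0 <= k1 by exact: mulr_ge0 (mulr_ge0 (ltW l0_gt0) (normr_ge0 _)) m2.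
pose cap := bandwidth_cap flow k1 k3 C0 C1 kb b.
have cap_gt0 : 0 < cap by exact: bandwidth_cap_gt0.
(* For these values the two bounds on [h] read [sqrt m3 * s <= h] and
   [h <= cap / sqrt m3]. *)
exists (flow / ups1), (cap / flow), (C + k1 * C0); split.
  by split; rewrite ?divr_gt0// ltr_wpDr// mulr_ge0// ltW.
move=> d T P p n X Y Xs Ys betastar f S K h t betahat p_ge2 n_gt0 eps [_ _ _ Sigma_pos] S_sqrt
  tauP ef lawZ indepZ HK dens sgX mb bmin t_gt0 h_gt0 r h_ge h_le.
have p_gt0 : (0 < p)%N by exact: ltn_trans p_ge2.
have mX : measurable_fun setT X by exact: measurable_funPT.
have mY : measurable_fun setT Y by exact: measurable_funPT.
have mXs i : measurable_fun setT (Xs i) by exact: measurable_funPT.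
have mYs i : measurable_fun setT (Ys i) by exact: measurable_funPT.
have n0 : 0 < n%:R :> R by rewrite ltr0n.
have r_gt0 : 0 < r by rewrite divr_gt0// addr_gt0// ltr0n.
pose s := Num.sqrt r; pose g := Num.sqrt h.
have s_gt0 : 0 < s by rewrite sqrtr_gt0.
have g_gt0 : 0 < g by rewrite sqrtr_gt0.
have s_sqr : s ^+ 2 = r by rewrite sqr_sqrtr// ltW.
have g_sqr : g ^+ 2 = h by rewrite sqr_sqrtr// ltW.
have M_ge1 : 1 <= Num.sqrt (m3 P X S).
  by rewrite -(sqrtr1 R) ler_wsqrtr// (m3_ge1 mX ups1_gt0 sgX Sigma_pos S_sqrt).
have M_gt0 : 0 < Num.sqrt (m3 P X S) by exact: lt_le_trans M_ge1.
have s_le : s <= h.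
  apply: le_trans h_ge; rewrite -/s.
  rewrite (_ : _ * _ * _ * ups1 * s = Num.sqrt (m3 P X S) * s); last first.
    by field; rewrite !gt_eqF.
  by rewrite ler_peMl// ltW.
have h_cap : h <= cap.
  by apply: le_trans h_le _; rewrite divfK ?gt_eqF// ler_pdivrMr// ler_peMr// ltW.
have [h_le1 s_small sg_small] :=
  bandwidth_cap_small flow_gt0 k1_ge0 k3_ge0 C0_gt0 C1_gt0 kb_gt0 b_gt0 s_gt0 s_le g_gt0 g_sqr h_cap.
have kap1E : `|kap1| = kap1 := ger0_norm (kernel_moment1_ge0 HK).
have kap2E : `|kap2| = kap2 := ger0_norm (kernel_moment2_ge0 HK).
have kapu_le : kapu <= kb.
  by apply: le_trans (ler_norm _) _; rewrite lerDl.
have rateh := remainder_rate_Jh k3_ge0 C0_gt0 C1_gt0 s_gt0 s_le g_gt0 g_sqr h_le1.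
have rate := remainder_rate_J k1_ge0 k3_ge0 C0_gt0 C1_gt0 s_gt0 s_le g_gt0 g_sqr h_le1.
move=> curv.
pose phi (z : R * p.-tuple R) := (z.2, z.1 - dot (vec z.2) betastar).
have mphi : measurable_fun setT phi.
  apply: measurable_fun_pair; first exact: measurable_snd.
  exact: (measurable_noise betastar measurable_snd measurable_fst).
have s_sqr' : s ^+ 2 * n%:R = p%:R + t by rewrite s_sqr divfK// gt_eqF.
have [] := @bahadur_bounds _ _ _ P p n p_gt0 n_gt0 X Y f S Xs Ys betastar K kap1 kap2 kapu
  h ups1 tau l0 fbar flow kb t s g mX (measurable_noise betastar mX mY) mXs
  (fun i => measurable_noise betastar (mXs i) (mYs i))
  (fun i => same_law_comp mphi (lawZ i)) (mutually_independent_comp mphi indepZ)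
  ef HK h_gt0 ups1_gt0 sgX Sigma_pos S_sqrt dens l0_gt0 fbar_gt0 flow_gt0 tau01 tauP
  kb_gt0 kapu_le t_gt0 s_gt0 g_gt0 s_sqr' g_sqr s_small sg_small _.
  rewrite -kap2E -/C2 -/C0 -/C1 -/k3; apply: le_trans curv.
  by rewrite /k1 kap1E !lerD2r (_ : l0 * kap1 * mom2 ups1 * h = l0 * h * kap1 * mom2 ups1)//; ring.
move=> Bad [mBad PBad HBad]; rewrite -kap2E -/C2 -/C0 -/C1 in HBad.
have PBad3 : (P Bad <= (3 * expR (- t))%:E)%E.
  apply: le_trans PBad _; rewrite lee_fin ler_wpM2r ?expR_ge0//; lra.
have event (J : 'M[R]_p) M : measurable
    [set w | bahadur_remainder tau K h Xs Ys S J betastar betahat w <= M].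
  rewrite -[X in measurable X]setTI; apply: measurable_fun_le => //.
  exact: (measurable_bahadur_remainder S J betastar tau mXs mYs mb HK h_gt0).
split; apply: probability_ge_compl mBad PBad3 _ => // w nB /=.
- have [+ _] := HBad w betahat nB (bmin w); move/le_trans; apply.
  have -> : h `^ (3 / 2) = g ^+ 3.
    by rewrite mulrC powRrM powR12_sqrt ?(ltW h_gt0)// powR_mulrn// sqrtr_ge0.
  by rewrite -/g -/s -s_sqr; apply: le_trans rateh; rewrite /k3 [l0 * _ * _]mulrAC.
- have [_ +] := HBad w betahat nB (bmin w); move/le_trans; apply.
  rewrite -/g -/s -s_sqr; apply: le_trans rate; rewrite /k3 /k1 kap1E.
  by rewrite [l0 * _ ^+ 2 * _]mulrAC (_ : l0 * h * kap1 * _ = l0 * kap1 * mom2 ups1 * h)//; ring.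
Qed.
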